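(* Suppose $\nu_0=\nu_N$. Let $0\le x<y\le N$ with $y-x\in\{2,4,\dots,\rho\}$. Then there exists a coupling $(X,Y)$ for $p$ with $(X_0,Y_0)=(x,y)$ whose coupling time $\tau=\inf\{t:X_t=Y_t\}$ is stochastically dominated by the sum of at most $5$ independent copies of $T(N/2)$; that is, there is $m\le 5$ such that, if $T_1,\dots,T_m$ are independent and each distributed as $T(N/2)$, then $P_{x,y}(\tau>t)\le P(T_1+\dots+T_m>t)$ for all $t\in\mathbb{Z}_+$.
   Context: Let $N\in 4\mathbb{N}$ and $\mathcal{S}_N=\{0,\dots,N\}$. Let $\nu_0$ and $\nu_N$ be probability distributions both supported on the odd integers $\{3,5,\dots,N-3\}$ (also viewed as probability mass functions). The transition function $p$ on $\mathcal{S}_N$ is $$p(x,y)=\begin{cases}\frac12 & x=y\\ \frac14 & |x-y|=1\\ \frac14\nu_x(y) & x\in\{0,N\},\ |y-x|>1\end{cases}$$ and $p(x,y)=0$ otherwise. Define $\rho=2\left\lfloor \tfrac12\min\{x,N-x:\nu_0(x)+\nu_N(x)>0\}\right\rfloor$. A coupling for $p$ is an $\mathcal{S}_N^2$-valued process $(X,Y)=\{(X_n,Y_n):n\in\mathbb{Z}_+\}$ such that both marginal processes $X$ and $Y$ are Markov chains with transition function $p$ (the pair itself need not be Markov). Only coalescing couplings are considered: if $X_n=Y_n$ for some $n$, then $X_k=Y_k$ for all $k\ge n$. $P_{x,y}$ denotes the law of $(X,Y)$ with $X_0=x$, $Y_0=y$. For a positive integer $L$, $T(L)$ denotes a random variable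 distributed as the first exit time $\inf\{n:Z_n\notin\{1,\dots,L\}\}$, where $Z$ is the lazy random walk on $\mathbb{Z}$ (at each step it stays put with probability $\frac12$ and moves to each of the two neighbors with probability $\frac14$) started from $Z_0=\lfloor (L+1)/2\rfloor$. *)

(* Defs.v *)
From HB Require Import structures.
From mathcomp Require Export all_boot all_order all_algebra.
From mathcomp Require Export all_classical all_reals all_analysis.
From mathcomp Require Export measurable_realfun.

Set Implicit Arguments.
Unset Strict Implicit.
Unset Printing Implicit Defensive.

Import Order.TTheory GRing.Theory Num.Theory.

Local Open Scope classical_set_scope.
Local Open Scope ring_scope.

(* [inf A] for a set of times [A], with value [+oo] when [A] is empty. *)
Definition first_time (R : realType) (A : set nat) : \bar R :=
  ereal_inf [set n%:R%:E | n in A].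

(* The Markov property with respect to the natural filtration of [X], written
   without division so that conditioning on null events is vacuous. Since [S]
   is countable, measurability of the fibres is discrete measurability. *)
Definition markov_chain (R : realType) (S : countType) (q : S -> S -> R)
    (d : measure_display) (Om : measurableType d) (P : probability Om R)
    (X : nat -> Om -> S) : Prop :=
  (forall n a, measurable [set w | X n w = a]) /\
  (forall (n : nat) (s : nat -> S),
     P [set w | forall i, (i <= n.+1)%N -> X i w = s i] =
     (P [set w | forall i, (i <= n)%N -> X i w = s i]
        * (q (s n) (s n.+1))%:E)%E).

(* The pair [(X, Y)] itself need not be Markov. *)
Definition coalescing_coupling (R : realType) (S : countType) (q : S -> S -> R)
    (d : measure_display) (Om : measurableType d) (P : probability Om R)
    (X Y : nat -> Om -> S) : Prop :=
  [/\ markov_chain q P X, markov_chain q P Y &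
      forall w n, X n w = Y n w -> forall k, (n <= k)%N -> X k w = Y k w].

Definition coupling_time (R : realType) (S Om : Type) (X Y : nat -> Om -> S)
    (w : Om) : \bar R :=
  first_time R [set n | X n w = Y n w].

(* A probability mass function on {0,...,N} carried by (not necessarily
   charging all of) the odd integers {3,5,...,N-3}. *)
Definition inner_odd_pmf (R : realType) (N : nat) (nu : 'I_N.+1 -> R) : Prop :=
  [/\ forall z, 0 <= nu z,
      \sum_z nu z = 1 &
      forall z : 'I_N.+1, 0 < nu z ->
        [&& odd z, (3 <= z)%N & (z + 3 <= N)%N]].

Definition trans (R : realType) (N : nat) (nu0 nuN : 'I_N.+1 -> R)
    (x y : 'I_N.+1) : R :=
  if x == y then 1 / 2
  else if (x.+1 == y :> nat) || (y.+1 == x :> nat) then 1 / 4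
  else if x == 0%N :> nat then 1 / 4 * nu0 y
  else if x == N :> nat then 1 / 4 * nuN y
  else 0.

(* The default value [N] of the minimum bounds every [z] and [N - z], so it
   plays no role when the index set is nonempty. *)
Definition rho (R : realType) (N : nat) (nu0 nuN : 'I_N.+1 -> R) : nat :=
  (\big[minn/N]_(z : 'I_N.+1 | (0 < nu0 z + nuN z)%R) minn z (N - z))./2.*2.

Definition lazy_step (R : realType) (a b : int) : R :=
  if a == b then 1 / 2
  else if (b == a + 1) || (b == a - 1) then 1 / 4
  else 0.

Definition exit_time (R : realType) (L : nat) (Om : Type)
    (Z : nat -> Om -> int) (w : Om) : \bar R :=
  first_time R [set n | ~ (1 <= Z n w <= L%:Z)].

Definition distributed_as_T (R : realType) (L : nat)
    (d : measure_display) (Om : measurableType d) (P : probability Om R)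
    (T : Om -> \bar R) : Prop :=
  exists (d' : measure_display) (Om' : measurableType d')
         (P' : probability Om' R) (Z : nat -> Om' -> int),
    [/\ markov_chain (lazy_step R) P' Z,
        forall w, Z 0%N w = ((L.+1)./2)%:Z &
        forall B : set (\bar R), measurable B ->
          P (T @^-1` B) = P' (exit_time R L Z @^-1` B)].

(* Taking some of the [B i] to be [setT] gives the product rule for every
   subfamily. *)
Definition mutually_independent (R : realType) (m : nat)
    (d : measure_display) (Om : measurableType d) (P : probability Om R)
    (T : 'I_m -> Om -> \bar R) : Prop :=
  forall B : 'I_m -> set (\bar R), (forall i, measurable (B i)) ->
    P [set w | forall i, B i (T i w)] = (\prod_(i < m) P (T i @^-1` B i))%E.

(* Main.v *)
Require Import Defs.
From mathcomp Require Import ring lra zify.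

Set Implicit Arguments.
Unset Strict Implicit.
Unset Printing Implicit Defensive.

Import Order.TTheory GRing.Theory Num.Theory numFieldNormedType.Exports.

Local Open Scope classical_set_scope.
Local Open Scope ring_scope.

(* Put the sites 0, ..., N of the chain at the points 1, ..., N + 1 of a circle of length 2H,
   where H = N/2 + 1: away from the marked point 0 = 2H the chain is a lazy walk, and a step
   onto the marked point is redirected according to nu. Steering the pair at its visits to
   the marked point biases one of the two marginal laws, so the coupling is not built step
   by step. Instead, the total variation distance of the laws of X_t and Y_t is bounded by
   P(T_1 + ... + T_5 > t), and a maximal coupling is used: the coupling time and the two
   trajectories up to it are drawn first, the trajectories independently given the place
   where they meet, and are followed by one common trajectory.

   Let F_t be the image of a [0, 1]-valued function under t steps, with F_t(0) the mean of
   F_t under nu, and let h = y - x. For x <= H - h/2 the difference F_t(x) - F_t(x + h)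
   solves the heat equation; at the right end it is a difference of mirror images, which
   vanishes when either of them reaches 0 or H. So it suffices to bound the value at x = 0
   by b_4(t), where b_m(t) = P(T_1 + ... + T_m > t).
   - If b_2(t) >= 1/4: F_t(0) - F_t(h) is the mean over z of F_t(z) - F_t(h). Moving from
     (z, h) as mirror images and then, at distance z, in parallel leaves a mean of
     p(z) (F(z) - nu F) with 0 <= p <= P, which is at most P/4 since F takes values in
     [0, 1]. This gives 1/4 + 3/4 b_2 <= 1 - (1 - b_2)^2 <= b_4.
   - If b_2(t) < 1/4: the odd part of F decays like the Dirichlet semigroup. The even part
     is compared with the chain that always jumps to H - 1. By the Duhamel formula the
     difference is governed by the impulse responses of the marked point, which are
     ordered because the jump point dominates the points near it. With the leading
     Dirichlet eigenvalue lam = kap^2 the total is at most (6 / kap + 3) lam^t, and this is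
     at most b_4(t) because t is large. *)

(** * The heat equation on an interval *)

(** Neither regime covers all times. The small-time bound 1/4 + 3/4 b_2 never drops below 1/4. The
    spectral bound has a constant above 1, so it needs t so large that the polynomial factor of
    b_4(t) / lam^t has outgrown that constant. Parity is used throughout. Since 4 divides N, H is
    odd, while all jump targets are even points of the circle. Hence h and the targets are even,
    mirror images meet on a site, and H - 1 is an even point next to the antipode of the marked
    point. Differences for the chain jumping to H - 1 live on strips of about half the length H,
    where a cosine of frequency pi / H stays positive and serves as a barrier with eigenvalue lam.
    In the Duhamel sum the differences of impulse responses at h and 0 must be summed against lam^s.
    Because they have one sign, no absolute values are lost, and the sum can be read off from a
    single test function, again an eigenfunction for lam. The fifth copy of T pays for the time
    until the parallel pair leaves its strip; the other four pay for a pair sitting at 0 and h. *)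

Definition heat (R : realType) (f : nat -> R) (x : nat) : R :=
  f x / 2 + f x.-1 / 4 + f x.+1 / 4.

Lemma max_principle (R : realType) (n : nat) (W : nat -> nat -> R) :
  (forall x, (0 < x < n)%N -> W 0%N x <= 0) ->
  (forall t, W t 0%N <= 0) -> (forall t, W t n <= 0) ->
  (forall t x, (0 < x < n)%N -> W t.+1 x <= heat (W t) x) ->
  forall t x, (x <= n)%N -> W t x <= 0.
Proof.
move=> init left right step; elim=> [|t IHt] x xn.
  case: (posnP x) => [->//|x0]; case: (ltngtP x n) xn => // [xn _|-> _//].
  by apply: init; rewrite x0.
case: (posnP x) => [->//|x0]; case: (ltngtP x n) xn => // [xn _|-> _//].
apply: le_trans (step t x _) _; first by rewrite x0.
have h1 := IHt x (ltnW xn); have h2 := IHt x.+1 xn.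
have h3 := IHt x.-1 (leq_trans (leq_pred _) (ltnW xn)).
by rewrite /heat; lra.
Qed.

(** When [b] is nonincreasing with values in [0, 1], this is P(tau + B > t), where tau is the exit
    time from (0, H) of the lazy walk started at [x] and B is an independent time with P(B > t) = b
    t. *)
Fixpoint dir (R : realType) (H : nat) (b : nat -> R) (t x : nat) {struct t} : R :=
  if (0 < x < H)%N then (if t is t'.+1 then heat (dir H b t') x else 1) else b t.

Section Dirichlet.
Context (R : realType) (H : nat).
Implicit Type b : nat -> R.

Lemma dir0E b x : (0 < x < H)%N -> dir H b 0 x = 1.
Proof. by move=> /= ->. Qed.

Lemma dirS b t x : (0 < x < H)%N -> dir H b t.+1 x = heat (dir H b t) x.
Proof. by move=> /= ->. Qed.

Lemma dir_out b t x : ~~ (0 < x < H)%N -> dir H b t x = b t.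
Proof. by case: t => [|t] /= /negbTE ->. Qed.

Lemma dir_left b t : dir H b t 0 = b t.
Proof. exact: dir_out. Qed.

Lemma dir_right b t : dir H b t H = b t.
Proof. by apply: dir_out; rewrite ltnn andbF. Qed.

Lemma dir_sub b (W : nat -> nat -> R) :
  (forall x, (0 < x < H)%N -> W 0%N x <= 1) ->
  (forall t, W t 0%N <= b t) -> (forall t, W t H <= b t) ->
  (forall t x, (0 < x < H)%N -> W t.+1 x <= heat (W t) x) ->
  forall t x, (x <= H)%N -> W t x <= dir H b t x.
Proof.
move=> i l r s t x xH; rewrite -subr_le0.
apply: (@max_principle R H (fun t x => W t x - dir H b t x)) => //.
- by move=> y yH; rewrite dir0E// subr_le0 i.
- by move=> u; rewrite dir_left subr_le0.
- by move=> u; rewrite dir_right subr_le0.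
- move=> u y yH; rewrite dirS//; have := s u y yH; rewrite /heat; lra.
Qed.

Lemma dir_super b n (W : nat -> nat -> R) : (n <= H)%N ->
  (forall x, (0 < x < n)%N -> W 0%N x <= 1) ->
  (forall t, W t 0%N <= b t) -> (forall t, W t n <= dir H b t n) ->
  (forall t x, (0 < x < n)%N -> W t.+1 x <= heat (W t) x) ->
  forall t x, (x <= n)%N -> W t x <= dir H b t x.
Proof.
move=> nH i l r s t x xn; rewrite -subr_le0.
have inH y : (0 < y < n)%N -> (0 < y < H)%N by lia.
apply: (@max_principle R n (fun t x => W t x - dir H b t x)) => //.
- by move=> y yn; rewrite dir0E ?inH// subr_le0 i.
- by move=> u; rewrite dir_left subr_le0.
- by move=> u; rewrite subr_le0.
- move=> u y yn; rewrite dirS ?inH//; have := s u y yn; rewrite /heat; lra.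
Qed.

Lemma dir_sym b t x : (x <= H)%N -> dir H b t (H - x) = dir H b t x.
Proof.
elim: t x => [|t IHt] x xH.
  by rewrite /=; case: (boolP (0 < x < H)%N); case: (boolP (0 < H - x < H)%N) => //; lia.
case: (boolP (0 < x < H)%N) => x0; last first.
  by rewrite !dir_out//; lia.
rewrite !dirS//; last lia.
rewrite /heat IHt//.
have -> : (H - x).-1 = (H - x.+1)%N by lia.
have -> : (H - x).+1 = (H - x.-1)%N by lia.
rewrite !IHt//; try lia.
by ring.
Qed.

Definition survival b := (forall t, b t.+1 <= b t) /\ (forall t, 0 <= b t <= 1).

Variable b : nat -> R.
Hypothesis bS : survival b.

Lemma survival_le s t : (s <= t)%N -> b t <= b s.
Proof.
elim: t => [|t IHt]; first by rewrite leqn0 => /eqP ->.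
rewrite leq_eqVlt => /orP[/eqP->//|/IHt]; apply: le_trans; exact: bS.1.
Qed.

Lemma dir_ge t x : b t <= dir H b t x.
Proof.
elim: t x => [|t IHt] x.
  by rewrite /=; case: ifP => // _; case/andP: (bS.2 0%N).
case: (boolP (0 < x < H)%N) => x0; last by rewrite dir_out.
rewrite dirS// /heat; have := bS.1 t.
have := IHt x; have := IHt x.-1; have := IHt x.+1; lra.
Qed.

Lemma dir_le1 t x : dir H b t x <= 1.
Proof.
elim: t x => [|t IHt] x.
  by rewrite /=; case: ifP => // _; case/andP: (bS.2 0%N).
case: (boolP (0 < x < H)%N) => x0; last by rewrite dir_out//; case/andP: (bS.2 t.+1).
rewrite dirS// /heat; have := IHt x; have := IHt x.-1; have := IHt x.+1; lra.
Qed.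

Lemma dir_ge0 t x : 0 <= dir H b t x.
Proof. by apply: le_trans (dir_ge t x); case/andP: (bS.2 t). Qed.

Lemma dir_noninc t x : dir H b t.+1 x <= dir H b t x.
Proof.
elim: t x => [|t IHt] x.
  case: (boolP (0 < x < H)%N) => x0; last by rewrite !dir_out// bS.1.
  by rewrite dir0E// dir_le1.
case: (boolP (0 < x < H)%N) => x0; last by rewrite !dir_out// bS.1.
rewrite [leLHS]dirS// [leRHS]dirS// /heat.
have := IHt x; have := IHt x.-1; have := IHt x.+1; lra.
Qed.

Lemma dir_survival x : survival (fun t => dir H b t x).
Proof. by split=> t; [exact: dir_noninc | rewrite dir_ge0 dir_le1]. Qed.

(** Induction on time: a new increment averages three old increments. Near the centre the last of
    them is turned back by the symmetry about H/2; at the left end [b t] is a lower bound of all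
    values. *)
Lemma dir_unimodal t x : (x.*2 < H)%N -> dir H b t x <= dir H b t x.+1.
Proof.
elim: t x => [|t IHt] x xH.
  case: (boolP (0 < x.+1 < H)%N) => x1; first by rewrite [leRHS]dir0E ?dir_le1.
  by rewrite !dir_out//; lia.
case: (boolP (0 < x.+1 < H)%N) => x1; last by rewrite !dir_out//; lia.
case: (posnP x) => [x0|x0].
  rewrite {}x0 in x1 *; rewrite dir_left dirS// /heat /= dir_left.
  have := bS.1 t; have := dir_ge t 1; have := dir_ge t 2; lra.
have xin : (0 < x < H)%N by lia.
rewrite !dirS// /heat /=.
have h1 := IHt x.-1; have h2 := IHt x xH; have h3 := IHt x.+1.
rewrite prednK// in h1.
have {}h1 : dir H b t x.-1 <= dir H b t x by apply: h1; lia.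
case: (ltnP x.+1.*2 H) => xl.
  have := h3 xl; lra.
case: (eqVneq x.+1.*2 H) => xe.
  have -> : dir H b t x.+2 = dir H b t x.
    by rewrite -(@dir_sym b t x); [congr dir|]; lia.
  lra.
have e1 : dir H b t x.+1 = dir H b t x.
  by rewrite -(@dir_sym b t x); [congr dir|]; lia.
have -> : dir H b t x.+2 = dir H b t x.-1.
  by rewrite -(@dir_sym b t x.-1); [congr dir|]; lia.
rewrite e1; lra.
Qed.

(** [H./2] is the starting point in the definition of T(H - 1), so one copy of T dominates the exit
    from any starting point. *)
Lemma dir_le_center t x : dir H b t x <= dir H b t H./2.
Proof.
have low y : (y <= H./2)%N -> dir H b t y <= dir H b t H./2.
  move=> yH; rewrite -(subKn yH); elim: (H./2 - y)%N (leq_subr y H./2) => [|k IH] kH.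
    by rewrite subn0.
  apply: le_trans (IH (ltnW kH)).
  have -> : (H./2 - k = (H./2 - k.+1).+1)%N by lia.
  by apply: dir_unimodal; lia.
case: (leqP x H./2) => xH; first exact: low.
case: (leqP x H) => xH2; last first.
  by rewrite dir_out ?dir_ge//; lia.
by rewrite -dir_sym// low//; lia.
Qed.

End Dirichlet.

Lemma dir_le (R : realType) (H : nat) (b b' : nat -> R) : (forall t, b t <= b' t) ->
  forall t x, (x <= H)%N -> dir H b t x <= dir H b' t x.
Proof.
move=> bb'; apply: dir_sub => [x xH|t|t|t x xH].
- by rewrite dir0E.
- by rewrite dir_left.
- by rewrite dir_right.
- by rewrite dirS.
Qed.

(* [tail H m t] is P(T_1 + ... + T_m > t) for independent copies T_i of T(H - 1). *)
Fixpoint tail (R : realType) (H m : nat) : nat -> R :=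
  if m is m'.+1 then fun t => dir H (tail R H m') t H./2 else fun=> 0.

Lemma tail_survival (R : realType) H m : survival (tail R H m).
Proof.
elim: m => [|m IHm]; last exact: dir_survival.
by split=> t //=; rewrite lexx ler01.
Qed.

Lemma tailS_ge (R : realType) H m t x : dir H (tail R H m) t x <= tail R H m.+1 t.
Proof. exact/dir_le_center/tail_survival. Qed.

(** For independent times, max(tau + C, B) <= tau + max(C, B); a product of distribution functions
    is the distribution function of a maximum. *)
Lemma dir_sub_mul (R : realType) H (b B : nat -> R) (c : nat -> R) (cS : survival c) :
  survival b -> (forall t, 1 - (1 - c t) * (1 - b t) <= B t) ->
  forall t x, (x <= H)%N -> 1 - (1 - dir H c t x) * (1 - b t) <= dir H B t x.
Proof.
move=> bS Bge; apply: dir_sub => [x xH|t|t|t x xH].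
- by rewrite dir0E// subrr mul0r subr0.
- by rewrite dir_left.
- by rewrite dir_right.
- rewrite dirS//.
  have : (1 - heat (dir H c t) x) * (1 - b t) <= (1 - heat (dir H c t) x) * (1 - b t.+1).
    rewrite ler_wpM2l ?lerD2l ?lerN2 ?(bS.1)// subr_ge0 -dirS//; exact: dir_le1.
  rewrite /heat; lra.
Qed.

(** The maximum of T_1 + T_2 and T_3 + T_4 is at most their sum. The two terms of the first sum are
    peeled off one at a time. *)
Lemma tail_mul (R : realType) H t :
  1 - (1 - tail R H 2 t) * (1 - tail R H 2 t) <= tail R H 4 t.
Proof.
have b2S := tail_survival R H 2.
have H2 : (H./2 <= H)%N by lia.
apply: (@dir_sub_mul R H (tail R H 2) (tail R H 3) (tail R H 1)) => //.
  exact: tail_survival.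
move=> s; apply: (@dir_sub_mul R H (tail R H 2) (tail R H 2) (fun=> 0)) => //.
  by split=> u //; rewrite lexx ler01.
by move=> u; lra.
Qed.

(** * Dominance of the jump point *)

Section Order.
Context (R : realType) (H a : nat) (w : nat -> R).
Hypothesis w_ge0 : forall z, 0 <= w z.
Hypothesis w_supp : forall z, 0 < w z -> [&& ~~ odd z, (4 <= z)%N & (z <= a.*2)%N].
Hypothesis w_top : 0 < w a.*2.
Hypothesis aH : (a.*2 < H)%N.
Hypothesis w_sum : \sum_(z < H) w z = 1.

Let a_ge2 : (2 <= a)%N.
Proof. by move/w_supp: w_top => /and3P[_]; lia. Qed.

Let w_eq0 z : ~~ [&& ~~ odd z, (4 <= z)%N & (z <= a.*2)%N] -> w z = 0.
Proof.
by move=> zN; apply/eqP; move: zN; apply: contraNT => wz; apply: w_supp; rewrite lt0r wz w_ge0.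
Qed.

Lemma mean_le (g : nat -> R) c :
  (forall z, 0 < w z -> g z <= c) -> \sum_(z < H) w z * g z <= c.
Proof.
move=> gc; rewrite -[leRHS]mul1r -w_sum mulr_suml; apply: ler_sum => z _.
have := w_ge0 z; rewrite le_eqVlt => /orP[/eqP <-|wz]; first by rewrite !mul0r.
by rewrite ler_wpM2l// gc.
Qed.

(** The bound m <= a keeps the minimum at or before the midpoint between 0 and the topmost target
    [a.*2]. *)
Definition ushaped (g : nat -> R) m :=
  [/\ (1 <= m <= a)%N, forall x, (x < m)%N -> g x.+1 <= g x &
      forall x, (m <= x < H)%N -> g x <= g x.+1].

Lemma ushaped_dec g m x y : ushaped g m -> (x <= y <= m)%N -> g y <= g x.
Proof.
case=> _ dec _ /andP[]; elim: y => [|y IHy]; first by rewrite leqn0 => /eqP ->.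
rewrite leq_eqVlt => /orP[/eqP ->//|xy] ym.
by apply: le_trans (dec _ ym) _; apply: IHy => //; exact: ltnW.
Qed.

Lemma ushaped_inc g m x y : ushaped g m -> (m <= x)%N -> (x <= y <= H)%N -> g x <= g y.
Proof.
case=> _ _ inc mx /andP[]; elim: y => [|y IHy]; first by rewrite leqn0 => /eqP ->.
rewrite leq_eqVlt => /orP[/eqP ->//|xy] yH.
by apply: le_trans (IHy xy (ltnW yH)) (inc _ _); rewrite yH andbT; exact: leq_trans mx xy.
Qed.

Lemma ushaped_between g m x y z : ushaped g m -> (x <= y <= z)%N -> (z <= H)%N ->
  g y <= g x \/ g y <= g z.
Proof.
move=> gU /andP[xy yz] zH; case: (leqP y m) => ym; [left|right].
  by apply: (ushaped_dec gU); rewrite xy ym.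
by apply: (ushaped_inc gU); rewrite ?yz ?zH ?(ltnW ym).
Qed.

(** The whole sum is zero. If some z1 >= b lies below g 0, then every z < b lies between 0 and z1,
    so the U-shape makes the complementary part nonpositive; otherwise every term is nonnegative. *)
Lemma ushaped_tail_sum g m b : ushaped g m -> g 0%N = \sum_(z < H) w z * g z ->
  0 <= \sum_(z < H | (b <= z)%N) w z * (g z - g 0%N).
Proof.
move=> gU g0.
have tot : \sum_(z < H) w z * (g z - g 0%N) = 0.
  under eq_bigr do rewrite mulrBr.
  by rewrite sumrB -mulr_suml w_sum mul1r -g0 subrr.
case: (pselect (exists2 z1 : 'I_H, (b <= z1)%N & g z1 < g 0%N)) => [[z1 bz1 gz1]|N].
  have <- : - (\sum_(z < H | ~~ (b <= z)%N) w z * (g z - g 0%N)) =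
      \sum_(z < H | (b <= z)%N) w z * (g z - g 0%N).
    by rewrite (bigID (fun z : 'I_H => (b <= z)%N)) /= in tot; lra.
  rewrite oppr_ge0 sumr_le0// => z; rewrite -ltnNge => zb.
  rewrite mulr_ge0_le0// subr_le0.
  have zz : (0 <= z <= z1)%N by lia.
  case: (ushaped_between gU zz (ltnW (ltn_ord _))) => // h.
  exact: le_trans h (ltW gz1).
apply: sumr_ge0 => z bz; rewrite mulr_ge0// subr_ge0 leNgt; apply/negP => h.
by apply: N; exists z.
Qed.

(** The U-shape alone does not control the slope at 0 or the position of the minimum after a heat
    step. The other two clauses do: they compare x with its mirror image z - x and its translate z +
    x, averaged over the target z. *)
Definition order_inv (g : nat -> R) :=
  [/\ exists m, ushaped g m,
      forall b x, (x.*2 <= b)%N ->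
        0 <= \sum_(z < H | (b <= z)%N) w z * (g (z - x)%N - g x) &
      forall x, (x <= a)%N -> 0 <= \sum_(z < H) w z * (g (z + x)%N - g x)].

(** If g x exceeded g 0, the U-shape would put g x below g z for every target z, hence below their
    mean g 0. *)
Lemma order_inv_le0 g x : order_inv g -> g 0%N = \sum_(z < H) w z * g z ->
  (forall z, 0 < w z -> (x <= z)%N) -> g x <= g 0%N.
Proof.
move=> [[m gU] _ _] g0 xz; rewrite leNgt; apply/negP => h.
suff : \sum_(z < H) w z * (- g z) <= - g x by under eq_bigr do rewrite mulrN; rewrite sumrN -g0; lra.
apply: (@mean_le (fun z => - g z)) => z wz; rewrite lerN2.
have /and3P[_ _ za] := w_supp wz.
have zz : (0 <= x <= z)%N by rewrite xz.
by case: (ushaped_between gU zz (ltnW (leq_ltn_trans za aH))) => //; lra.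
Qed.

Variable G : nat -> nat -> R.
Hypothesis G_sym : forall t x, (x <= H.*2)%N -> G t (H.*2 - x)%N = G t x.
Hypothesis G_step : forall t x, (0 < x < H.*2)%N -> G t.+1 x = heat (G t) x.
Hypothesis G_bd : forall t, G t 0%N = \sum_(z < H) w z * G t z.
Hypothesis G_mono : forall x, (0 < x < H)%N -> G 0%N x <= G 0%N x.+1.

Let G_far t m p : ushaped (G t) m -> (a <= p <= H.*2 - a)%N -> G t a <= G t p.
Proof.
move=> gU /andP[ap pa]; have ma : (m <= a)%N by case: gU => /andP[].
case: (leqP p H) => pH; first by apply: (ushaped_inc gU); rewrite ?ap.
rewrite -(@G_sym t p); last lia.
by apply: (ushaped_inc gU) => //; lia.
Qed.

Let G0_far x p : (0 < x)%N -> (x <= p <= H.*2 - x)%N -> G 0%N x <= G 0%N p.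
Proof.
move=> x0 /andP[xp px].
have mono y : (x <= y <= H)%N -> G 0%N x <= G 0%N y.
  case/andP; elim: y => [|y IHy]; first by lia.
  rewrite leq_eqVlt => /orP[/eqP ->//|xy] yH.
  by apply: le_trans (IHy xy (ltnW yH)) (G_mono _); lia.
case: (leqP p H) => pH; first by apply: mono; rewrite xp.
by rewrite -(@G_sym 0%N p); [apply: mono; lia|lia].
Qed.

Let G_inv0 : order_inv (G 0%N).
Proof.
have U : ushaped (G 0%N) 1.
  split; first by lia.
    move=> [|//] _; rewrite G_bd -subr_le0.
    rewrite -[X in X - _]mul1r -w_sum mulr_suml -sumrB sumr_le0// => z _.
    rewrite -mulrBr; have := w_ge0 z; rewrite le_eqVlt => /orP[/eqP <-|wz].
      by rewrite mul0r.
    rewrite mulr_ge0_le0// subr_le0 G0_far//.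
    by have /and3P[] := w_supp wz; have := ltn_ord z; lia.
  by move=> x xH; exact: G_mono.
split; first by exists 1%N.
- move=> b x xb; case: (posnP x) => [->|x0].
    under eq_bigr do rewrite subn0.
    exact: ushaped_tail_sum U (G_bd _).
  apply: sumr_ge0 => z bz; rewrite mulr_ge0// subr_ge0 G0_far//.
  by have := ltn_ord z; lia.
- move=> x xa; case: (posnP x) => [->|x0].
    under eq_bigr do rewrite addn0 mulrBr.
    by rewrite sumrB -mulr_suml w_sum mul1r -G_bd subrr.
  apply: sumr_ge0 => z _; have := w_ge0 z; rewrite le_eqVlt => /orP[/eqP <-|wz].
    by rewrite mul0r.
  rewrite mulr_ge0// subr_ge0 G0_far//.
  by have /and3P[] := w_supp wz; have := ltn_ord z; lia.
Qed.

Let G_invS t : order_inv (G t) -> order_inv (G t.+1).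
Proof.
move=> inv; have [[m gU] gM gD] := inv.
have [/andP[m1 ma] dec inc] := gU.
have zH z : 0 < w z -> (4 <= z <= a.*2)%N by move/w_supp => /and3P[_ -> ->].
(* The value at 0 is the mean over the targets at the same time, so it is expanded by one heat step
   at each z. The mirror and translate clauses at x = 1 bound the two neighbour terms from below by
   G t 1, which leaves G t 2 <= G t 0. *)
have d0 : G t.+1 1%N <= G t.+1 0%N.
  have h2 : G t 2%N <= G t 0%N.
    by apply: order_inv_le0 => // z /zH; lia.
  have hp := gD 1%N (ltnW a_ge2).
  have hm : 0 <= \sum_(z < H) w z * (G t (z - 1)%N - G t 1%N).
    have := gM 2%N 1%N (leqnn _); congr (_ <= _).
    rewrite [RHS](bigID (fun z : 'I_H => (2 <= z)%N)) /= [X in _ + X]big1 ?addr0//.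
    by move=> z z2; rewrite w_eq0 ?mul0r//; lia.
  have -> : G t.+1 0%N = G t 0%N / 2 + \sum_(z < H) w z * G t (z - 1)%N / 4 +
                          \sum_(z < H) w z * G t (z + 1)%N / 4.
    rewrite G_bd [in RHS]G_bd mulr_suml -!big_split /=; apply: eq_bigr => z _.
    have := w_ge0 z; rewrite le_eqVlt => /orP[/eqP <-|wz]; first by lra.
    rewrite G_step; last by have := zH _ wz; have := ltn_ord z; lia.
    by rewrite /heat subn1 addn1; lra.
  move: hp hm; rewrite G_step; last lia.
  under eq_bigr do rewrite mulrBr.
  rewrite sumrB -mulr_suml w_sum mul1r.
  under [X in _ -> 0 <= X -> _]eq_bigr do rewrite mulrBr.
  rewrite sumrB -mulr_suml w_sum mul1r -!mulr_suml /heat /=.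
  lra.
have stepS x : (0 < x < H)%N ->
    G t.+1 x.+1 - G t.+1 x = (G t x.+1 - G t x) / 2 + (G t x - G t x.-1) / 4
                             + (G t x.+2 - G t x.+1) / 4.
  by move=> xH; rewrite !G_step; try lia; rewrite /heat/=; lra.
have top : G t H.+1 = G t H.-1 by rewrite -(@G_sym t H.+1); [congr G|]; lia.
have low x : (0 < x)%N -> (x.+1 < m)%N -> G t.+1 x.+1 <= G t.+1 x.
  move=> x0 xm; rewrite -subr_le0 stepS; last lia.
  have h1 : G t x.+1 <= G t x by apply: dec; lia.
  have h2 : G t x.+2 <= G t x.+1 by apply: dec; lia.
  have h3 : G t x <= G t x.-1 by rewrite -{1}(@prednK x)//; apply: dec; lia.
  lra.
have high x : (m < x < H)%N -> G t.+1 x <= G t.+1 x.+1.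
  move=> /andP[mx xH]; rewrite -subr_ge0 stepS; last lia.
  have h1 : G t x <= G t x.+1 by apply: inc; lia.
  have h2 : G t x.-1 <= G t x by rewrite -[in leRHS](@prednK x); [apply: inc|]; lia.
  case: (ltnP x.+1 H) => xH1.
    have h3 : G t x.+1 <= G t x.+2 by apply: inc; lia.
    lra.
  have -> : G t x.+2 = G t x by rewrite (_ : x = H.-1) -?top; [congr G|]; lia.
  lra.
(* The minimum moves by at most one site: of the two new increments around m, the left one does not
   exceed the right one. *)
have mid : (1 < m)%N -> G t.+1 m - G t.+1 m.-1 <= G t.+1 m.+1 - G t.+1 m.
  move=> m2; have := stepS m ltac:(lia); have := stepS m.-1 ltac:(lia); rewrite (@prednK m)//.
  have h1 : G t m <= G t m.+1 by apply: inc; lia.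
  have h2 : G t m.+1 <= G t m.+2 by apply: inc; lia.
  have h3 : G t m <= G t m.-1 by rewrite -{1}(@prednK m)//; apply: dec; lia.
  have h4 : G t m.-1 <= G t m.-2 by rewrite -{1}(@prednK m.-1); [apply: dec|]; lia.
  by move=> -> ->; lra.
(* The mirror clause with b = 2a sees only the topmost target; at x = a - 1 it compares a - 1 with a
   + 1, which keeps the minimum from passing a. *)
have ata : m = a -> G t.+1 a <= G t.+1 a.+1.
  move=> mE; rewrite -subr_ge0 stepS; last lia.
  have h1 : G t a <= G t a.+1 by apply: inc; lia.
  have h2 : G t a.+1 <= G t a.+2 by apply: inc; lia.
  have h3 : G t a.-1 <= G t a.+1.
    have := gM a.*2 a.-1; rewrite (bigD1 (Ordinal aH))//= big1 ?addr0; last first.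
      move=> z /andP[az za]; rewrite w_eq0 ?mul0r//.
      by move: za; rewrite -val_eqE /=; lia.
    rewrite (_ : (a.*2 - a.-1)%N = a.+1); last lia.
    rewrite pmulr_rge0// subr_ge0; apply; lia.
  lra.
have [m' gU'] : exists m', ushaped (G t.+1) m'.
  have [vm|vm] := boolP ((1 < m)%N && (G t.+1 m.-1 < G t.+1 m)).
    case/andP: vm => m2 vm; exists m.-1; split; first lia.
      by move=> [//|x] xm; apply: low; lia.
    move=> x /andP[mx xH]; case: (ltngtP x m) => [xm|xm|->].
    - by rewrite (_ : x = m.-1) ?prednK ?ltW//; lia.
    - by apply: high; rewrite xm xH.
    - by rewrite -subr_ge0; apply: le_trans (mid m2); rewrite subr_ge0 ltW.
  have low' x : (x < m)%N -> G t.+1 x.+1 <= G t.+1 x.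
    case: x => [//|x] xm; case: (ltnP x.+2 m) => xm2; first exact: low.
    have e : m = x.+2 by lia.
    by move: vm; rewrite e /= -leNgt.
  have [vm2|vm2] := ltP (G t.+1 m.+1) (G t.+1 m).
    have ma' : m != a by apply: contraTneq vm2 => mE; rewrite mE -leNgt ata.
    exists m.+1; split; first lia.
      move=> x; rewrite ltnS leq_eqVlt => /orP[/eqP ->|]; [exact: ltW|exact: low'].
    by move=> x xH; apply: high.
  exists m; split=> //; first by rewrite m1.
  move=> x /andP[]; rewrite leq_eqVlt => /orP[/eqP <-//|mx] xH.
  by apply: high; rewrite mx.
split; first by exists m'.
- move=> b x xb; case: (posnP x) => [->|x0].
    under eq_bigr do rewrite subn0.
    exact: ushaped_tail_sum gU' (G_bd _).
  (* The target z = 2x contributes zero and odd targets have no weight, so the threshold may be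
     raised to 2x + 2. This leaves room to apply the clause at x + 1. *)
  pose b' := maxn b x.*2.+2.
  have -> : \sum_(z < H | (b <= z)%N) w z * (G t.+1 (z - x)%N - G t.+1 x) =
            \sum_(z < H | (b' <= z)%N) w z * (G t.+1 (z - x)%N - G t.+1 x).
    rewrite (bigID (fun z : 'I_H => (b' <= z)%N)) /= [X in _ + X]big1 ?addr0.
      by apply: eq_bigl => z; rewrite /b'; lia.
    move=> z /andP[bz bz']; have [zx|zx] := eqVneq (nat_of_ord z) x.*2.
      by rewrite zx -addnn addnK subrr mulr0.
    by rewrite w_eq0 ?mul0r//; move: bz'; rewrite /b'; lia.
  have h1 := gM b' x; have h2 := gM b' x.+1; have h3 := gM b' x.-1.
  have {}h1 := h1 ltac:(rewrite /b'; lia); have {}h2 := h2 ltac:(rewrite /b'; lia).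
  have {}h3 := h3 ltac:(rewrite /b'; lia).
  suff -> : \sum_(z < H | (b' <= z)%N) w z * (G t.+1 (z - x)%N - G t.+1 x) =
     \sum_(z < H | (b' <= z)%N) w z * (G t (z - x)%N - G t x) / 2 +
     \sum_(z < H | (b' <= z)%N) w z * (G t (z - x.+1)%N - G t x.+1) / 4 +
     \sum_(z < H | (b' <= z)%N) w z * (G t (z - x.-1)%N - G t x.-1) / 4.
    by rewrite -!mulr_suml; lra.
  rewrite -!big_split /=; apply: eq_bigr => z bz.
  have zx : (x.*2.+2 <= z)%N by move: bz; rewrite /b'; lia.
  have := ltn_ord z => zH'.
  rewrite !G_step; try lia.
  rewrite /heat (_ : (z - x).-1 = (z - x.+1)%N); last lia.
  by rewrite (_ : (z - x).+1 = (z - x.-1)%N); [field|lia].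
- move=> x xa; case: (posnP x) => [->|x0].
    under eq_bigr do rewrite addn0 mulrBr.
    by rewrite sumrB -mulr_suml w_sum mul1r -G_bd subrr.
  (* At x = a the inequality comes from the shape: z + a lies between a and 2H - a, where the values
     are at least the one at a. For x < a it is a heat step of the old clause. *)
  case: (ltngtP x a) xa => // [xa _|-> _]; last first.
    apply: sumr_ge0 => z _; have := w_ge0 z; rewrite le_eqVlt => /orP[/eqP <-|wz].
      by rewrite mul0r.
    rewrite mulr_ge0// subr_ge0 (G_far gU')//.
    by have := zH _ wz; lia.
  have h1 := gD x (ltnW xa); have h2 := gD x.+1 xa.
  have h3 := gD x.-1 (leq_trans (leq_pred _) (ltnW xa)).
  suff -> : \sum_(z < H) w z * (G t.+1 (z + x)%N - G t.+1 x) =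
     \sum_(z < H) w z * (G t (z + x)%N - G t x) / 2 +
     \sum_(z < H) w z * (G t (z + x.+1)%N - G t x.+1) / 4 +
     \sum_(z < H) w z * (G t (z + x.-1)%N - G t x.-1) / 4.
    by rewrite -!mulr_suml; lra.
  rewrite -!big_split /=; apply: eq_bigr => z bz.
  have := ltn_ord z => zH'.
  rewrite !G_step; try lia.
  rewrite /heat (_ : (z + x).-1 = (z + x.-1)%N); last lia.
  by rewrite (_ : (z + x).+1 = (z + x.+1)%N); [field|lia].
Qed.

Lemma jump_dominates t x : (forall z, 0 < w z -> (x <= z)%N) -> G t x <= G t 0%N.
Proof.
move=> xz; apply: (order_inv_le0 _ (G_bd t) xz).
by elim: t => [|t]; [exact: G_inv0|exact: G_invS].
Qed.

End Order.

(** * Spectral estimates *)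

Section Spectral.
Context (R : realType).

Lemma heat_cos (th phi : R) x : (0 < x)%N ->
  heat (fun x => cos (th * x%:R + phi)) x = (1 + cos th) / 2 * cos (th * x%:R + phi).
Proof.
case: x => [//|x] _; rewrite /heat /=.
have -> : th * x%:R + phi = (th * x.+1%:R + phi) - th by rewrite -natr1; ring.
have -> : th * x.+2%:R + phi = (th * x.+1%:R + phi) + th by rewrite -[x.+2%:R]natr1; ring.
by move: (th * x.+1%:R + phi) => al; rewrite cosB cosD; field.
Qed.

Lemma green_heat (f g : nat -> R) n :
  \sum_(1 <= x < n.+1) heat f x * g x =
  \sum_(1 <= x < n.+1) f x * heat g x +
  (f n.+1 * g n - f n * g n.+1) / 4 - (f 1%N * g 0%N - f 0%N * g 1%N) / 4.
Proof.
elim: n => [|n IHn]; first by rewrite !big_geq//; field.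
rewrite big_nat_recr//= IHn [in RHS]big_nat_recr//=.
by move: (\sum_(1 <= x < n.+1) f x * heat g x) => S; rewrite /heat /=; field.
Qed.

Variable H : nat.
Hypothesis H_odd : odd H.
Hypothesis H_ge5 : (5 <= H)%N.
Let c := H./2.
Let th : R := pi / H%:R.
Definition kap : R := cos (pi / H%:R / 2).
Definition lam : R := (1 + cos (pi / H%:R)) / 2.

Let HE : H = c.*2.+1. Proof. by rewrite /c -{1}(odd_double_half H) H_odd. Qed.
Let c2 : (2 <= c)%N. Proof. by have := HE; lia. Qed.
Let HR0 : 0 < H%:R :> R. Proof. by rewrite ltr0n; lia. Qed.
Let HR : H%:R = c%:R * 2 + 1 :> R. Proof. by rewrite HE -natr1 -muln2 natrM. Qed.

Lemma lamE : lam = kap ^+ 2.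
Proof.
rewrite /lam /kap; move: (pi / H%:R : R) => y; rewrite {1}(splitr y) -mulr2n cos_mulr2n.
by field.
Qed.

(** The worst case is H = 5. With u = cos(pi/10)^2, the identity cos(5 pi/10) = 0 reads 16 u^2 - 20
    u + 5 = 0, and 2u - 1 = cos(pi/5) >= 0 selects the larger root. *)
Lemma kap2_ge : 9 / 10 <= kap ^+ 2.
Proof.
have p0 := pi_gt0 R.
pose x : R := pi / 10; pose u := cos x ^+ 2.
have c0 : 0 < cos x by rewrite cos_gt0_pihalf// /x; lra.
have c2x : cos (x + x) = 2 * u - 1 by rewrite -mulr2n cos_mulr2n /u; ring.
have C2 : 0 <= 2 * u - 1 by rewrite -c2x cos_ge0_pihalf// /x; lra.
have C5 : cos (((x + x) + (x + x)) + x) = 0.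
  by rewrite (_ : _ + x = pi / 2) ?cos_pihalf// /x; field.
have s2x : sin (x + x) = 2 * (sin x * cos x) by rewrite sinD; ring.
move: C5 s2x c2x; move: (x + x) => y.
rewrite [cos (y + y + x)]cosD (cosD y y) (sinD y y) => C5 s2x c2x.
have e : cos x * cos x = u by rewrite /u expr2.
have f : sin x * sin x = 1 - u by rewrite -expr2 sin2cos2.
have {}C5 : cos x * (16 * u ^+ 2 - 20 * u + 5) = 0.
  rewrite -C5 s2x c2x.
  transitivity (((2 * u - 1) * (2 * u - 1) - 4 * ((sin x * sin x) * (cos x * cos x))) * cos x
     - 4 * (2 * u - 1) * (cos x * (sin x * sin x))).
    by rewrite e f; ring.
  ring.
have {}C5 : 16 * u ^+ 2 - 20 * u + 5 = 0.
  by move/eqP: C5; rewrite mulf_eq0 (gt_eqF c0)/= => /eqP.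
have u9 : 9 / 10 <= u.
  by rewrite leNgt; apply/negP => u9; nra.
apply: le_trans u9 _.
have H5 : 5 <= H%:R :> R by rewrite ler_nat.
have yx : pi / H%:R / 2 <= x.
  rewrite /x -mulrA -invfM ler_pM2l// lef_pV2 ?posrE; lra.
have y0 : 0 <= pi / H%:R / 2 :> R by rewrite !divr_ge0 ?ltW//; lra.
rewrite /u lerXn2r ?nnegrE ?(ltW c0)//.
  rewrite cos_ge0_pihalf//; move: yx y0; rewrite /x; lra.
rewrite /kap; case: (ltgtP (pi / H%:R / 2) x) yx => // [lt _|-> //].
by rewrite ltW// ltr_cos// in_itv/=; move: y0 lt; rewrite /x; lra.
Qed.

Lemma kap_gt0 : 0 < kap.
Proof.
rewrite cos_gt0_pihalf//; have p0 := pi_gt0 R.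
have y0 : 0 < pi / H%:R / 2 :> R by rewrite !divr_gt0//; lra.
have : pi / H%:R / 2 < pi / 2 :> R.
  by rewrite ltr_pM2r ?ltr_pdivrMr ?ltr_pMr ?ltr1n//; lia.
by move: y0; lra.
Qed.

Lemma kap_le1 : kap <= 1. Proof. exact: cos_le1. Qed.

Lemma lam_gt0 : 0 < lam. Proof. by rewrite lamE exprn_gt0 ?kap_gt0. Qed.

Lemma lam_le1 : lam <= 1.
Proof. by rewrite lamE expr_le1 ?kap_le1// ltW ?kap_gt0. Qed.

(* The first Dirichlet eigenfunction sin(pi x / H), written with cos. *)
Definition sn (x : nat) : R := cos (th * x%:R - pi / 2).

Lemma heat_sn x : (0 < x)%N -> heat sn x = lam * sn x.
Proof. exact: heat_cos. Qed.

Lemma sn0 : sn 0 = 0.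
Proof. by rewrite /sn mulr0 sub0r cosN cos_pihalf. Qed.

Lemma snH : sn H = 0.
Proof. by rewrite /sn /th divfK ?gt_eqF// {1}(splitr pi) addrK cos_pihalf. Qed.

Lemma sn_sym x : (x <= H)%N -> sn (H - x) = sn x.
Proof.
move=> xH; rewrite /sn natrB// mulrBr /th divfK ?gt_eqF//.
by rewrite -[RHS]cosN; congr cos; lra.
Qed.

Lemma sn_mono x y : (x <= y <= c)%N -> sn x <= sn y.
Proof.
case/andP=> xy yc; have p0 := pi_gt0 R.
have t0 : 0 < th by rewrite divr_gt0.
have yh : th * y%:R <= pi / 2.
  have : th * (y%:R * 2) <= th * H%:R.
    by rewrite ler_pM2l// -natrM ler_nat HE; lia.
  by rewrite [X in _ <= X]divfK ?gt_eqF//; lra.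
have xy' : th * x%:R <= th * y%:R by rewrite ler_pM2l// ler_nat.
have x0 : 0 <= th * x%:R by rewrite mulr_ge0 ?ler0n// ltW.
rewrite /sn -[leLHS]cosN -[leRHS]cosN.
case: (ltgtP (th * x%:R) (th * y%:R)) xy' => // [lt _|-> //].
by rewrite ltW// ltr_cos ?in_itv/=; lra.
Qed.

Lemma sn_c : sn c = kap.
Proof.
rewrite /sn /kap -[LHS]cosN; congr cos; rewrite /th HR; field.
by rewrite -HR gt_eqF.
Qed.

Lemma sn_cS : sn c.+1 = sn c.
Proof. by rewrite -[RHS]sn_sym; [congr sn|]; rewrite HE; lia. Qed.

Lemma sn_bounds x : (x <= H)%N -> 0 <= sn x <= kap.
Proof.
have low y : (y <= c)%N -> 0 <= sn y <= kap.
  by move=> yc; rewrite -{1}sn0 -sn_c !sn_mono ?yc ?leqnn.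
move=> xH; case: (leqP x c) => xc; first exact: low.
by rewrite -sn_sym// low//; rewrite HE; lia.
Qed.

Let K := dir H (fun=> 0 : R).

Let K0 t : K t 0%N = 0. Proof. exact: dir_left. Qed.
Let KH t : K t H = 0. Proof. exact: dir_right. Qed.

(** The initial profile 0, 1, ..., 1, 0 is concave, and the heat step with zero boundary values
    preserves concavity. *)
Let K_concave t x : (0 < x < H)%N -> K t x.-1 + K t x.+1 <= K t x * 2.
Proof.
have K1 s y : K s y <= 1 by apply: dir_le1; split=> u //; rewrite lexx ler01.
elim: t x => [|t IHt] x xH.
  have k1 := K1 0%N x.-1; have k2 := K1 0%N x.+1.
  by have -> : K 0 x = 1; [exact: dir0E|lra].
have KS y : (0 < y < H)%N -> K t.+1 y = K t y / 2 + K t y.-1 / 4 + K t y.+1 / 4.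
  by move=> yH; rewrite /K dirS.
have h0 := IHt x xH.
have hm : (1 < x)%N -> K t x.-2 + K t x <= K t x.-1 * 2.
  by move=> x1; have := IHt x.-1 ltac:(lia); rewrite prednK//; lia.
have hp : (x.+1 < H)%N -> K t x + K t x.+2 <= K t x.+1 * 2.
  by move=> x1; have := IHt x.+1 ltac:(lia).
rewrite (KS x xH); have [x1|x1] := eqVneq x 1%N.
  have := hp ltac:(lia); rewrite [K t.+1 x.+1]KS; last lia.
  by move: h0; rewrite {}x1 /= !K0; lra.
have {}hm := hm ltac:(lia); rewrite [K t.+1 x.-1]KS; last lia.
rewrite prednK; last lia.
have [xE|xE] := eqVneq x.+1 H; first by move: h0; rewrite xE !KH; lra.
by have := hp ltac:(lia); rewrite [K t.+1 x.+1]KS /=; [lra|lia].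
Qed.

Let K_slope t x : (x < H)%N -> K t x.+1 * x%:R <= K t x * x.+1%:R.
Proof.
elim: x => [|x IHx] xH; first by rewrite mulr0 K0 mul0r.
have := IHx (ltnW xH); have := K_concave t (x := x.+1) ltac:(lia) => /=.
have : 0 <= x%:R :> R by rewrite ler0n.
rewrite -[x.+2%:R]natr1 -[x.+1%:R]natr1; move: (x%:R : R) => r; nra.
Qed.

Let K_above_chord t x : (x <= c)%N -> x%:R * K t c <= c%:R * K t x.
Proof.
move=> xc; case: (posnP x) => [->|x0].
  by rewrite mul0r K0 mulr0.
suff : forall k, (x <= k <= c)%N -> x%:R * K t k <= k%:R * K t x.
  by apply; rewrite xc leqnn.
elim=> [|k IHk]; first by lia.
case/andP; rewrite leq_eqVlt => /orP[/eqP -> //|xk] kc.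
have := IHk ltac:(lia); have := K_slope t (x := k) ltac:(rewrite HE; lia).
have k0 : 0 < k%:R :> R by rewrite ltr0n; lia.
have x0' : 0 < x%:R :> R by rewrite ltr0n.
have e : k.+1%:R = k%:R + 1 :> R by rewrite natr1.
rewrite e => h1 h2; rewrite -(ler_pM2l k0).
have h3 : x%:R * (K t k.+1 * k%:R) <= x%:R * (K t k * (k%:R + 1)) by rewrite ler_pM2l.
have h4 : (k%:R + 1) * (x%:R * K t k) <= (k%:R + 1) * (k%:R * K t x).
  by rewrite ler_wpM2l// ltW// ltr_wpDr.
lra.
Qed.

(** Green's identity on the left half: both functions vanish at 0 and take equal values at c and c +
    1, so there is no boundary flux. *)
Let K_sn t : \sum_(1 <= x < c.+1) K t x * sn x = lam ^+ t * \sum_(1 <= x < c.+1) sn x.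
Proof.
elim: t => [|t IHt].
  rewrite mul1r; apply: eq_big_nat => x xc; rewrite /K dir0E ?mul1r//.
  by rewrite HE; lia.
transitivity (\sum_(1 <= x < c.+1) heat (K t) x * sn x).
  by apply: eq_big_nat => x xc; rewrite /K dirS//; rewrite HE; lia.
rewrite green_heat sn0 K0 sn_cS.
have -> : K t c.+1 = K t c.
  by rewrite /K -[RHS]dir_sym; [congr dir|]; rewrite HE; lia.
rewrite exprS -mulrA -IHt mulr_sumr mul0r mulr0 !subrr !mul0r addr0 subr0.
by apply: eq_big_nat => x /andP[x0 _]; rewrite heat_sn//; ring.
Qed.

(* Chebyshev's sum inequality for the increasing sequences x and sn x. *)
Let sn_moment : c%:R * \sum_(1 <= x < c.+1) sn x <= (\sum_(1 <= x < c.+1) x%:R * sn x) * 2.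
Proof.
have e (f : nat -> R) : f 0%N = 0 -> \sum_(1 <= x < c.+1) f x = \sum_(x < c.+1) f x.
  by move=> f0; rewrite -(big_mkord xpredT) big_ltn// f0 add0r.
rewrite !e ?sn0 ?mulr0// -subr_ge0 mulr_sumr mulr_suml -sumrB.
set S := \sum_(_ < _) _.
have S2 : S = \sum_(x < c.+1) (c%:R - x%:R * 2) * sn (c - x)%N.
  rewrite /S (reindex_inj rev_ord_inj)/=; apply: eq_bigr => x _.
  rewrite subSS natrB; last by rewrite -ltnS.
  by ring.
have : 0 <= S + S.
  rewrite {2}S2 /S -big_split sumr_ge0//= => x _.
  rewrite (_ : _ + _ = (x%:R * 2 - c%:R) * (sn x - sn (c - x)%N)); last by ring.
  have xc : (x <= c)%N by rewrite -ltnS.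
  have e2 : x%:R * 2 - c%:R = x%:R - (c - x)%N%:R :> R by rewrite natrB//; ring.
  rewrite {}e2; case: (leqP x (c - x)) => h.
    by rewrite mulr_le0// subr_le0 ?ler_nat// sn_mono// h leq_subr.
  by rewrite mulr_ge0// subr_ge0 ?ler_nat ?(ltnW h)// sn_mono// (ltnW h).
by lra.
Qed.

(** By concavity K t x >= (x / c) K t c on the left half. Pairing this with [sn], the left side has
    mean lam^t, and Chebyshev's inequality says that the [sn]-mean of x / c is at least 1/2; hence
    the factor 2. *)
Lemma dir_decay t x : dir H (fun=> 0) t x <= 2 * lam ^+ t.
Proof.
have zS : survival (fun=> 0 : R) by split=> u //; rewrite lexx ler01.
apply: le_trans (dir_le_center H zS t x) _; rewrite -/c -/K.
have snp : 0 < \sum_(1 <= x < c.+1) sn x.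
  rewrite big_nat_recr ?(ltnW c2)//= sn_c ltr_wpDl ?kap_gt0// big_nat_cond sumr_ge0// => y.
  rewrite andbT => /andP[_ yc].
  by have /andP[] : 0 <= sn y <= kap by apply: sn_bounds; rewrite HE; lia.
have c0 : 0 < c%:R :> R by rewrite ltr0n; lia.
rewrite -(ler_pM2r snp) -mulrA -K_sn -(ler_pM2l c0).
apply: (@le_trans _ _ (K t c * ((\sum_(1 <= y < c.+1) y%:R * sn y) * 2))).
  rewrite mulrCA ler_wpM2l ?sn_moment//; exact: dir_ge0.
suff : K t c * (\sum_(1 <= y < c.+1) y%:R * sn y) <= c%:R * \sum_(1 <= y < c.+1) K t y * sn y.
  by lra.
rewrite !mulr_sumr big_nat_cond [leRHS]big_nat_cond.
apply: ler_sum => y; rewrite andbT => /andP[y0 yc].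
have /andP[s0 _] : 0 <= sn y <= kap by apply: sn_bounds; rewrite HE; lia.
have := K_above_chord t (x := y) yc; nra.
Qed.

(** Negative binomial tail: the probability of fewer than m successes in t independent trials with
    success probability 1 - lam. *)
Fixpoint nb (m t : nat) {struct t} : R :=
  if m is m'.+1 then
    (if t is t'.+1 then lam * nb m t' + (1 - lam) * nb m' t' else 1) else 0.

Let nb0 t : nb 0 t = 0. Proof. by case: t. Qed.

Let nb_monoS m t : 0 <= nb m t <= nb m.+1 t.
Proof.
have := lam_gt0; have := lam_le1 => l1 l0.
elim: t m => [|t IHt] [|m] /=; rewrite ?lexx ?ler01//.
  have /andP[] := IHt 0%N; rewrite nb0 => _ h.
  by nra.
have /andP[a1 a2] := IHt m.+1; have /andP[a3 a4] := IHt m.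
by apply/andP; split; nra.
Qed.

Let nb_survival m : survival (nb m).
Proof.
have := lam_gt0; have := lam_le1 => l1 l0.
have dec t : nb m t.+1 <= nb m t.
  case: m => [|m]; first by rewrite !nb0.
  by have /andP[_ h] := nb_monoS m t; rewrite /= -/(nb m.+1 t); nra.
split=> // t; have /andP[-> _] := nb_monoS m t.
elim: t => [|t IHt]; last exact: le_trans (dec t) IHt.
by case: m {dec} => [|m] /=; rewrite ?ler01.
Qed.

(** T dominates a geometric time of parameter 1 - lam, because sn / kap is an eigenfunction that is
    at most 1 and equals 1 at the centre. For several copies, interpolating between [nb m.+1] and
    [nb m] with weight sn / kap gives a subsolution. *)
Lemma nb_le_tail m t : nb m t <= tail R H m t.
Proof.
elim: m t => [|m IHm] t; first by rewrite nb0.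
have k0 := kap_gt0.
pose si x := sn x / kap.
have si1 x : (x <= H)%N -> 0 <= si x <= 1.
  move=> xH; have /andP[s0 s1] := sn_bounds xH.
  by rewrite /si divr_ge0 ?(ltW k0)//= ler_pdivrMr// mul1r.
have -> : nb m.+1 t = si c * nb m.+1 t + (1 - si c) * nb m t.
  by rewrite /si sn_c divff ?gt_eqF//; ring.
rewrite /tail -/tail -/c.
apply: (@dir_sub _ _ _ (fun t x => si x * nb m.+1 t + (1 - si x) * nb m t)).
- move=> x xH; have := si1 x ltac:(lia); have /andP[_ ] := (nb_survival m).2 0%N.
  have /andP[_ ] := (nb_survival m.+1).2 0%N; nra.
- by move=> s; rewrite /si sn0 !mul0r add0r subr0 mul1r.
- by move=> s; rewrite /si snH !mul0r add0r subr0 mul1r.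
- move=> s x xH; have := heat_sn (x := x) ltac:(lia); rewrite /heat => sE.
  have -> : nb m.+1 s.+1 = lam * nb m.+1 s + (1 - lam) * nb m s by [].
  have := (nb_survival m).1 s; have := si1 x ltac:(lia).
  have e : si x / 2 + si x.-1 / 4 + si x.+1 / 4 = lam * si x.
    by rewrite /si mulrA -sE; field; rewrite gt_eqF.
  move: e; move: (si x) (si x.-1) (si x.+1) (nb m.+1 s) (nb m s) (nb m s.+1) => p q r u v w.
  move=> e p01 wv.
  have -> : (p * u + (1 - p) * v) / 2 + (q * u + (1 - q) * v) / 4 + (r * u + (1 - r) * v) / 4
     = (p / 2 + q / 4 + r / 4) * (u - v) + v by field.
  by rewrite e; nra.
- by rewrite HE; lia.
Qed.

(** Chosen so that nb m t = lam^t times the sum of binomial(t, i) eps^i over i < m; moreover 1 + eps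
    = 1 / lam. *)
Definition eps : R := (1 - lam) / lam.

Let lamN0 : lam != 0. Proof. by rewrite gt_eqF ?lam_gt0. Qed.

Let epsE : 1 - lam = eps * lam. Proof. by rewrite /eps divfK. Qed.

Let nb1E t : nb 1 t = lam ^+ t.
Proof. by elim: t => //= t ->; rewrite nb0 exprS; ring. Qed.

Let nb2E t : nb 2 t = lam ^+ t * (1 + t%:R * eps).
Proof.
elim: t => [|t IHt]; first by rewrite /= expr0; ring.
have -> : nb 2 t.+1 = lam * nb 2 t + (1 - lam) * nb 1 t by [].
by rewrite IHt nb1E [lam ^+ t.+1]exprS -[t.+1%:R]natr1 epsE; move: (lam ^+ t) (t%:R : R) => L r; field.
Qed.

Let nb3E t : nb 3 t = lam ^+ t * (1 + t%:R * eps + t%:R * (t%:R - 1) / 2 * eps ^+ 2).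
Proof.
elim: t => [|t IHt]; first by rewrite /= expr0; ring.
have -> : nb 3 t.+1 = lam * nb 3 t + (1 - lam) * nb 2 t by [].
by rewrite IHt nb2E [lam ^+ t.+1]exprS -[t.+1%:R]natr1 epsE; move: (lam ^+ t) (t%:R : R) => L r; field.
Qed.

Let nb4E t : nb 4 t = lam ^+ t * (1 + t%:R * eps + t%:R * (t%:R - 1) / 2 * eps ^+ 2
   + t%:R * (t%:R - 1) * (t%:R - 2) / 6 * eps ^+ 3).
Proof.
elim: t => [|t IHt]; first by rewrite /= expr0; field.
have -> : nb 4 t.+1 = lam * nb 4 t + (1 - lam) * nb 3 t by [].
by rewrite IHt nb3E [lam ^+ t.+1]exprS -[t.+1%:R]natr1 epsE; move: (lam ^+ t) (t%:R : R) => L r; field.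
Qed.

(** Start from exp(-1/50) >= 49/50 and square repeatedly, rounding down; then 13/5 = 128/50 +
    2/50. *)
Let expR_13_5 : expR (13 / 5) <= 72 / 5 :> R.
Proof.
have x1 : 49 / 50 <= expR (- (1 / 50)) :> R by apply: le_trans (expR_ge1Dx _); lra.
have dbl (p q u v : R) : 0 <= p -> q <= p * p -> v = u + u -> p <= expR u -> q <= expR v.
  by move=> p0 qp -> pu; rewrite expRD; nra.
have x2 : 24 / 25 <= expR (- (2 / 50)) :> R by apply: (dbl (49 / 50) _ (- (1 / 50))) => //; lra.
have x4 : 47 / 51 <= expR (- (4 / 50)) :> R by apply: (dbl (24 / 25) _ (- (2 / 50))) => //; lra.
have x8 : 45 / 53 <= expR (- (8 / 50)) :> R by apply: (dbl (47 / 51) _ (- (4 / 50))) => //; lra.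
have x16 : 49 / 68 <= expR (- (16 / 50)) :> R by apply: (dbl (45 / 53) _ (- (8 / 50))) => //; lra.
have x32 : 27 / 52 <= expR (- (32 / 50)) :> R by apply: (dbl (49 / 68) _ (- (16 / 50))) => //; lra.
have x64 : 7 / 26 <= expR (- (64 / 50)) :> R by apply: (dbl (27 / 52) _ (- (32 / 50))) => //; lra.
have x128 : 5 / 69 <= expR (- (128 / 50)) :> R by apply: (dbl (7 / 26) _ (- (64 / 50))) => //; lra.
have : 5 / 72 <= expR (- (13 / 5)) :> R.
  have -> : - (13 / 5) = - (128 / 50) + - (2 / 50) :> R by field.
  by rewrite expRD; nra.
rewrite expRN => h.
by rewrite -[expR _]invrK -[72 / 5]invrK lef_pV2 ?posrE ?invr_gt0 ?expR_gt0// invf_div.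
Qed.

Lemma tail_spectral t : tail R H 2 t < 1 / 4 -> (6 / kap + 3) * lam ^+ t <= tail R H 4 t.
Proof.
move=> b2; apply: le_trans (nb_le_tail 4 t).
have {b2} := le_lt_trans (nb_le_tail 2 t) b2.
rewrite nb2E nb4E [leLHS]mulrC ler_pM2l ?exprn_gt0 ?lam_gt0//.
have l0 := lam_gt0; have l9 : 9 / 10 <= lam by rewrite lamE kap2_ge.
have l1 := lam_le1.
have e9 : 0 <= eps <= 1 / 9.
  rewrite /eps divr_ge0 ?subr_ge0 ?(ltW l0)//= ler_pdivrMr//; lra.
have l1e : 1 + eps = lam^-1 by rewrite /eps; field.
pose a := t%:R * eps; rewrite -/a => a4.
have a0 : 0 <= a by rewrite mulr_ge0 ?ler0n//; case/andP: e9.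
(* Otherwise 4 (1 + a) < lam^(-t) = (1 + eps)^t <= exp a. Multiplying by 1 + (13/5 - a) gives a
   product below 72/5, yet 72/5 = 4 (1 + 13/5) is its value at both ends of [0, 13/5] and it is
   larger in between. *)
have a26 : 13 / 5 <= a.
  rewrite leNgt; apply/negP => a26.
  have h1 : (1 + a) * 4 < lam ^- t.
    by rewrite -[ltRHS]mul1r ltr_pdivlMr ?exprn_gt0//; lra.
  have h2 : lam ^- t <= expR a.
    rewrite -exprVn -l1e /a expRM_natl lerXn2r ?nnegrE ?expR_ge0 ?expR_ge1Dx//.
    by have /andP[] := e9; lra.
  have h3 : expR a * (1 + (13 / 5 - a)) <= 72 / 5.
    apply: le_trans expR_13_5; rewrite -{2}(subrKC a (13 / 5)) expRD.
    by rewrite ler_pM2l ?expR_gt0// expR_ge1Dx.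
  have h4 : (1 + a) * 4 < expR a := lt_le_trans h1 h2.
  have h5 : (1 + a) * 4 * (1 + (13 / 5 - a)) < 72 / 5.
    by apply: lt_le_trans h3; rewrite ltr_pM2r//; lra.
  by nra.
have k0 := kap_gt0.
have kge : 18 / 19 <= kap.
  by have := kap2_ge; rewrite expr2 => kk; nra.
have k6 : 6 / kap <= 19 / 3 by rewrite ler_pdivrMr//; lra.
have -> : t%:R * (t%:R - 1) / 2 * eps ^+ 2 = a * (a - eps) / 2 by rewrite /a; field.
have -> : t%:R * (t%:R - 1) * (t%:R - 2) / 6 * eps ^+ 3 = a * (a - eps) * (a - 2 * eps) / 6.
  by rewrite /a; field.
(* These bounds use a >= 13/5 and eps <= 1/9. They suffice because 1 + 13/5 + 42/13 + 23/9 exceeds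
   19/3 + 3. *)
have m1 : 112 / 45 <= a - eps by lra.
have m2 : 107 / 45 <= a - 2 * eps by lra.
have m3 : 84 / 13 <= a * (a - eps) by nra.
have m4 : 46 / 3 <= a * (a - eps) * (a - 2 * eps) by nra.
lra.
Qed.

End Spectral.

(** * Decay for large times *)

Section Circle.
Context (R : realType) (H : nat).

Definition heat_on (F : nat -> nat -> R) :=
  forall t x, (0 < x < H.*2)%N -> F t.+1 x = heat (F t) x.

Definition symmetric (f : nat -> R) := forall x, (x <= H.*2)%N -> f (H.*2 - x)%N = f x.

(* Heat flow on the circle Z/2H in which the value at the marked point 0 = 2H is
   the functional J of the values elsewhere. *)
Fixpoint evol (J : (nat -> R) -> R) (g : nat -> R) (t : nat) : nat -> R :=
  if t is t'.+1 then
    fun x => if (0 < x < H.*2)%N then heat (evol J g t') x else J (heat (evol J g t'))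
  else fun x => if (0 < x < H.*2)%N then g x else J g.

Section Evolution.
Variables (J : (nat -> R) -> R) (g : nat -> R).
Hypothesis J_ext : forall f f', (forall x, (0 < x < H.*2)%N -> f x = f' x) -> J f = J f'.

Lemma evol0E x : (0 < x < H.*2)%N -> evol J g 0 x = g x.
Proof. by move=> /= ->. Qed.

Lemma evol_heat : heat_on (evol J g).
Proof. by move=> t x /= ->. Qed.

Lemma evol_jump t : evol J g t 0 = J (evol J g t).
Proof. by case: t => [|t] /=; apply: J_ext => x ->. Qed.

Lemma evol_end t : evol J g t H.*2 = evol J g t 0.
Proof. by case: t => [|t] /=; rewrite ltnn andbF. Qed.

Lemma evol_sym t : (forall x, (0 < x < H.*2)%N -> g (H.*2 - x)%N = g x) ->
  symmetric (evol J g t).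
Proof.
move=> gs; elim: t => [|t IHt] x xH /=.
  have -> : (0 < H.*2 - x < H.*2)%N = (0 < x < H.*2)%N by lia.
  by case: ifP => // /gs.
have -> : (0 < H.*2 - x < H.*2)%N = (0 < x < H.*2)%N by lia.
case: ifP => // xin; rewrite /heat.
have -> : (H.*2 - x).-1 = (H.*2 - x.+1)%N by lia.
have -> : (H.*2 - x).+1 = (H.*2 - x.-1)%N by lia.
by rewrite !IHt; try lia; rewrite -addrA [_ / 4 + _]addrC addrA.
Qed.

End Evolution.

Lemma reflect_heat (F : nat -> nat -> R) : heat_on F -> heat_on (fun t x => F t (H.*2 - x)%N).
Proof.
move=> Fh t x xH; rewrite Fh; last lia.
rewrite /heat (_ : (H.*2 - x).-1 = (H.*2 - x.+1)%N); last lia.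
by rewrite (_ : (H.*2 - x).+1 = (H.*2 - x.-1)%N); [lra|lia].
Qed.

Lemma norm_le_of (x y : R) : x <= y -> - x <= y -> `|x| <= y.
Proof. by move=> h1 h2; rewrite ler_norml h1 andbT lerNl. Qed.

(** The difference of mirror images vanishes at 0 and at H, so on (0, H) it solves the heat equation
    with Dirichlet conditions. *)
Lemma antisym_le_dir (F : nat -> nat -> R) : heat_on F ->
  (forall t, F t H.*2 = F t 0%N) -> (forall x, (x <= H.*2)%N -> 0 <= F 0%N x <= 1) ->
  forall t x, (x <= H)%N -> `|F t x - F t (H.*2 - x)%N| <= dir H (fun=> 0) t x.
Proof.
move=> Fh Fe F01 t x xH.
have F0 := F01 _ (_ : (_ <= _)%N).
have Fr := reflect_heat Fh.
by apply: norm_le_of; rewrite ?opprB;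
  [apply: (@dir_sub _ _ _ (fun t x => F t x - F t (H.*2 - x)%N))
  |apply: (@dir_sub _ _ _ (fun t x => F t (H.*2 - x)%N - F t x))] => // {t x xH};
  first [move=> x xH; have /andP[] := F01 x ltac:(lia);
           have /andP[] := F01 (H.*2 - x)%N ltac:(lia); lra
        |move=> t; rewrite ?subn0 ?Fe ?subrr// (_ : (H.*2 - H)%N = H) ?subrr//; lia
        |move=> t x xH; rewrite Fr ?Fh; try lia; rewrite /heat; lra].
Qed.

End Circle.

Section LargeTime.
Context (R : realType) (H : nat).
Hypothesis H_odd : odd H.
Hypothesis H_ge5 : (5 <= H)%N.
Let th : R := pi / H%:R.
Local Notation lam := (lam R H).
Local Notation kap := (kap R H).

Let HE : H = H./2.*2.+1. Proof. by rewrite -{1}(odd_double_half H) H_odd. Qed.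
Let HR0 : 0 < H%:R :> R. Proof. by rewrite ltr0n; lia. Qed.
Let lam0 : 0 < lam. Proof. exact: lam_gt0. Qed.
Let lamX t : 0 < lam ^+ t. Proof. by rewrite exprn_gt0. Qed.

Let thH : th * H%:R = pi. Proof. by rewrite divfK// gt_eqF. Qed.

Let strip_cos n : (n.*2 <= H.+1)%N -> 0 < cos (th * n%:R / 2).
Proof.
move=> nH; have p0 := pi_gt0 R; have t0 : 0 < th by rewrite divr_gt0.
have h1 : th * (n%:R * 2) <= pi + th.
  rewrite -thH -[X in _ + X]mulr1 -mulrDr ler_pM2l//.
  by rewrite -natrM natr1 ler_nat; lia.
have h2 : th * 5 <= pi.
  by rewrite -thH ler_pM2l// (ler_nat R 5).
have n0 : 0 <= th * n%:R by rewrite mulr_ge0 ?ler0n// ltW.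
rewrite cos_gt0_pihalf//; lra.
Qed.

(** The barrier is the cosine of frequency pi / H centred in the strip, times lam^t. The strip is
    shorter than H, so it is positive, and after division by its end value it is at least 1 on the
    strip. *)
Lemma strip_decay n C (W : nat -> nat -> R) : (n.*2 <= H.+1)%N -> 0 <= C ->
  (forall x, (0 < x < n)%N -> `|W 0%N x| <= C) ->
  (forall t, `|W t 0%N| <= C * lam ^+ t) -> (forall t, `|W t n| <= C * lam ^+ t) ->
  (forall t x, (0 < x < n)%N -> W t.+1 x = heat (W t) x) ->
  forall t x, (x <= n)%N -> `|W t x| <= C / cos (th * n%:R / 2) * lam ^+ t.
Proof.
move=> nH C0 i l r s t x xn; have p0 := pi_gt0 R; have t0 : 0 < th by rewrite divr_gt0.
have cn := strip_cos nH.
pose k y := cos (th * y%:R - th * n%:R / 2) / cos (th * n%:R / 2).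
have k1 y : (y <= n)%N -> 1 <= k y.
  move=> yn; rewrite /k ler_pdivlMr// mul1r.
  have tn : th * n%:R / 2 < pi / 2.
    have h1 : th * (n%:R * 2) <= pi + th.
      rewrite -thH -[X in _ + X]mulr1 -mulrDr ler_pM2l//.
      by rewrite -natrM natr1 ler_nat; lia.
    have h2 : th * 5 <= pi.
      by rewrite -thH ler_pM2l// (ler_nat R 5).
    lra.
  have ty : 0 <= th * y%:R <= th * n%:R.
    by rewrite mulr_ge0 ?ler0n ?(ltW t0)//= ler_pM2l// ler_nat.
  have le_cos (p q : R) : 0 <= p <= q -> q <= pi -> cos q <= cos p.
    move=> /andP[p0' ]; rewrite le_eqVlt => /orP[/eqP ->//|pq] qpi.
    by rewrite ltW// ltr_cos ?in_itv/=; lra.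
  case: (leP (th * n%:R / 2) (th * y%:R)) => h; first by apply: le_cos; lra.
  by rewrite -[leRHS]cosN; apply: le_cos; lra.
have kh y : (0 < y)%N -> heat k y = lam * k y.
  move=> y0; rewrite /k [RHS]mulrA.
  have := heat_cos th (- (th * n%:R / 2)) y0 => e.
  have -> : heat (fun z => cos (th * z%:R - th * n%:R / 2) / cos (th * n%:R / 2)) y =
     heat (fun z => cos (th * z%:R - th * n%:R / 2)) y / cos (th * n%:R / 2).
    by rewrite /heat; field; rewrite gt_eqF.
  by congr (_ / _); exact: e.
suff h : `|W t x| <= C * k x * lam ^+ t.
  apply: le_trans h _; rewrite ler_pM2r// ler_wpM2l// /k -[leRHS]mul1r ler_pM2r ?invr_gt0//.
have key (U : nat -> nat -> R) :
    (forall x, (0 < x < n)%N -> U 0%N x <= C) ->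
    (forall t, U t 0%N <= C * lam ^+ t) -> (forall t, U t n <= C * lam ^+ t) ->
    (forall t x, (0 < x < n)%N -> U t.+1 x = heat (U t) x) -> U t x <= C * k x * lam ^+ t.
  move=> Ui Ul Ur Us; rewrite -subr_le0.
  have CL u y : (y <= n)%N -> C * lam ^+ u <= C * k y * lam ^+ u.
    by move=> yn; rewrite ler_pM2r// ler_peMr// k1.
  apply: (@max_principle R n (fun t x => U t x - C * k x * lam ^+ t)) => //.
  - move=> y yn; rewrite subr_le0; apply: le_trans (Ui _ yn) _.
    by have := CL 0%N y ltac:(lia); rewrite !expr0 !mulr1.
  - by move=> u; rewrite subr_le0; apply: le_trans (Ul u) (CL _ _ _).
  - by move=> u; rewrite subr_le0; apply: le_trans (Ur u) (CL _ _ _).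
  - move=> u y yn; rewrite Us//; have := kh y ltac:(lia); rewrite /heat exprS => e.
    have -> : C * k y * (lam * lam ^+ u) = C * (lam * k y) * lam ^+ u by ring.
    by rewrite -e; lra.
apply: norm_le_of.
  apply: key.
  - by move=> y yn; apply: le_trans (ler_norm _) (i _ yn).
  - by move=> u; apply: le_trans (ler_norm _) (l u).
  - by move=> u; apply: le_trans (ler_norm _) (r u).
  - by move=> u y yn; apply: s.
apply: (key (fun t x => - W t x)).
- by move=> y yn; apply: le_trans (ler_norm _) _; rewrite normrN i.
- by move=> u; apply: le_trans (ler_norm _) _; rewrite normrN.
- by move=> u; apply: le_trans (ler_norm _) _; rewrite normrN.
- by move=> u y yn; rewrite s//; rewrite /heat; lra.
Qed.

(** The two angles have sum pi/2 and difference pi/(2H). *)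
Lemma strip_cos_mul :
  cos (th * H./2.+1%:R / 2) * cos (th * H./2%:R / 2) = kap / 2.
Proof.
have HR : H%:R = H./2%:R * 2 + 1 :> R by rewrite {1}HE -natr1 -muln2 natrM.
have e1 : th * H./2.+1%:R / 2 = pi / 4 + th / 4 by rewrite -thH HR -natr1; field.
have e2 : th * H./2%:R / 2 = pi / 4 - th / 4 by rewrite -thH HR; field.
have e3 : pi / 4 + th / 4 + (pi / 4 - th / 4) = pi / 2 by field.
have e4 : pi / 4 + th / 4 - (pi / 4 - th / 4) = th / 2 by field.
rewrite e1 e2; move: e3 e4; move: (pi / 4 + th / 4) (pi / 4 - th / 4) => p q e3 e4.
move/eqP: (cos_pihalf R); rewrite -e3 cosD.
have -> : kap = cos (th / 2) by [].
by rewrite -e4 cosB subr_eq0 => /eqP <-; field.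
Qed.

Section SingleTarget.
Variable g : nat -> R.
Hypothesis g_sym : forall x, (0 < x < H.*2)%N -> g (H.*2 - x)%N = g x.
Hypothesis g01 : forall x, (x <= H.*2)%N -> 0 <= g x <= 1.
Let J (f : nat -> R) := f H.-1.
Let E := evol H J g.

Let J_ext (f f' : nat -> R) : (forall x, (0 < x < H.*2)%N -> f x = f' x) -> J f = J f'.
Proof. by apply; lia. Qed.

Let E0_diff x y : (0 < x < H.*2)%N -> (0 < y < H.*2)%N -> `|E 0%N x - E 0%N y| <= 1.
Proof.
move=> xH yH; rewrite /E !evol0E// ler_norml.
have := g01 (x := x) ltac:(lia); have := g01 (x := y) ltac:(lia); lra.
Qed.

Let E_jump t : E t H.-1 = E t 0%N.
Proof. by rewrite /E evol_jump. Qed.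

(** E(0) equals E(H - 1), which is compared with E(x) by moving (H - 1, x) as mirror images on a
    strip of width (H - 1)/2. At the outer end the pair has become (H - 1 + x/2, x/2) and moves in
    parallel on a strip of width (H + 1)/2, between the jump rule at y = 0 and a pair of mirror
    images about H. The two strips contribute the factors whose product is 2 / kap. *)
Lemma single_target_decay t x : ~~ odd x -> (0 < x < H.*2)%N ->
  `|E t 0%N - E t x| <= 2 / kap * lam ^+ t.
Proof.
move=> xe; wlog xH : x xe / (x < H)%N => [hw|] x0.
  case: (ltngtP x H) => xH; [exact: hw| |by move: xe; rewrite xH H_odd].
  have <- : E t (H.*2 - x)%N = E t x by apply: evol_sym => //; lia.
  by apply: hw; rewrite ?oddB ?odd_double ?(negbTE xe)//; lia.
have Eh : heat_on H E := evol_heat J g.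
have Es s : symmetric H (E s) := evol_sym J s g_sym.
have stripp := strip_cos (n := H./2.+1) ltac:(lia).
have strip2 := strip_cos (n := H./2) ltac:(lia).
pose C1 := 1 / cos (th * H./2.+1%:R / 2).
have sync s y : (y <= H./2.+1)%N -> `|E s (H.-1 + y)%N - E s y| <= C1 * lam ^+ s.
  move=> yn; apply: (strip_decay (n := H./2.+1) (W := fun t y => E t (H.-1 + y)%N - E t y)) => //.
  - by lia.
  - by move=> z zn; apply: E0_diff; lia.
  - by move=> u; rewrite addn0 E_jump subrr normr0 mul1r ltW.
  - move=> u; rewrite (_ : (H.-1 + H./2.+1)%N = (H.*2 - H./2.+1)%N); last lia.
    by rewrite Es ?subrr ?normr0 ?mul1r ?ltW//; lia.
  - move=> u z zn; rewrite !Eh; try lia.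
    by rewrite /heat (_ : (H.-1 + z).-1 = (H.-1 + z.-1)%N) ?addnS; [lra|lia].
have mirror s y : (y <= H./2)%N ->
    `|E s (H.-1 + x./2 - y)%N - E s (x./2 + y)%N| <= C1 / cos (th * H./2%:R / 2) * lam ^+ s.
  move=> yn; apply: (strip_decay (n := H./2)
      (W := fun t y => E t (H.-1 + x./2 - y)%N - E t (x./2 + y)%N)) => //.
  - by lia.
  - by rewrite divr_ge0 ?ltW.
  - move=> z zn; apply: le_trans (E0_diff _ _) _; try lia.
    rewrite /C1 ler_pdivlMr// mul1r; exact: cos_le1.
  - by move=> u; rewrite subn0 addn0; apply: sync; lia.
  - move=> u; rewrite (_ : (H.-1 + x./2 - H./2)%N = (x./2 + H./2)%N); last lia.
    by rewrite subrr normr0 mulr_ge0 ?divr_ge0 ?ltW.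
  - move=> u z zn; rewrite !Eh; try lia.
    rewrite /heat (_ : (H.-1 + x./2 - z).-1 = (H.-1 + x./2 - z.+1)%N); last lia.
    rewrite (_ : (H.-1 + x./2 - z).+1 = (H.-1 + x./2 - z.-1)%N); last lia.
    rewrite (_ : (x./2 + z).-1 = (x./2 + z.-1)%N); last lia.
    by rewrite (_ : (x./2 + z).+1 = (x./2 + z.+1)%N); [lra|lia].
have := mirror t x./2 ltac:(lia).
rewrite addnK E_jump (_ : (x./2 + x./2)%N = x); last lia.
by rewrite /C1 -[2 / kap]invf_div -strip_cos_mul invfM div1r.
Qed.

End SingleTarget.

End LargeTime.

Section Jump.
Context (R : realType) (H : nat) (w : nat -> R).
Hypothesis H_odd : odd H.
Hypothesis H_ge5 : (5 <= H)%N.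
Hypothesis w_ge0 : forall z, 0 <= w z.
Hypothesis w_supp : forall z, 0 < w z -> [&& ~~ odd z, (4 <= z)%N & (z + 4 <= H.*2)%N].
Hypothesis w_sum : \sum_(z < H.*2) w z = 1.

Let w_eq0 z : ~~ [&& ~~ odd z, (4 <= z)%N & (z + 4 <= H.*2)%N] -> w z = 0.
Proof.
by move=> zN; apply/eqP; move: zN; apply: contraNT => wz; apply: w_supp; rewrite lt0r wz w_ge0.
Qed.

Definition mean (f : nat -> R) := \sum_(z < H.*2) w z * f z.

Lemma mean_ext f f' : (forall x, (0 < x < H.*2)%N -> f x = f' x) -> mean f = mean f'.
Proof.
move=> ff'; apply: eq_bigr => -[[|z] /= zH] _; last by rewrite ff'.
by rewrite w_eq0 ?mul0r.
Qed.

Lemma meanD f f' : mean (fun x => f x + f' x) = mean f + mean f'.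
Proof. by rewrite -big_split; apply: eq_bigr => z _; rewrite mulrDr. Qed.

Lemma meanZ k f : mean (fun x => k * f x) = k * mean f.
Proof. by rewrite mulr_sumr; apply: eq_bigr => z _; rewrite mulrCA. Qed.

Lemma mean_cst k : mean (fun=> k) = k.
Proof. by rewrite /mean -mulr_suml w_sum mul1r. Qed.

Lemma mean_norm_le f k : (forall z, 0 < w z -> `|f z| <= k) -> `|mean f| <= k.
Proof.
move=> fk; apply: le_trans (ler_norm_sum _ _ _) _.
rewrite -[leRHS]mul1r -w_sum mulr_suml; apply: ler_sum => z _.
rewrite normrM (ger0_norm (w_ge0 z)); have := w_ge0 z.
rewrite le_eqVlt => /orP[/eqP <-|wz]; first by rewrite !mul0r.
by rewrite ler_wpM2l// fk.
Qed.

Definition fold_weight z := if (z < H)%N then w z + w (H.*2 - z)%N else 0.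

Lemma fold_mean f : symmetric H f -> mean f = \sum_(z < H) fold_weight z * f z.
Proof.
move=> fs; rewrite /mean -(big_mkord xpredT (fun z => w z * f z)).
rewrite (big_cat_nat (n := H))//=; last lia.
have -> : \sum_(H <= z < H.*2) w z * f z = \sum_(0 <= z < H) w (H.*2 - z)%N * f z.
  (* Shifting the range by one trades the term w(2H) for w(H); both vanish, the second because H is
     odd. *)
  have -> : \sum_(0 <= z < H) w (H.*2 - z)%N * f z = \sum_(1 <= z < H.+1) w (H.*2 - z)%N * f z.
    have H0 : (0 < H)%N by lia.
    rewrite big_nat_recr//= (big_ltn H0).
    rewrite subn0 (_ : (H.*2 - H)%N = H); last lia.
    by rewrite !w_eq0 ?H_odd ?mul0r ?add0r ?addr0//; lia.
  rewrite big_nat_rev /=.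
  rewrite -{1}[H]add0n big_addn -[1%N in RHS]add0n big_addn.
  rewrite (_ : (H.*2 - H)%N = H) ?subn1 /=; last lia.
  rewrite big_nat_cond [RHS]big_nat_cond; apply: eq_bigr => z /andP[/andP[_ zH] _].
  rewrite (_ : (H + H.*2 - (z + H).+1)%N = (H.*2 - (z + 1))%N); last lia.
  by rewrite fs//; lia.
rewrite -(big_mkord xpredT (fun z => fold_weight z * f z)) -big_split /=.
rewrite big_nat_cond [RHS]big_nat_cond; apply: eq_bigr => z /andP[/andP[_ zH] _].
by rewrite /fold_weight zH mulrDl.
Qed.

Lemma fold_weight_ge0 z : 0 <= fold_weight z.
Proof. by rewrite /fold_weight; case: ifP => // _; rewrite addr_ge0. Qed.

Lemma fold_weight_gt0 z : 0 < fold_weight z -> (z < H)%N /\ (0 < w z \/ 0 < w (H.*2 - z)%N).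
Proof.
rewrite /fold_weight; case: ifP => [zH|_]; last by rewrite ltxx.
have := w_ge0 z; rewrite le_eqVlt => /orP[/eqP <-|]; last by auto.
by rewrite add0r; auto.
Qed.

Lemma fold_weight_sum : \sum_(z < H) fold_weight z = 1.
Proof.
have := @fold_mean (fun=> 1) (fun _ _ => erefl); rewrite mean_cst => ->.
by apply: eq_bigr => z _; rewrite mulr1.
Qed.

Let fold_supp z : 0 < fold_weight z -> [&& ~~ odd z, (4 <= z)%N & (z < H)%N].
Proof.
move=> /fold_weight_gt0[zH [/w_supp/and3P[]|/w_supp/and3P[]]].
  by move=> -> ->; rewrite zH.
by rewrite oddB ?odd_double//; lia.
Qed.

Let fold_top : exists a, 0 < fold_weight a.*2 /\ forall z, 0 < fold_weight z -> (z <= a.*2)%N.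
Proof.
have [||m fm max] := @ex_maxnP (fun z => 0 < fold_weight z) H.
- case: (pselect (exists z, 0 < fold_weight z)) => // N; exfalso.
  have := fold_weight_sum; rewrite big1 => [/eqP|z _]; first by rewrite eq_sym oner_eq0.
  apply/eqP; rewrite eq_le fold_weight_ge0 andbT leNgt; apply/negP => h.
  by apply: N; exists z.
- by move=> z /fold_supp/and3P[_ _ /ltnW].
exists m./2; have /and3P[me _ _] := fold_supp fm.
by rewrite even_halfK//; split.
Qed.

Lemma even_jump_dominates (G : nat -> nat -> R) t x :
  heat_on H G -> (forall t, symmetric H (G t)) -> (forall t, G t 0%N = mean (G t)) ->
  (forall x, (0 < x < H)%N -> G 0%N x <= G 0%N x.+1) ->
  (forall z, 0 < w z -> (x <= z)%N && (x <= H.*2 - z)%N) -> G t x <= G t 0%N.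
Proof.
move=> Gh Gs Gj Gm xz; have [a [wa amax]] := fold_top.
have aH : (a.*2 < H)%N by have /and3P[] := fold_supp wa.
apply: (@jump_dominates _ H a fold_weight) => //.
- exact: fold_weight_ge0.
- by move=> z wz; have /and3P[-> -> _] := fold_supp wz; rewrite amax.
- exact: fold_weight_sum.
- by move=> s; rewrite Gj fold_mean.
- by move=> z /fold_weight_gt0[zH [/xz|/xz]] /andP[]; lia.
Qed.

Definition marked (x : nat) : R := ((x == 0) || (x == H.*2))%N%:R.

(* [impulse t x] is the probability that the chain started at x is at the jump
   point at time t, a visit to the jump point being followed by an instantaneous jump. *)
Definition impulse t : nat -> R := if t is t'.+1 then evol H mean (heat marked) t' else marked.

Let marked_in x : (0 < x < H.*2)%N -> marked x = 0.
Proof. by rewrite /marked => xH; case: eqP => [|_]; [lia|]; case: eqP => //; lia. Qed.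

Let marked_sym : symmetric H marked.
Proof.
by move=> x xH; rewrite /marked; congr (_%:R); congr (nat_of_bool _); lia.
Qed.

Lemma impulse_heat : heat_on H impulse.
Proof.
move=> [|t] x xH; first by rewrite /impulse evol0E.
exact: evol_heat.
Qed.

Lemma impulse_jump t : impulse t.+1 0%N = mean (impulse t.+1).
Proof. by rewrite /impulse evol_jump//; exact: mean_ext. Qed.

Lemma impulse_end t : impulse t H.*2 = impulse t 0%N.
Proof. by case: t => [|t]; rewrite /impulse ?evol_end// /marked eqxx orbT. Qed.

Lemma impulse_sym t : symmetric H (impulse t).
Proof.
case: t => [|t]; first exact: marked_sym.
apply: evol_sym => x xH; rewrite /heat.
rewrite (_ : (H.*2 - x).-1 = (H.*2 - x.+1)%N); last lia.
rewrite (_ : (H.*2 - x).+1 = (H.*2 - x.-1)%N); last lia.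
rewrite !marked_sym; try lia.
by rewrite addrAC.
Qed.

(** By linearity, each defect g s of the jump rule acts as an impulse released at the marked point
    at time s. The term s = t is seen only at the marked point itself. *)
Lemma duhamel (V : nat -> nat -> R) g :
  heat_on H V -> (forall x, (0 < x < H.*2)%N -> V 0%N x = 0) ->
  (forall t, V t 0%N = mean (V t) + g t) -> (forall t, V t H.*2 = V t 0%N) ->
  forall t x, (x <= H.*2)%N -> V t x = \sum_(s < t.+1) g s * impulse (t - s) x.
Proof.
move=> Vh V0 Vj Ve.
have bd t : (forall x, (0 < x < H.*2)%N -> V t x = \sum_(s < t.+1) g s * impulse (t - s) x) ->
    forall x, (x <= H.*2)%N -> V t x = \sum_(s < t.+1) g s * impulse (t - s) x.
  move=> Vt; have j0 : V t 0%N = \sum_(s < t.+1) g s * impulse (t - s) 0%N.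
    rewrite Vj (mean_ext Vt) big_ord_recr /= subnn [impulse 0 0]mulr1n mulr1.
    congr (_ + _); rewrite /mean (eq_bigr (fun z : 'I_H.*2 =>
      \sum_(s < t.+1) w z * (g s * impulse (t - s) z))); last by move=> z _; rewrite mulr_sumr.
    rewrite exchange_big [LHS]big_ord_recr /= [X in _ + X]big1 ?addr0; last first.
      move=> z _; rewrite subnn; case: (posnP z) => z0; first by rewrite z0 w_eq0 ?mul0r.
      by rewrite [impulse 0 z]marked_in ?z0 ?ltn_ord// !mulr0.
    apply: eq_bigr => s _; rewrite -(prednK (_ : (0 < t - s)%N)) ?subn_gt0//.
    by rewrite impulse_jump /mean mulr_sumr; apply: eq_bigr => z _; rewrite mulrCA.
  move=> x xH; case: (posnP x) => [->//|x0].
  case: (ltngtP x H.*2) xH => // [xH _|-> _]; first by rewrite Vt// x0.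
  by rewrite Ve j0; apply: eq_bigr => s _; rewrite impulse_end.
elim=> [|t IHt]; first by apply: bd => x xH; rewrite V0// big_ord1 subnn /impulse marked_in ?mulr0.
apply: bd => x xH; rewrite Vh// big_ord_recr /= subnn [impulse 0 x]marked_in// mulr0 addr0.
rewrite /heat !IHt; try lia.
rewrite !mulr_suml -!big_split/=; apply: eq_bigr => s _.
rewrite subSn ?impulse_heat//; last by rewrite -ltnS.
by rewrite /heat; lra.
Qed.

Variable h : nat.
Hypothesis h_gt0 : (0 < h)%N.
Hypothesis h_even : ~~ odd h.
Hypothesis h_supp : forall z, 0 < w z -> (h < z)%N && (z + h < H.*2)%N.

Local Notation lam := (lam R H).
Local Notation kap := (kap R H).
Let th : R := pi / H%:R.
Let HR0 : 0 < H%:R :> R. Proof. by rewrite ltr0n; lia. Qed.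
Let thH : th * H%:R = pi. Proof. by rewrite divfK// gt_eqF. Qed.
Let th0 : 0 < th. Proof. by rewrite divr_gt0// pi_gt0. Qed.
Let lam0 : 0 < lam. Proof. exact: lam_gt0. Qed.
Let lamX t : 0 < lam ^+ t. Proof. by rewrite exprn_gt0. Qed.

Let hH : (h < H)%N.
Proof.
case: (pselect (exists z, 0 < w z)) => [[z /h_supp]|N]; first by lia.
have := w_sum; rewrite big1 => [/eqP|z _]; first by rewrite eq_sym oner_eq0.
by apply/eqP; rewrite eq_le w_ge0 andbT leNgt; apply/negP => wz; apply: N; exists z.
Qed.

(** Dominance is applied to the negated response, which one step after the impulse is nondecreasing
    on (0, H), since the response is then concentrated next to the marked point. *)
Lemma impulse_excess_ge0 t : 0 <= impulse t.+1 h - impulse t.+1 0%N.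
Proof.
rewrite subr_ge0 -lerN2.
apply: (@even_jump_dominates (fun t x => - impulse t.+1 x)).
- by move=> s x xH; rewrite impulse_heat// /heat; lra.
- by move=> s x xH; rewrite impulse_sym.
- by move=> s; rewrite impulse_jump -mulN1r -meanZ; congr mean; apply/funext => x; rewrite mulN1r.
- move=> x xH; rewrite lerN2 !impulse_heat; try lia.
  rewrite /heat /= !(marked_in (x := x), marked_in (x := x.+1), marked_in (x := x.+2)); try lia.
  have m0 : 0 <= marked x.-1 by exact: ler0n.
  by lra.
- by move=> z /h_supp; lia.
Qed.

Let cos_le (p q : R) : 0 <= p <= q -> q <= pi -> cos q <= cos p.
Proof.
move=> /andP[p0' ]; rewrite le_eqVlt => /orP[/eqP ->//|pq] qpi.
by rewrite ltW// ltr_cos ?in_itv/=; lra.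
Qed.

Let cosc x : R := cos (th * x%:R).

Let cosc_le x y : (x <= y <= H)%N -> cosc y <= cosc x.
Proof.
case/andP=> xy yH; apply: cos_le; last by rewrite -thH ler_pM2l// ler_nat.
by rewrite mulr_ge0 ?ler0n ?(ltW th0)//= ler_pM2l// ler_nat.
Qed.

Let cosc_sym : symmetric H cosc.
Proof.
move=> x xH; rewrite /cosc natrB// mulrBr -muln2 natrM mulrA thH [pi * _]mulr_natr.
by rewrite -opprB cosN -[LHS]cosD2pi subrK.
Qed.

Let cosc1_lt1 : cosc 1 < 1.
Proof.
have tp : th <= pi by rewrite -thH ler_peMr ?(ltW th0)// ler1n; lia.
by rewrite -cos0 /cosc mulr1 ltr_cos// in_itv/= ?lexx ?pi_ge0 ?(ltW th0).
Qed.

Let cosc_heat x : (0 < x)%N -> heat cosc x = lam * cosc x.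
Proof.
move=> x0; have := heat_cos th 0 x0.
rewrite (_ : (fun x => cos (th * x%:R + 0)) = cosc) ?addr0//.
by apply/funext => y; rewrite addr0.
Qed.

(* Evaluated on the increasing eigenfunction - cos (pi x / H). *)
Lemma impulse_excess_sum t :
  \sum_(s < t) lam ^+ s * (impulse (t - s) h - impulse (t - s) 0%N) <= lam ^+ t.
Proof.
pose phi x := - cosc x; pose G := evol H mean phi.
have Gh : heat_on H G := evol_heat mean phi.
have Gj s : G s 0%N = mean (G s) by rewrite /G evol_jump//; exact: mean_ext.
have Ge s : G s H.*2 = G s 0%N := evol_end H mean phi s.
have Gle : G t h <= G t 0%N.
  apply: even_jump_dominates => //.
  - by move=> s; apply: evol_sym => x xH; rewrite /phi cosc_sym//; lia.
  - by move=> x xH; rewrite /G !evol0E; try lia; rewrite lerN2 cosc_le; lia.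
  - by move=> z /h_supp; lia.
(* As phi 0 = -1, k is the amount by which phi violates the jump rule; the difference V below
   therefore has source lam^s k. *)
pose k := mean (fun x => 1 - cosc x).
have k0 : 0 < k.
  apply: (@lt_le_trans _ _ (1 - cosc 1)); first by rewrite subr_gt0.
  rewrite -[leLHS]mean_cst; apply: ler_sum => z _.
  have := w_ge0 z; rewrite le_eqVlt => /orP[/eqP <-|wz]; first by rewrite !mul0r.
  have := h_supp wz; rewrite ler_pM2l// lerD2l lerN2 => hz.
  case: (leqP z H) => zH; first by apply: cosc_le; lia.
  by rewrite -cosc_sym; [apply: cosc_le|]; lia.
have V := @duhamel (fun s x => G s x - lam ^+ s * phi x) (fun s => lam ^+ s * k).
have {}V : forall x, (x <= H.*2)%N ->
   G t x - lam ^+ t * phi x = \sum_(s < t.+1) lam ^+ s * k * impulse (t - s) x.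
  move=> x xH; apply: V => //.
  - move=> s y yH; rewrite Gh// /heat exprS.
    have := cosc_heat (x := y) ltac:(lia); rewrite /heat /phi => e.
    by rewrite -mulrA [lam * (_ * _)]mulrCA mulrN -e; lra.
  - by move=> y yH; rewrite /G evol0E// expr0 mul1r subrr.
  - move=> s; rewrite Gj.
    have -> : mean (fun y => G s y - lam ^+ s * phi y) = mean (G s) - lam ^+ s * mean phi.
      by rewrite -mulNr -meanZ -meanD; congr mean; apply/funext => y; rewrite mulNr.
    have -> : k = 1 + mean phi by rewrite /k meanD mean_cst.
    by rewrite /phi /cosc mulr0 cos0; ring.
  - by move=> s; rewrite Ge /phi -(@cosc_sym 0%N)// subn0.
have := V h ltac:(lia); have := V 0%N ltac:(lia).
rewrite !big_ord_recr /= subnn [impulse 0 0]mulr1n [impulse 0 h]marked_in; last lia.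
have -> : phi 0%N = -1 by rewrite /phi /cosc mulr0 cos0.
move=> V0 Vh.
suff : k * (\sum_(s < t) lam ^+ s * (impulse (t - s) h - impulse (t - s) 0%N)) <= k * lam ^+ t.
  by rewrite ler_pM2l.
have -> : k * (\sum_(s < t) lam ^+ s * (impulse (t - s) h - impulse (t - s) 0%N)) =
  \sum_(s < t) lam ^+ s * k * impulse (t - s) h - \sum_(s < t) lam ^+ s * k * impulse (t - s) 0%N.
  by rewrite -sumrB mulr_sumr; apply: eq_bigr => s _; ring.
have : 0 <= lam ^+ t * (1 + phi h) by rewrite mulr_ge0 ?(ltW (lamX _))// /phi subr_ge0; exact: cos_le1.
lra.
Qed.

Variable F : nat -> nat -> R.
Hypothesis F_heat : heat_on H F.
Hypothesis F_jump : forall t, F t 0%N = mean (F t).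
Hypothesis F_end : forall t, F t H.*2 = F t 0%N.
Hypothesis F01 : forall x, (x <= H.*2)%N -> 0 <= F 0%N x <= 1.

(** In units of lam^t the constant collects 1 for the odd part at h, 2 / kap for the comparison
    chain between 0 and h, and 1 + 2 / kap twice, for the Duhamel sum over s < t and for its last
    term, present only at 0. *)
Lemma jump_large_time t : `|F t h - F t 0%N| <= (6 / kap + 3) * lam ^+ t.
Proof.
pose S t x := (F t x + F t (H.*2 - x)%N) / 2; pose A t x := (F t x - F t (H.*2 - x)%N) / 2.
have FSA s x : F s x = S s x + A s x by rewrite /S /A; field.
have Fr := reflect_heat F_heat.
have Aup s x : (x <= H.*2)%N -> `|A s x| <= lam ^+ s.
  suff low y : (y <= H)%N -> `|A s y| <= lam ^+ s.
    case: (leqP x H) => xH xH2; first exact: low.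
    have -> : A s x = - A s (H.*2 - x)%N by rewrite /A subKn//; field.
    by rewrite normrN low//; lia.
  move=> yH; rewrite /A normrM (ger0_norm (x := 2^-1))//.
  rewrite ler_pdivrMr// [leRHS]mulrC.
  apply: le_trans (antisym_le_dir F_heat F_end F01 s yH) _; exact: dir_decay.
have Ss s : symmetric H (S s) by move=> x xH; rewrite /S subKn// addrC.
have Sh : heat_on H S.
  by move=> s x xH; rewrite /S F_heat// Fr// /heat; lra.
have S01 x : (x <= H.*2)%N -> 0 <= S 0%N x <= 1.
  by move=> xH; have := F01 xH; have := F01 (leq_subr x H.*2); rewrite /S; lra.
(* The comparison chain starts from the same even data, so the difference vanishes initially off the
   marked point, as the Duhamel formula requires. *)
pose Sh' := evol H (fun f => f H.-1) (S 0%N).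
have J_ext (f f' : nat -> R) : (forall x, (0 < x < H.*2)%N -> f x = f' x) -> f H.-1 = f' H.-1.
  by apply; lia.
have Sd s x : ~~ odd x -> (0 < x < H.*2)%N -> `|Sh' s 0%N - Sh' s x| <= 2 / kap * lam ^+ s.
  by move=> xe xH; apply: single_target_decay => // y yH; apply: Ss; lia.
(* The defect has two causes: the odd part enters the mean in the jump rule, and the comparison
   chain jumps to H - 1 instead of to a random target. *)
pose g s := mean (A s) + mean (fun z => Sh' s z - Sh' s 0%N).
have gle s : `|g s| <= (1 + 2 / kap) * lam ^+ s.
  rewrite mulrDl mul1r; apply: le_trans (ler_normD _ _) (lerD _ _).
    by apply: mean_norm_le => z wz; apply: Aup; have := h_supp wz; lia.
  apply: mean_norm_le => z wz; rewrite distrC; have /and3P[] := w_supp wz => ze z4 z5.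
  by apply: Sd => //; lia.
have V x : (x <= H.*2)%N -> S t x - Sh' t x = \sum_(s < t.+1) g s * impulse (t - s) x.
  move=> xH; apply: (@duhamel (fun s x => S s x - Sh' s x) g) => //.
  - by move=> s y yH; rewrite Sh// /Sh' evol_heat// /heat; lra.
  - by move=> y yH; rewrite /Sh' evol0E// subrr.
  - move=> s; have -> : S s 0%N = mean (S s) + mean (A s).
      rewrite -meanD (_ : (fun x => S s x + A s x) = F s); last by apply/funext => y; rewrite FSA.
      by rewrite -F_jump /S subn0 F_end; lra.
    have mB f f' : mean (fun x => f x - f' x) = mean f - mean f'.
      by rewrite -mulN1r -meanZ -meanD; congr mean; apply/funext => y; rewrite mulN1r.
    by rewrite /g !mB mean_cst; ring.
  - by move=> s; rewrite /S subnn subn0 F_end /Sh' evol_end.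
have V0 := V 0%N (leq0n _); have Vh := V h ltac:(lia).
have sumE : \sum_(s < t.+1) g s * impulse (t - s) h - \sum_(s < t.+1) g s * impulse (t - s) 0%N =
    \sum_(s < t) g s * (impulse (t - s) h - impulse (t - s) 0%N) - g t.
  rewrite !big_ord_recr /= subnn [impulse 0 0]mulr1n [impulse 0 h]marked_in; last lia.
  by under [in RHS]eq_bigr do rewrite mulrBr; rewrite sumrB; ring.
have sum_le : `|\sum_(s < t) g s * (impulse (t - s) h - impulse (t - s) 0%N)| <=
    (1 + 2 / kap) * lam ^+ t.
  have k0 := kap_gt0 R H_odd H_ge5.
  apply: le_trans (ler_norm_sum _ _ _) _.
  apply: (@le_trans _ _ (\sum_(s < t) (1 + 2 / kap) *
      (lam ^+ s * (impulse (t - s) h - impulse (t - s) 0%N)))).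
    apply: ler_sum => s _; rewrite mulrA normrM ler_pM//.
    by rewrite -(prednK (_ : (0 < t - s)%N)) ?subn_gt0// ger0_norm// impulse_excess_ge0.
  by rewrite -mulr_sumr ler_wpM2l ?impulse_excess_sum// addr_ge0// divr_ge0// ltW.
have -> : F t h - F t 0%N = A t h - (Sh' t 0%N - Sh' t h) +
   (\sum_(s < t) g s * (impulse (t - s) h - impulse (t - s) 0%N) - g t).
  have A0 : A t 0%N = 0 by rewrite /A subn0 F_end subrr mul0r.
  by rewrite -sumE -V0 -Vh !FSA A0; ring.
have h1 := Aup t h ltac:(lia); have h2 := Sd t h h_even ltac:(lia); have h3 := gle t.
move: h1 h2 h3 sum_le; rewrite !ler_norml => /andP[a1 a2] /andP[b1 b2] /andP[c1 c2] /andP[d1 d2].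
have e : (6 / kap + 3) * lam ^+ t = lam ^+ t + 2 / kap * lam ^+ t + (1 + 2 / kap) * lam ^+ t +
   (1 + 2 / kap) * lam ^+ t by ring.
by rewrite e; apply/andP; split; lra.
Qed.

End Jump.

(** * Small times *)

(** The probability that a lazy walk started at y first reaches 0 at time s, without leaving (0, n)
    before. *)
Fixpoint hit (R : realType) (n s : nat) (y : nat) {struct s} : R :=
  if s is s'.+1 then (if (0 < y < n)%N then heat (hit R n s') y else 0) else (y == 0)%N%:R.

(* The expected value, for a walk started at y, of f at the time remaining when
   the walk leaves the interval (0, n) through 0 before time t. *)
Definition hconv (R : realType) n (f : nat -> R) t y := \sum_(s < t.+1) hit R n s y * f (t - s)%N.

Section Hitting.
Context (R : realType).
Implicit Types (n s t y : nat) (f : nat -> R).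

Lemma hit_ge0 n s y : 0 <= hit R n s y.
Proof.
elim: s y => [|s IHs] y /=; first exact: ler0n.
by case: ifP => // _; rewrite /heat; have := IHs y; have := IHs y.-1; have := IHs y.+1; lra.
Qed.

Lemma hit_le n m s y : (n <= m)%N -> hit R n s y <= hit R m s y.
Proof.
move=> nm; elim: s y => [|s IHs] y //=.
case: (boolP (0 < y < n)%N) => yn; last by case: ifP => // _; rewrite /heat;
  have := hit_ge0 m s y; have := hit_ge0 m s y.-1; have := hit_ge0 m s y.+1; lra.
rewrite (_ : (0 < y < m)%N = true); last lia.
by rewrite /heat; have := IHs y; have := IHs y.-1; have := IHs y.+1; lra.
Qed.

Lemma hconv0 n f y : (0 < y)%N -> hconv n f 0 y = 0.
Proof. by move=> y0; rewrite /hconv big_ord1 /= (gtn_eqF y0) mul0r. Qed.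

Lemma hconv_left n f t : hconv n f t 0 = f t.
Proof.
by rewrite /hconv big_ord_recl/= mul1r subn0 big1 ?addr0// => s _; rewrite mul0r.
Qed.

Lemma hconv_right n f t : (0 < n)%N -> hconv n f t n = 0.
Proof.
move=> n0; rewrite /hconv big1// => -[[|s] sH] _ /=; first by rewrite (gtn_eqF n0) mul0r.
by rewrite ltnn andbF mul0r.
Qed.

Lemma hconvS n f t y : (0 < y < n)%N -> hconv n f t.+1 y = heat (hconv n f t) y.
Proof.
move=> yn; rewrite /hconv big_ord_recl /= (gtn_eqF (_ : 0 < y)%N); last by case/andP: yn.
rewrite mul0r add0r /heat !mulr_suml -!big_split /=; apply: eq_bigr => s _.
by rewrite /bump/= subSS /= yn /heat; lra.
Qed.

Lemma hconv_le n f f' t y : (forall s, f s <= f' s) -> hconv n f t y <= hconv n f' t y.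
Proof. by move=> ff'; apply: ler_sum => s _; rewrite ler_wpM2l ?hit_ge0. Qed.

Lemma hconvD n f f' t y : hconv n (fun s => f s + f' s) t y = hconv n f t y + hconv n f' t y.
Proof. by rewrite -big_split; apply: eq_bigr => s _; rewrite mulrDr. Qed.

Lemma hconvN n f t y : hconv n (fun s => - f s) t y = - hconv n f t y.
Proof. by rewrite -sumrN; apply: eq_bigr => s _; rewrite mulrN. Qed.

(** Leaving through 0 by time t and not having left by time t are disjoint events. *)
Lemma hconv1_add_dir H t y : (0 < H)%N -> (y <= H)%N ->
  hconv H (fun=> 1) t y + dir H (fun=> 0 : R) t y <= 1.
Proof.
move=> H0 yH; rewrite -subr_le0.
apply: (@max_principle R H (fun t y => hconv H (fun=> 1) t y + dir H (fun=> 0) t y - 1)) => //.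
- by move=> x xH; rewrite hconv0 ?dir0E; [lra| |]; lia.
- by move=> s; rewrite hconv_left dir_left; lra.
- by move=> s; rewrite hconv_right// dir_right; lra.
- by move=> s x xH; rewrite hconvS// dirS// /heat; lra.
Qed.

(* Subtracting the contribution of the paths that leave through 0. *)
Lemma hconv_rest n (Z : nat -> nat -> R) (b : nat -> nat -> R) (W := fun t y => Z t y - hconv n (Z ^~ 0%N) t y) :
  (0 < n)%N ->
  (forall t y, (0 < y < n)%N -> Z t.+1 y = heat (Z t) y) ->
  (forall t y, (0 < y < n)%N -> b t.+1 y = heat (b t) y) ->
  (forall y, (0 < y < n)%N -> `|Z 0%N y| <= b 0%N y) ->
  (forall t, 0 <= b t 0%N) -> (forall t, `|Z t n| <= b t n) ->
  forall t y, (y <= n)%N -> `|W t y| <= b t y.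
Proof.
move=> n0 Zh bh Z0 b0 Zn t y yn.
have W0 y' : (0 < y' < n)%N -> W 0%N y' = Z 0%N y'.
  by case/andP=> y0 _; rewrite /W hconv0// subr0.
have Wl s : W s 0%N = 0 by rewrite /W hconv_left subrr.
have Wr s : W s n = Z s n by rewrite /W hconv_right// subr0.
have Wh s y' : (0 < y' < n)%N -> W s.+1 y' = heat (W s) y'.
  by move=> y'n; rewrite /W Zh// hconvS// /heat; lra.
apply: norm_le_of; rewrite -subr_le0.
- apply: (@max_principle R n (fun t y => W t y - b t y)) => //.
  + by move=> x xn; rewrite W0// subr_le0; apply: le_trans (ler_norm _) (Z0 _ xn).
  + by move=> s; rewrite Wl sub0r oppr_le0.
  + by move=> s; rewrite Wr subr_le0; apply: le_trans (ler_norm _) (Zn s).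
  + by move=> s x xn; rewrite Wh// bh// /heat; lra.
- apply: (@max_principle R n (fun t y => - W t y - b t y)) => //.
  + by move=> x xn; rewrite W0// subr_le0; apply: le_trans (ler_norm _) _; rewrite normrN Z0.
  + by move=> s; rewrite Wl oppr0 sub0r oppr_le0.
  + by move=> s; rewrite Wr subr_le0; apply: le_trans (ler_norm _) _; rewrite normrN.
  + by move=> s x xn; rewrite Wh// bh// /heat; lra.
Qed.

End Hitting.

Section SmallTime.
Context (R : realType) (H : nat) (w : nat -> R).
Hypothesis H_odd : odd H.
Hypothesis H_ge5 : (5 <= H)%N.
Hypothesis w_ge0 : forall z, 0 <= w z.
Hypothesis w_supp : forall z, 0 < w z -> [&& ~~ odd z, (4 <= z)%N & (z + 4 <= H.*2)%N].
Hypothesis w_sum : \sum_(z < H.*2) w z = 1.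
Local Notation mean := (mean H w).

Lemma w_nonempty : exists z, 0 < w z.
Proof.
case: (pselect (exists z, 0 < w z)) => // N; exfalso.
have := w_sum; rewrite big1 => [/eqP|z _]; first by rewrite eq_sym oner_eq0.
by apply/eqP; rewrite eq_le w_ge0 andbT leNgt; apply/negP => wz; apply: N; exists z.
Qed.

(** Only the positive part of f - m, or of m - f, can help, and for f with values in [0, 1] and mean
    m its mean is at most m (1 - m) <= 1/4. *)
Lemma covariance_le (p f : nat -> R) P : (forall z, 0 < w z -> 0 <= p z <= P) ->
  (forall z, 0 < w z -> 0 <= f z <= 1) -> `|\sum_(z < H.*2) w z * (p z * (f z - mean f))| <= P / 4.
Proof.
move=> pP f01; pose m := mean f.
have P0 : 0 <= P.
  have [z wz] := w_nonempty; have /andP[] := pP _ wz; exact: le_trans.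
have m01 : 0 <= m <= 1.
  apply/andP; split; first by apply: sumr_ge0 => z _; have := w_ge0 z; rewrite le_eqVlt =>
    /orP[/eqP <-|wz]; rewrite ?mul0r// mulr_ge0//; case/andP: (f01 _ wz).
  rewrite -w_sum; apply: ler_sum => z _; have := w_ge0 z; rewrite le_eqVlt.
  by move=> /orP[/eqP <-|wz]; rewrite ?mul0r// ler_piMr//; case/andP: (f01 _ wz).
(* [f z + m - 2 m f z] dominates [|f z - m|] and has mean [2 m (1 - m)]. *)
have key z (e : R) : (e = 1) \/ (e = -1) -> w z * (p z * (e * (f z - m))) <=
    P * (w z * ((e * (f z - m) + (f z + m - 2 * m * f z)) / 2)).
  move=> e1; have := w_ge0 z; rewrite le_eqVlt => /orP[/eqP <-|wz]; first by rewrite !mul0r mulr0.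
  rewrite [leRHS]mulrCA ler_pM2l//; have /andP[p0 pP'] := pP _ wz; have /andP[f0 f1] := f01 _ wz.
  case/andP: m01 => m0 m1; have [u u0 [eu ue]] : exists2 u, 0 <= u &
      e * (f z - m) <= u /\ (e * (f z - m) + (f z + m - 2 * m * f z)) / 2 = u.
    by case: e1 => ->; [exists (f z * (1 - m))|exists (m * (1 - f z))]; nra.
  rewrite ue; apply: (@le_trans _ _ (p z * u)); first by rewrite ler_wpM2l.
  by rewrite ler_wpM2r.
have sumE (e : R) : \sum_(z < H.*2) P * (w z * ((e * (f z - m) + (f z + m - 2 * m * f z)) / 2)) =
    P * (m * (1 - m)).
  rewrite -mulr_sumr; congr (_ * _).
  transitivity (mean (fun z => (e + 1 - 2 * m) / 2 * f z + (1 - e) * m / 2)).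
    by apply: eq_bigr => z _; congr (_ * _); field.
  by rewrite meanD meanZ mean_cst// -/m; field.
have mm : P * (m * (1 - m)) <= P / 4.
  apply: ler_wpM2l => //; rewrite -subr_ge0 (_ : _ - _ = (m - 1 / 2) ^+ 2) ?sqr_ge0//.
  by field.
apply: norm_le_of.
  apply: (@le_trans _ _ (P * (m * (1 - m)))); last exact: mm.
  rewrite -(sumE 1); apply: ler_sum => z _.
  by have := key z 1 (or_introl erefl); rewrite !mul1r.
apply: (@le_trans _ _ (P * (m * (1 - m)))); last exact: mm.
rewrite -(sumE (-1)) -sumrN; apply: ler_sum => z _.
by have := key z (-1) (or_intror erefl); rewrite !mulN1r !mulrN.
Qed.

Variable h : nat.
Hypothesis h_gt0 : (0 < h)%N.
Hypothesis h_even : ~~ odd h.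
Hypothesis h_supp : forall z, 0 < w z -> (h < z)%N && (z + h < H.*2)%N.
Variable F : nat -> nat -> R.
Hypothesis F_heat : heat_on H F.
Hypothesis F_jump : forall t, F t 0%N = mean (F t).
Hypothesis F_end : forall t, F t H.*2 = F t 0%N.
Hypothesis F01 : forall x, (x <= H.*2)%N -> 0 <= F 0%N x <= 1.

Let K := dir H (fun=> 0 : R).
Let q := hconv H (fun=> 1 : R).
Let k := h./2.

Lemma evolution01 t x : (x <= H.*2)%N -> 0 <= F t x <= 1.
Proof.
elim: t x => [|t IHt] x xH; first exact: F01.
have Fin y : (0 < y < H.*2)%N -> 0 <= F t.+1 y <= 1.
  move=> yH; rewrite F_heat// /heat.
  have := IHt y ltac:(lia); have := IHt y.-1 ltac:(lia); have := IHt y.+1 ltac:(lia); lra.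
have F0 : 0 <= F t.+1 0%N <= 1.
  have Fs z : 0 < w z -> 0 <= F t.+1 z <= 1 by move=> /w_supp zH; apply: Fin; lia.
  have : `|F t.+1 0%N| <= 1.
    rewrite F_jump; apply: mean_norm_le => // z /Fs; rewrite ler_norml; lra.
  rewrite ler_norml => /andP[_ ->]; rewrite andbT F_jump; apply: sumr_ge0 => z _.
  have := w_ge0 z; rewrite le_eqVlt => /orP[/eqP <-|wz]; first by rewrite mul0r.
  by rewrite mulr_ge0//; have /andP[] := Fs _ wz.
case: (posnP x) => [->//|x0]; case: (eqVneq x H.*2) => [->|xN]; first by rewrite F_end.
by apply: Fin; lia.
Qed.

Let F_diff t x y : (x <= H.*2)%N -> (y <= H.*2)%N -> `|F t x - F t y| <= 1.
Proof.
by move=> /(evolution01 t) ? /(evolution01 t) ?; rewrite ler_norml; lra.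
Qed.

Let qK t y : (y <= H)%N -> q t y + K t y <= 1.
Proof. by move=> yH; apply: hconv1_add_dir => //; lia. Qed.

Let K_ge0 t y : 0 <= K t y.
Proof. by apply: dir_ge0; split=> s //; rewrite lexx ler01. Qed.

(** This is K + (1 - K - q) / 4: cost 1 if the walk is still in (0, H), 1/4 if it has left through
    H, and 0 if it has left through 0, a case paid for by the covariance bound. *)
Let sync_bound t y := 1 / 4 + 3 / 4 * K t y - 1 / 4 * q t y.
(** The same cost for two successive exits, the second from a walk restarted at k; at y = 0 it
    equals [sync_bound] at k. *)
Let mirror_bound t y :=
  1 / 4 + 3 / 4 * dir H (K ^~ k) t y - 1 / 4 * hconv H (q ^~ k) t y.

Let Z z t y := F t (z + y)%N - F t y.
Let M z t y := F t (z + k - y)%N - F t (k + y)%N.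

(** At the far end y = H - z/2 the parallel pair consists of mirror images about H, whose difference
    is at most K; and K <= [sync_bound] because q + K <= 1. *)
Let sync z t y : 0 < w z -> (y <= H - z./2)%N ->
  `|Z z t y - hconv (H - z./2) (Z z ^~ 0%N) t y| <= sync_bound t y.
Proof.
move=> wz; have zH := w_supp wz; have H0 : (0 < H)%N by lia.
apply: hconv_rest; first by lia.
- by move=> s x xn; rewrite /Z !F_heat; try lia; rewrite /heat addnS -!subn1 addnBA; [lra|lia].
- move=> s x xn; rewrite /sync_bound /K /q dirS ?hconvS; try lia.
  by rewrite /heat; field.
- move=> x xn; apply: le_trans (F_diff _ _ _) _; try lia.
  by rewrite /sync_bound /K /q dir0E ?hconv0; try lia; lra.
- by move=> s; rewrite /sync_bound /K /q dir_left hconv_left; lra.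
- move=> s; rewrite /Z distrC.
  have := antisym_le_dir F_heat F_end F01 s (x := (H - z./2)%N) ltac:(lia).
  rewrite (_ : (H.*2 - (H - z./2))%N = (z + (H - z./2))%N); last lia.
  move=> /le_trans; apply; have := qK s (y := (H - z./2)%N) ltac:(lia).
  by rewrite /sync_bound /K; lra.
Qed.

Let mirror_bound_ge0 t y : (y <= H)%N -> 0 <= mirror_bound t y.
Proof.
move=> yH; have : hconv H (q ^~ k) t y <= q t y.
  apply: hconv_le => s; have := qK s (y := k) ltac:(have [z wz] := @w_nonempty; have := h_supp wz; lia).
  by have := K_ge0 s k; lra.
have := qK t yH; have := K_ge0 t y; rewrite /mirror_bound.
have : 0 <= dir H (K ^~ k) t y by apply/dir_ge0/dir_survival; split=> s //; rewrite lexx ler01.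
by lra.
Qed.

(** The mirror pair meets at y = z/2. At y = 0 it becomes the parallel pair at distance z started at
    k, whose cost is subtracted here and added back in the final estimate. *)
Let mirror z t y : 0 < w z -> (y <= z./2)%N ->
  `|M z t y - hconv z./2 (M z ^~ 0%N) t y| <= mirror_bound t y - hconv z./2 (sync_bound ^~ k) t y.
Proof.
move=> wz; have zH := w_supp wz; have hz := h_supp wz; have H0 : (0 < H)%N by lia.
apply: (@hconv_rest _ _ _ (fun t y => mirror_bound t y - hconv z./2 (sync_bound ^~ k) t y)).
- by lia.
- move=> s x xn; rewrite /M !F_heat; try lia.
  rewrite /heat (_ : (z + k - x).-1 = (z + k - x.+1)%N); last lia.
  rewrite (_ : (z + k - x).+1 = (z + k - x.-1)%N); last lia.
  rewrite (_ : (k + x).-1 = (k + x.-1)%N); last lia.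
  by rewrite (_ : (k + x).+1 = (k + x.+1)%N); [lra|lia].
- move=> s x xn; rewrite /mirror_bound dirS ?hconvS; try lia.
  by rewrite /heat; field.
- move=> x xn; apply: le_trans (F_diff _ _ _) _; try lia.
  by rewrite /mirror_bound dir0E ?hconv0; try lia; lra.
- by move=> s; rewrite /mirror_bound dir_left !hconv_left /sync_bound; lra.
- move=> s; rewrite /M (_ : (z + k - z./2)%N = (k + z./2)%N); last lia.
  rewrite subrr normr0 hconv_right ?subr0; last lia.
  by apply: mirror_bound_ge0; lia.
Qed.

Let jumps t := \sum_(z < H.*2)
  w z * hconv z./2 (fun s => hconv (H - z./2) (Z z ^~ 0%N) s k) t k.

(** Both phases end at 0, which leaves F z - F 0, and F 0 is the mean of F z. The coefficient
    depends on z only through the strip widths and is at most the hitting weight of the full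
    interval (0, H). *)
Let jumps_le t : `|jumps t| <= 1 / 4 * hconv H (q ^~ k) t k.
Proof.
have -> : jumps t = \sum_(s < t.+1) \sum_(s' < (t - s).+1) \sum_(z < H.*2)
    w z * (hit R z./2 s k * hit R (H - z./2) s' k * (F (t - s - s')%N z - mean (F (t - s - s')%N))).
  rewrite /jumps; under eq_bigr do rewrite mulr_sumr.
  rewrite exchange_big; apply: eq_bigr => s _ /=.
  under eq_bigr do rewrite /hconv mulr_sumr mulr_sumr.
  rewrite exchange_big; apply: eq_bigr => s' _ /=; apply: eq_bigr => z _.
  by rewrite /Z addn0 F_jump; ring.
apply: le_trans (ler_norm_sum _ _ _) _; rewrite [leRHS]mulr_sumr; apply: ler_sum => s _.
apply: le_trans (ler_norm_sum _ _ _) _; rewrite mulr_sumr mulr_sumr; apply: ler_sum => s' _.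
apply: (@le_trans _ _ (hit R H s k * hit R H s' k / 4)); last by lra.
apply: (@covariance_le (fun z => hit R z./2 s k * hit R (H - z./2) s' k) (F (t - s - s')%N)).
- move=> z wz; have zH := w_supp wz; rewrite mulr_ge0 ?hit_ge0//=.
  by rewrite ler_pM ?hit_ge0// hit_le//; lia.
- by move=> z wz; apply: evolution01; have := w_supp wz; lia.
Qed.

Lemma jump_small_time t : `|F t h - F t 0%N| <= 1 / 4 + 3 / 4 * tail R H 2 t.
Proof.
have tail2 : dir H (K ^~ k) t k <= tail R H 2 t.
  apply: le_trans (tailS_ge R H 1 t k); apply: dir_le => [s|].
    exact: (tailS_ge R H 0 s k).
  by have [z wz] := w_nonempty; have := h_supp wz; lia.
have E : F t 0%N - F t h = mean (fun z => F t z - F t h -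
    hconv z./2 (fun s => hconv (H - z./2) (Z z ^~ 0%N) s k) t k) + jumps t.
  rewrite /mean /jumps -big_split /= F_jump /mean.
  rewrite -[X in _ - X](mean_cst w_sum) /mean -sumrB; apply: eq_bigr => z _; ring.
rewrite distrC E; apply: le_trans (ler_normD _ _) _.
apply: (@le_trans _ _ (mirror_bound t k + 1 / 4 * hconv H (q ^~ k) t k)); last first.
  by rewrite /mirror_bound; lra.
apply: lerD; last exact: jumps_le.
apply: mean_norm_le => // z wz; have zH := w_supp wz; have hz := h_supp wz.
have m := mirror t (y := k) wz ltac:(lia).
have -> : F t z - F t h = M z t k.
  by rewrite /M addnK (_ : (k + k)%N = h)//; lia.
have MZ s : M z s 0%N = Z z s k by rewrite /M /Z subn0 addn0.
set X := hconv z./2 _ t k.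
have -> : M z t k - X = (M z t k - hconv z./2 (M z ^~ 0%N) t k) +
    hconv z./2 (fun s => Z z s k - hconv (H - z./2) (Z z ^~ 0%N) s k) t k.
  rewrite hconvD hconvN /X.
  rewrite (_ : hconv z./2 (M z ^~ 0%N) t k = hconv z./2 (Z z ^~ k) t k); first by ring.
  by apply: eq_bigr => s _; rewrite MZ.
apply: le_trans (ler_normD _ _) _.
rewrite -[leRHS](subrK (hconv z./2 (sync_bound ^~ k) t k)); apply: lerD => //.
apply: le_trans (ler_norm_sum _ _ _) _; apply: ler_sum => s _.
by rewrite normrM (ger0_norm (hit_ge0 _ _ _ _)) ler_wpM2l ?hit_ge0// sync//; lia.
Qed.

Lemma jump_bound t : `|F t h - F t 0%N| <= tail R H 4 t.
Proof.
case: (leP (1 / 4) (tail R H 2 t)) => b2.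
  apply: le_trans (jump_small_time t) _; apply: le_trans (tail_mul R H t).
  have /andP[_ b1] := (tail_survival R H 2).2 t.
  (* The difference of the two sides is (1 - b)(b - 1/4), which explains the threshold 1/4. *)
  by move: (tail R H 2 t) b1 b2 => b b1 b2; nra.
apply: le_trans (tail_spectral H_odd H_ge5 b2).
exact: (@jump_large_time _ _ w).
Qed.

End SmallTime.

(** * Vanishing of the tails at infinity *)

Section Vanishing.
Context (R : realType) (H : nat).
Hypothesis H_odd : odd H.
Hypothesis H_ge5 : (5 <= H)%N.

Lemma lam_lt1 : lam R H < 1.
Proof.
have p0 := pi_gt0 R; have th0 : 0 < pi / H%:R :> R by rewrite divr_gt0// ltr0n; lia.
have th1 : pi / H%:R <= pi :> R by rewrite ler_piMr ?(ltW p0)// invf_le1 ?ler1n ?ltr0n; lia.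
have : cos (pi / H%:R) < cos (0 : R) by rewrite ltr_cos ?in_itv//=; lra.
by rewrite cos0 /lam; lra.
Qed.

(** If tau + B > t + s, then tau > t or B > s. *)
Lemma dir_restart (b : nat -> R) s t x : survival b -> (x <= H)%N ->
  dir H b (t + s) x <= dir H (fun=> 0) t x + b s.
Proof.
move=> bS xH; rewrite -subr_le0.
apply: (@max_principle R H (fun t x => dir H b (t + s) x - (dir H (fun=> 0) t x + b s))) => //.
- move=> y yH; rewrite add0n dir0E//.
  by have := dir_le1 H bS s y; have /andP[] := bS.2 s; lra.
- by move=> u; rewrite !dir_left; have := survival_le bS (leq_addl u s); lra.
- by move=> u; rewrite !dir_right; have := survival_le bS (leq_addl u s); lra.
- by move=> u y yH; rewrite addSn !dirS// /heat; lra.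
Qed.

(** This makes the total variation distance tend to 0, so that the possible coupling times carry
    total mass 1. *)
Lemma tail_vanishes m (e : R) : 0 < e -> exists t, tail R H m t < e.
Proof.
elim: m e => [|m IHm] e e0; first by exists 0%N.
have [s bs] : exists s, tail R H m s < e / 2 by apply: IHm; rewrite divr_gt0.
have [t lt] : exists t, lam R H ^+ t < e / 4.
  have lc : (fun n => lam R H ^+ n) @ \oo --> (0 : R).
    by apply: cvg_expr; rewrite ger0_norm ?lam_lt1// ltW// lam_gt0.
  have e4 : 0 < e / 4 by rewrite divr_gt0.
  have [n _ hn] := cvgr_lt _ lc _ e4.
  by exists n; exact: (hn n (leqnn n)).
exists (t + s)%N; have := dir_restart s t (x := H./2) (tail_survival R H m) ltac:(lia).
by have := dir_decay R H_odd H_ge5 t H./2; rewrite /=; lra.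
Qed.

End Vanishing.

(** * Parallel pairs and the fifth exit time *)

Section Sync.
Context (R : realType) (H h : nat).
Hypothesis H_odd : odd H.
Hypothesis H_ge5 : (5 <= H)%N.
Hypothesis h_gt0 : (0 < h)%N.
Hypothesis h_even : ~~ odd h.

Definition jump_evolution (w : nat -> R) (F : nat -> nat -> R) := [/\
  [/\ forall z, 0 <= w z,
      forall z, 0 < w z -> [&& ~~ odd z, (4 <= z)%N & (z + 4 <= H.*2)%N],
      \sum_(z < H.*2) w z = 1 &
      forall z, 0 < w z -> (h < z)%N && (z + h < H.*2)%N],
  heat_on H F, forall t, F t 0%N = mean H w (F t), forall t, F t H.*2 = F t 0%N &
  forall x, (x <= H.*2)%N -> 0 <= F 0%N x <= 1].

Let hH w F : jump_evolution w F -> (h < H)%N.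
Proof. by case=> [[w0 _ ws hs] _ _ _ _]; have [z /hs] := w_nonempty w0 ws; lia. Qed.

Lemma sync_left w F t x : jump_evolution w F -> (x <= H - h./2)%N ->
  `|F t x - F t (x + h)%N| <= tail R H 5 t.
Proof.
move=> JE xH; have hH' := hH JE; case: JE => [[w0 wsup ws hs] Fh Fj Fe F01].
apply: le_trans (tailS_ge R H 4 t x).
have jb s : `|F s 0%N - F s h| <= tail R H 4 s by rewrite distrC; exact: (@jump_bound _ _ w).
have right s : `|F s (H - h./2)%N - F s (H - h./2 + h)%N| <= dir H (tail R H 4) s (H - h./2).
  rewrite (_ : (H - h./2 + h)%N = (H.*2 - (H - h./2))%N); last lia.
  apply: le_trans (antisym_le_dir Fh Fe F01 s _) _; first by lia.
  by apply: dir_le => [u|]; [case/andP: ((tail_survival R H 4).2 u)|lia].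
have init y : (0 < y < H - h./2)%N -> `|F 0%N y - F 0%N (y + h)%N| <= 1.
  move=> yH; have := F01 y ltac:(lia); have := F01 (y + h)%N ltac:(lia).
  by rewrite ler_norml; lra.
have step s y : (0 < y < H - h./2)%N ->
    F s.+1 y - F s.+1 (y + h)%N = heat (fun y => F s y - F s (y + h)%N) y.
  move=> yH; rewrite !Fh; try lia.
  by rewrite /heat (_ : (y + h).-1 = (y.-1 + h)%N) ?addSn; [lra|lia].
have nH : (H - h./2 <= H)%N by lia.
apply: norm_le_of.
  apply: (dir_super (W := fun t x => F t x - F t (x + h)%N) nH) => //.
  - by move=> y /init; apply: le_trans; exact: ler_norm.
  - by move=> s; apply: le_trans (jb s); exact: ler_norm.
  - by move=> s; apply: le_trans (right s); exact: ler_norm.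
  - by move=> s y yH; rewrite step.
apply: (dir_super (W := fun t x => - (F t x - F t (x + h)%N)) nH) => //.
- by move=> y /init; apply: le_trans; rewrite -normrN; exact: ler_norm.
- by move=> s; apply: le_trans (jb s); rewrite -normrN; exact: ler_norm.
- by move=> s; apply: le_trans (right s); rewrite -normrN; exact: ler_norm.
- by move=> s y yH; rewrite step// /heat; lra.
Qed.

Let sum_reflect (g : nat -> R) : g H.*2 = g 0%N ->
  \sum_(z < H.*2) g (H.*2 - z)%N = \sum_(z < H.*2) g z.
Proof.
move=> ge; have H0 : (0 < H.*2)%N by lia.
rewrite -(big_mkord xpredT (fun z => g (H.*2 - z)%N)) -(big_mkord xpredT g).
rewrite (big_ltn H0) [RHS](big_ltn H0) subn0 ge; congr (_ + _).
rewrite big_nat_rev /= big_nat_cond [RHS]big_nat_cond; apply: eq_bigr => z zH.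
by congr g; lia.
Qed.

(** Reflecting the circle sends the pair (x, x + h) to a pair at the same distance on the other
    side, which covers x > H - h/2. *)
Lemma jump_evolution_reflect w F : jump_evolution w F ->
  jump_evolution (fun z => w (H.*2 - z)%N) (fun t x => F t (H.*2 - x)%N).
Proof.
case=> [[w0 wsup ws hs] Fh Fj Fe F01].
have wz z : ~~ (4 <= z <= H.*2 - 4)%N -> w z = 0.
  move=> zN; apply/eqP; move: zN; apply: contraNT => wz.
  by have := wsup z; rewrite lt0r wz w0 => /(_ isT); lia.
split.
- split=> [z|z| |z].
  + exact: w0.
  + by move=> /wsup; lia.
  + by rewrite (@sum_reflect w) ?ws// !wz//; lia.
  + by move=> wp; have := wsup _ wp; have := hs _ wp; lia.
- exact: reflect_heat.
- move=> t; rewrite subn0 Fe Fj /mean.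
  rewrite (@sum_reflect (fun z => w z * F t z))// !wz ?mul0r//; lia.
- by move=> t; rewrite subnn subn0 Fe.
- by move=> x xH; apply: F01; lia.
Qed.

Theorem sync_bound w F t x : jump_evolution w F -> (x + h <= H.*2)%N ->
  `|F t x - F t (x + h)%N| <= tail R H 5 t.
Proof.
move=> JE xH; case: (leqP x (H - h./2)) => xs; first exact: (sync_left _ JE).
have := @sync_left _ _ t (H.*2 - (x + h))%N (jump_evolution_reflect JE) ltac:(lia).
rewrite distrC (_ : (H.*2 - (H.*2 - (x + h)))%N = (x + h)%N); last lia.
by rewrite (_ : (H.*2 - (H.*2 - (x + h) + h))%N = x); last lia.
Qed.

End Sync.

(** * Sums of exit times *)

Section FirstTime.
Context (R : realType).
Implicit Type A : set nat.

Lemma first_time_gt A k : (k%:R%:E < first_time R A)%E <-> forall n, (n <= k)%N -> ~ A n.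
Proof.
split=> [kA n nk An|h].
  move: kA; apply/negP; rewrite -leNgt.
  apply: (@le_trans _ _ (n%:R%:E)); last by rewrite lee_fin ler_nat.
  by apply: ereal_inf_lbound; exists n.
apply: (@lt_le_trans _ _ (k.+1%:R%:E)); first by rewrite lte_fin ltr_nat.
apply: le_ereal_inf_tmp => _ [n An <-]; rewrite lee_fin ler_nat ltnNge.
by apply/negP => nk; exact: h An.
Qed.

Lemma first_time_val A : first_time R A = +oo%E \/ exists n : nat, first_time R A = n%:R%:E.
Proof.
case: (pselect (exists n, A n)) => [[n An]|N].
  have [m Am mmin] : exists2 m, A m & forall k, A k -> (m <= k)%N.
    have exA : exists n, `[< A n >] by exists n; apply/asboolP.
    case: (ex_minnP exA) => m Am min; exists m; first exact/asboolP.
    by move=> k Ak; apply: min; apply/asboolP.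
  right; exists m; apply/eqP; rewrite eq_le; apply/andP; split.
    by apply: ereal_inf_lbound; exists m.
  by apply: le_ereal_inf_tmp => _ [k Ak <-]; rewrite lee_fin ler_nat mmin.
left; apply/eqP; rewrite eq_le leey /=; apply: le_ereal_inf_tmp => ? [k Ak ?].
by case: N; exists k.
Qed.

End FirstTime.

Section Stay.
Context (R : realType) (S : countType) (q : S -> S -> R).
Context (d : measure_display) (Om : measurableType d) (P : probability Om R).
Variable X : nat -> Om -> S.
Hypothesis mcX : markov_chain q P X.

Definition path_event m (C : nat -> set S) := [set w | forall j, (j <= m)%N -> C j (X j w)].

Lemma measurable_path_event m C : measurable (path_event m C).
Proof.
have -> : path_event m C = \bigcap_(j in `I_m.+1) \bigcup_(a in C j) [set w | X j w = a].
  by apply/seteqP; split=> w /= h j jm; [exists (X j w) => //; apply: h|have [a ? ->] := h j jm].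
apply: fin_bigcap_measurable => // j _.
rewrite bigcup_mkcond; apply: countable_bigcupT_measurable => // a.
by case: ifP => _ //; exact: mcX.1.
Qed.

Fixpoint stay L (e : 'I_L -> S) k (a : S) : R :=
  if k is k'.+1 then \sum_i q a (e i) * stay e k' (e i) else 1.

(** Splitting on the position at time n + 1 turns one free step into a prescribed one, so the rule
    for exact prefixes applies again. *)
Lemma prob_stay L (e : 'I_L -> S) n k (s : nat -> S) : injective e ->
  P (path_event (n + k) (fun j => if (j <= n)%N then [set s j] else range e)) =
  (P (path_event n (fun j => [set s j])) * (stay e k (s n))%:E)%E.
Proof.
move=> einj; elim: k n s => [|k IHk] n s.
  rewrite addn0 mule1; congr (P _); apply/seteqP.
  by split=> w /= h j jn; have := h j jn; rewrite jn.
pose s' (i : 'I_L) j := if j == n.+1 then e i else s j.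
pose F i := path_event (n.+1 + k) (fun j => if (j <= n.+1)%N then [set s' i j] else range e).
have -> : path_event (n + k.+1) (fun j => if (j <= n)%N then [set s j] else range e) =
    \big[setU/set0]_(i < L) F i.
  rewrite -bigcup_seq; apply/seteqP; split=> [w h|w [i _ h] j jn].
    have := h n.+1 ltac:(lia); rewrite ltnn => -[i _ Xi]; exists i => [|j jn]; first by rewrite /= mem_index_enum.
    have := h j ltac:(lia); rewrite /s'.
    case: (ltngtP j n.+1) => jn1; first by rewrite ltnS in jn1; rewrite jn1.
      by rewrite leqNgt (ltnW jn1).
    by rewrite jn1 Xi.
  have := h j ltac:(lia); rewrite /s'.
  case: (ltngtP j n.+1) => jn1; first by rewrite ltnS in jn1; rewrite jn1.
    by rewrite leqNgt (ltnW jn1).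
  by rewrite jn1 ltnn /= => ->; exists i.
rewrite measure_bigsetU_ord; first last.
- move=> i j _ _ [w [hi hj]]; apply: einj.
  have := hi n.+1 ltac:(lia); have := hj n.+1 ltac:(lia).
  by rewrite /s' leqnn eqxx /= => -> ->.
- by move=> i; exact: measurable_path_event.
have pE m C : P (path_event m C) = (fine (P (path_event m C)))%:E.
  by rewrite fineK// fin_num_measure//; exact: measurable_path_event.
rewrite /= pE -EFinM mulr_sumr -sumEFin; apply: eq_bigr => i _.
rewrite /F IHk {2}/s' eqxx mulrA 2!EFinM -pE; congr (_ * _)%E.
have := mcX.2 n (s' i); rewrite /s' eqxx (ltn_eqF (ltnSn n)) => eqP'.
transitivity (P [set w | forall i0, (i0 <= n.+1)%N -> X i0 w = (if i0 == n.+1 then e i else s i0)]) => //.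
rewrite eqP'; congr (P _ * _)%E; apply/seteqP; split=> w /= h j jn; have := h j jn.
  by rewrite ltn_eqF.
by rewrite (ltn_eqF (_ : (j < n.+1)%N)).
Qed.

End Stay.
(** The probability that the exit time from (0, H) started at x equals s, as a drop of its survival
    function. *)
Definition exit_mass (R : realType) H s x : R :=
  (if s is s'.+1 then dir H (fun=> 0) s' x else 1) - dir H (fun=> 0) s x.

(** Conditioning on the exit time: tau + B <= t means tau = s and B <= t - s for some s <= t. *)
Lemma exit_mass_conv (R : realType) H (b : nat -> R) t x : (x <= H)%N ->
  \sum_(s < t.+1) exit_mass R H s x * (1 - b (t - s)%N) = 1 - dir H b t x.
Proof.
elim: t x => [|t IHt] x xH.
  rewrite big_ord1 subn0 /exit_mass /=.
  by case: ifP => _; rewrite ?subrr ?mul0r// subr0 mul1r.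
case: (boolP (0 < x < H)%N) => xi; last first.
  rewrite [dir H b _ _]dir_out// big_ord_recl subn0 big1 ?addr0 => [|s _].
    by rewrite /exit_mass dir_out// subr0 mul1r.
  by rewrite /exit_mass /bump /= !dir_out// ?subrr ?mul0r//= (negbTE xi) subrr mul0r.
rewrite big_ord_recl {1}/exit_mass dir0E// subrr mul0r add0r dirS//.
have -> : 1 - heat (dir H b t) x = heat (fun x => 1 - dir H b t x) x by rewrite /heat; field.
rewrite /heat -!IHt; try lia.
rewrite !mulr_suml -!big_split /=; apply: eq_bigr => s _.
rewrite /bump /= subSS.
suff -> : exit_mass R H s.+1 x = heat (exit_mass R H s) x by rewrite /heat; field.
rewrite /exit_mass dirS//; case: (nat_of_ord s) => [|s'].
  by rewrite dir0E// /heat; field.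
by rewrite dirS// /heat; field.
Qed.

Section ExitLaw.
Context (R : realType) (L : nat).
Context (d : measure_display) (Om : measurableType d) (P : probability Om R).
Variable Z : nat -> Om -> int.
Hypothesis mcZ : markov_chain (lazy_step R) P Z.
Hypothesis L_gt0 : (0 < L)%N.
Hypothesis Z0 : forall w, Z 0%N w = ((L.+1)./2)%:Z.
Let H := L.+1.
Let K := dir H (fun=> 0 : R).

Let sum_lazy (g : nat -> R) x : (0 < x < H)%N ->
  \sum_(y < H.+1) lazy_step R x%:Z (nat_of_ord y)%:Z * g y = heat g x.
Proof.
move=> xH.
have pick (a : nat) (k : R) : (a < H.+1)%N -> \sum_(y < H.+1) (if nat_of_ord y == a then k * g y else 0) = k * g a.
  move=> aH; by rewrite -big_mkcond (big_pred1 (Ordinal aH)).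
transitivity (\sum_(y < H.+1) ((if nat_of_ord y == x then 1 / 2 * g y else 0) +
    (if nat_of_ord y == x.-1 then 1 / 4 * g y else 0) + (if nat_of_ord y == x.+1 then 1 / 4 * g y else 0))).
  apply: eq_bigr => y _; rewrite /lazy_step.
  have -> : (x%:Z == (nat_of_ord y)%:Z) = (nat_of_ord y == x) by lia.
  have -> : ((nat_of_ord y)%:Z == x%:Z + 1) = (nat_of_ord y == x.+1) by lia.
  have -> : ((nat_of_ord y)%:Z == x%:Z - 1) = (nat_of_ord y == x.-1) by lia.
  case: eqP => [->|_].
    have -> : (x == x.-1) = false by lia.
    have -> : (x == x.+1) = false by lia.
    by rewrite !addr0.
  case: eqP => [->|_] /=; last by case: eqP => _; rewrite ?mul0r ?add0r ?addr0.
  have -> : (x.+1 == x.-1) = false by lia.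
  by rewrite !add0r.
by rewrite !big_split /= !pick /heat; [field|lia..].
Qed.

Let stay_dir k x : (0 < x < H)%N ->
  stay (lazy_step R) (fun i : 'I_L => (i.+1)%:Z) k x%:Z = K k x.
Proof.
elim: k x => [|k IHk] x xH; first by rewrite /K dir0E.
rewrite /K dirS// -sum_lazy// big_ord_recl big_ord_recr /= dir_right dir_left !mulr0 add0r addr0.
apply: eq_bigr => i _; rewrite IHk//; last by have := ltn_ord i; rewrite /H; lia.
Qed.

Let inside k := [set w | (k%:R%:E < exit_time R L Z w)%E].

Let insideE k : inside k =
  path_event Z k (fun j => if (j <= 0)%N then [set ((L.+1)./2)%:Z] else range (fun i : 'I_L => (i.+1)%:Z)).
Proof.
apply/seteqP; split=> w /=; rewrite /inside /= first_time_gt => h j jk.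
  case: j jk => [|j] jk /=; first by rewrite Z0.
  have /contrapT := h _ jk.
  case: (Z j.+1 w) => // z zL.
  have zL' : (z.-1 < L)%N by lia.
  by exists (Ordinal zL') => //=; congr Posz; lia.
apply; case: j jk => [|j] jk; first by rewrite Z0; lia.
by have := h _ jk; rewrite /= => -[i _ <-]; have := ltn_ord i; lia.
Qed.

Let measurable_inside k : measurable (inside k).
Proof. by rewrite insideE; exact: (measurable_path_event mcZ). Qed.

Lemma prob_exit_gt k : P (inside k) = (K k H./2)%:E.
Proof.
rewrite insideE -[k in path_event _ k _]add0n.
rewrite (prob_stay mcZ 0 k (fun=> ((L.+1)./2)%:Z)); last by move=> i j [] /val_inj.
rewrite stay_dir; last by rewrite /H; lia.
rewrite (_ : path_event _ _ _ = setT) ?probability_setT ?mul1e//.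
by apply/seteqP; split=> w // _ [|j] // _; rewrite /= Z0.
Qed.

Lemma prob_exit_eq s : P (exit_time R L Z @^-1` [set s%:R%:E]) = (exit_mass R H s H./2)%:E.
Proof.
have val w : exit_time R L Z w = +oo%E \/ exists n : nat, exit_time R L Z w = n%:R%:E.
  exact: first_time_val.
case: s => [|s].
  rewrite (_ : _ @^-1` _ = ~` inside 0).
    by rewrite probability_setC// prob_exit_gt.
  apply/seteqP; split=> w; rewrite /inside /= => e.
    by rewrite e ltxx.
  case: (val w) => [e'|[n e']]; first by case: e; rewrite e' ltry.
  by move: e; rewrite e' lte_fin ltr_nat; case: n {e'} => // n [].
rewrite (_ : _ @^-1` _ = inside s `\` inside s.+1); last first.
  apply/seteqP; split=> w; rewrite /inside /= => e.
    by rewrite e !lte_fin !ltr_nat ltnSn ltnn.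
  case: (val w) => [e'|[n e']].
    by case: e => _ []; rewrite e' ltry.
  by move: e; rewrite e' !lte_fin !ltr_nat => -[] sn /negP ns; congr (_%:R%:E); lia.
rewrite measureD//; last by rewrite -ge0_fin_numE// fin_num_measure.
have sub : inside s.+1 `<=` inside s.
  by move=> w; rewrite /inside /=; apply: le_lt_trans; rewrite lee_fin ler_nat.
by rewrite (setIidr sub) [X in (X - _)%E]prob_exit_gt [X in (_ - X)%E]prob_exit_gt.
Qed.

End ExitLaw.

(** The times T_i are given only through their laws, so they take values in this set only almost
    surely. *)
Definition exit_values (R : realType) : set (\bar R) := [set e | e = +oo%E \/ exists n : nat, e = n%:R%:E].
Arguments exit_values R : clear implicits.

Lemma measurable_exit_values (R : realType) : measurable (exit_values R).
Proof.
have -> : exit_values R = [set +oo%E] `|` \bigcup_(n : nat) [set n%:R%:E].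
  by apply/seteqP; split=> e /= [->|[n]]; [left|move=> ->; right; exists n|left|move=> _ ->; right; exists n].
by apply: measurableU => //; apply: bigcupT_measurable.
Qed.

Section SumOfExits.
Context (R : realType) (L m : nat).
Context (d : measure_display) (Om : measurableType d) (P : probability Om R).
Variable T : 'I_m.+1 -> {RV P >-> \bar R}.
Hypothesis T_ind : mutually_independent P (fun i => T i : Om -> \bar R).
Hypothesis T_dist : forall i, distributed_as_T L P (T i).
Hypothesis L_gt0 : (0 < L)%N.
Let H := L.+1.

Let T_eq i s : P (T i @^-1` [set s%:R%:E]) = (exit_mass R H s H./2)%:E.
Proof.
have [d' [Om' [P' [Z [mcZ Z0 TZ]]]]] := T_dist i.
by rewrite TZ ?(prob_exit_eq mcZ)//; exact: emeasurable_set1.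
Qed.

Let T_val i : P (T i @^-1` exit_values R) = 1%E.
Proof.
have [d' [Om' [P' [Z [mcZ Z0 TZ]]]]] := T_dist i.
rewrite TZ; last exact: measurable_exit_values.
rewrite (_ : _ @^-1` _ = setT) ?probability_setT//.
by apply/seteqP; split=> w //= _; exact: first_time_val.
Qed.

(* The event that the first j times are natural numbers with sum at most t. *)
Fixpoint sum_le j t : set Om :=
  if j is j'.+1 then \big[setU/set0]_(s < t.+1) (T (inord j') @^-1` [set (nat_of_ord s)%:R%:E] `&` sum_le j' (t - s)%N)
  else setT.

Let measurable_T i B : measurable B -> measurable (T i @^-1` B).
Proof. by move=> mB; exact: measurable_funPTI. Qed.

Lemma measurable_sum_le j t : measurable (sum_le j t).
Proof.
elim: j t => [|j IHj] t //=; apply: bigsetU_measurable => s _.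
apply: measurableI => //; apply: measurable_T; exact: emeasurable_set1.
Qed.

Let measurable_all (B : 'I_m.+1 -> set (\bar R)) : (forall i, measurable (B i)) ->
  measurable [set w | forall i, B i (T i w)].
Proof.
move=> mB; rewrite (_ : mkset _ = \bigcap_(i in setT) (T i @^-1` B i)).
  by apply: fin_bigcap_measurable => // i _; exact: measurable_T.
by apply/seteqP; split=> w /= h i; [move=> _|]; apply: h.
Qed.

(** The sets B i with i >= j record the values already fixed. Independence is then used only at j =
    0, with all of them in place; an upper bound is enough, so Boole's inequality replaces
    disjointness. *)
Lemma prob_sum_le j t (B : 'I_m.+1 -> set (\bar R)) : (j <= m.+1)%N ->
  (forall i, measurable (B i)) -> (forall i : 'I_m.+1, (i < j)%N -> B i = setT) ->
  (P (sum_le j t `&` [set w | forall i, B i (T i w)]) <=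
    (1 - tail R H j t)%:E * \prod_i P (T i @^-1` B i))%E.
Proof.
elim: j t B => [|j IHj] t B jm mB Bj.
  by rewrite /= setTI T_ind// subr0 mul1e.
pose B' s (i : 'I_m.+1) := if nat_of_ord i == j then [set (s%:R%:E : \bar R)] else B i.
rewrite /= big_distrl /=.
have prodE s : (\prod_i P (T i @^-1` B' s i) =
    (exit_mass R H s H./2)%:E * \prod_i P (T i @^-1` B i))%E.
  rewrite (bigD1 (inord j))//= [in RHS](bigD1 (inord j))//= /B' inordK// eqxx T_eq.
  rewrite Bj ?inordK// preimage_setT probability_setT mul1e; congr (_ * _)%E.
  apply: eq_bigr => i ij; rewrite ifF//; apply/negP => /eqP e.
  by move: ij; rewrite -e inord_val eqxx.
have mB' s i : measurable (B' s i).
  by rewrite /B'; case: ifP => // _; exact: emeasurable_set1.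
have pB0 : (0 <= \prod_i P (T i @^-1` B i))%E by apply: prode_ge0.
apply: (@le_trans _ _ (\sum_(s < t.+1) P (sum_le j (t - s)%N `&` [set w | forall i, B' s i (T i w)]))%E).
  pose A s := T (inord j) @^-1` [set s%:R%:E] `&` sum_le j (t - s)%N `&`
    [set w | forall i, B i (T i w)].
  have mA s : measurable (A s).
    apply: measurableI; last exact: measurable_all.
    apply: measurableI; last exact: measurable_sum_le.
    by apply: measurable_T; exact: emeasurable_set1.
  apply: (le_trans (@Boole_inequality _ _ _ P A t.+1 (fun s _ => mA s))).
  apply: lee_sum => s _; apply: le_measure; rewrite ?inE.
  - exact: mA.
  - by apply: measurableI; [exact: measurable_sum_le|exact: measurable_all].
  - move=> w [[/= Tj wj] wB]; split=> // i; rewrite /B'; case: eqP => // e.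
    by rewrite -e inord_val in Tj; rewrite /= Tj.
apply: (@le_trans _ _ (\sum_(s < t.+1) ((1 - tail R H j (t - s)%N) * exit_mass R H s H./2)%:E * \prod_i P (T i @^-1` B i))%E).
  apply: lee_sum => s _; rewrite EFinM -muleA -prodE; apply: IHj; rewrite ?(ltnW jm)//.
  by move=> i ij; rewrite /B' ltn_eqF// Bj// ltnW.
have pE : (\prod_i P (T i @^-1` B i))%E = (fine (\prod_i P (T i @^-1` B i)))%:E.
  by rewrite -T_ind// fineK// fin_num_measure//; exact: measurable_all.
rewrite pE; under eq_bigr do rewrite -EFinM.
rewrite sumEFin -EFinM lee_fin -mulr_suml /= -exit_mass_conv; last by rewrite /H; lia.
by under eq_bigr do rewrite mulrC.
Qed.

Let sum_le_of w j t : (j <= m.+1)%N -> (forall i, exit_values R (T i w)) ->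
  (\sum_(i < j) T (inord i) w <= t%:R%:E)%E -> sum_le j t w.
Proof.
move=> jm Tv; have T0 i : (0 <= T i w)%E.
  by case: (Tv i) => [->|[n ->]]; rewrite ?leey// lee_fin ler0n.
elim: j t jm => [|j IHj] t jm //=; rewrite big_ord_recr /=.
have S0 : (0 <= \sum_(i < j) T (inord i) w)%E by apply: sume_ge0.
case: (Tv (inord j)) => [->|[n Tn]]; first by rewrite addey ?leye_eq// -ltNye (lt_le_trans _ S0)// ltNyr.
rewrite Tn -leeBrDr//.
rewrite -EFinB => h; have nt : (n <= t)%N.
  by have := le_trans S0 h; rewrite lee_fin subr_ge0 ler_nat.
rewrite -bigcup_seq; exists (Ordinal (nt : (n < t.+1)%N)); first by rewrite /= mem_index_enum.
split; first by rewrite /= Tn.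
by apply: IHj; rewrite ?(ltnW jm)//= natrB.
Qed.

Lemma tail_le_prob_sum t :
  ((tail R H m.+1 t)%:E <= P [set w | t%:R%:E < \sum_(i < m.+1) T i w])%E.
Proof.
have mS : measurable [set w | (t%:R%:E < \sum_(i < m.+1) T i w)%E].
  rewrite -[X in measurable X]setTI; apply: measurable_lte => //.
  by apply: emeasurable_sum => i.
set S := [set w | _] in mS *.
pose V := [set w | forall i, exit_values R (T i w)].
have mV : measurable V.
  by apply: (@measurable_all (fun=> exit_values R)) => i; exact: measurable_exit_values.
have PV : P V = 1%E.
  rewrite /V (T_ind (B := fun=> exit_values R)) ?big1// => i *; exact: measurable_exit_values.
have sub : V `\` S `<=` sum_le m.+1 t.
  move=> w [wV /negP]; rewrite -leNgt => wS; apply: sum_le_of => //.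
  by under eq_bigr do rewrite inord_val.
have PS : P S = (fine (P S))%:E by rewrite fineK// fin_num_measure.
have : (P V <= P (sum_le m.+1 t) + P S)%E.
  apply: le_trans (measureU2 _ _ _) => //; last exact: measurable_sum_le.
  apply: le_measure; rewrite ?inE//; first by apply: measurableU => //; exact: measurable_sum_le.
  by move=> w wV; case: (pselect (S w)) => wS; [right|left; apply: sub].
have := @prob_sum_le m.+1 t (fun=> setT) (leqnn _) ltac:(by []) ltac:(by []).
rewrite (_ : [set w | _] = setT); last by apply/seteqP; split.
rewrite setIT big1 ?mule1 => [h1|i _]; last by rewrite preimage_setT probability_setT.
rewrite PV PS => h2; have := le_trans h2 (leeD2r _ h1).
by rewrite -EFinD !lee_fin; lra.
Qed.

End SumOfExits.

(** * The maximal coupling *)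

Section Words.
Context (R : realType) (M : seq nat -> R).
(* Letters are drawn by nested intervals. Words are reversed: the head of the list is the last letter. *)
Hypothesis M_ge0 : forall v, 0 <= M v.
Hypothesis M_nil : M [::] = 1.
Hypothesis M_sum : forall v, (fun n => \sum_(e < n) M (nat_of_ord e :: v)) @ \oo --> M v.

Let partial v n := \sum_(e < n) M (nat_of_ord e :: v).

Let partialS v n : partial v n.+1 = partial v n + M (n :: v).
Proof. by rewrite /partial big_ord_recr. Qed.

Let partial_mono v n p : (n <= p)%N -> partial v n <= partial v p.
Proof.
elim: p => [|p IHp]; first by rewrite leqn0 => /eqP ->.
rewrite leq_eqVlt => /orP[/eqP ->//|/IHp]; rewrite partialS => /le_trans; apply.
by rewrite lerDl.
Qed.

Let partial_le v n : partial v n <= M v.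
Proof.
rewrite leNgt; apply/negP => h; have [N _ hN] := cvgr_lt _ (@M_sum v) _ h.
by have := hN (maxn n N) (leq_maxr _ _); rewrite /= ltNge partial_mono ?leq_maxl.
Qed.

Fixpoint word_left v : R := if v is e :: v' then word_left v' + partial v' e else 0.

Definition word_itv v : interval R := `[word_left v, word_left v + M v[.

Let word_itvP v u : u \in word_itv v <-> word_left v <= u < word_left v + M v.
Proof. by rewrite in_itv. Qed.

Let word_itv_behead e v u : u \in word_itv (e :: v) -> u \in word_itv v.
Proof.
rewrite !in_itv /= => /andP[h1 h2].
have := partial_le v e.+1; rewrite partialS => h3.
have : 0 <= partial v e by apply: sumr_ge0.
by lra.
Qed.

Let word_itv_head e e' v u : u \in word_itv (e :: v) -> u \in word_itv (e' :: v) -> e = e'.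
Proof.
wlog ee : e e' / (e <= e')%N => [hw h1 h2|].
  by case: (leqP e e') => ee; [exact: hw|symmetry; apply: hw => //; exact: ltnW].
rewrite !in_itv /= => h1 h2; apply/eqP; rewrite eqn_leq ee leqNgt; apply/negP => lt.
by have := partial_mono v lt; rewrite partialS; lra.
Qed.

(** The partial sums converge to M v and the interval is open on the right, so some partial sum
    passes u; the least such index gives the letter. *)
Let next_ex v u : u \in word_itv v -> exists e, u \in word_itv (e :: v).
Proof.
move=> /word_itvP/andP[ul ur].
have lt : u - word_left v < M v by lra.
have [N _ hN] := cvgr_gt _ (@M_sum v) _ lt.
have exn : exists n, u - word_left v < partial v n by exists N; exact: (hN N (leqnn N)).
case: (ex_minnP exn) => -[|n] hn nmin; first by move: hn; rewrite /partial big_ord0; lra.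
exists n; apply/word_itvP; rewrite /= -addrA -partialS; apply/andP; split; last by lra.
by rewrite -lerBrDl leNgt; apply/negP => /nmin; rewrite ltnn.
Qed.

Definition next v u : nat := xget 0%N [set e | u \in word_itv (e :: v)].

Fixpoint word k u : seq nat := if k is k'.+1 then next (word k' u) u :: word k' u else [::].

Lemma size_word k u : size (word k u) = k.
Proof. by elim: k => //= k ->. Qed.

Let in_word k u : 0 <= u < 1 -> u \in word_itv (word k u).
Proof.
move=> u01; elim: k => [|k IHk]; first by apply/word_itvP; rewrite /= M_nil; lra.
by have [e eu] := next_ex IHk; rewrite /= /next; case: xgetP => [e' _ //|/(_ e)].
Qed.

Let wordE k u v : 0 <= u < 1 -> size v = k -> (word k u = v) <-> (u \in word_itv v).
Proof.
move=> u01; elim: v k => [|e v IHv] [|k] //= => [_|[/IHv vk]].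
  by split=> // _; exact: (in_word 0).
split=> [|uv]; first by move=> <-; exact: (in_word k.+1).
have vE : word k u = v by apply/vk/word_itv_behead/uv.
have := in_word k.+1 u01; rewrite /= vE => un; congr (_ :: _); exact: word_itv_head un uv.
Qed.

(** The reals outside [0, 1) form a null set for [unif]; sending them to 0 makes the words defined
    everywhere. *)
Let clip (u : R) : R := if 0 <= u < 1 then u else 0.

Let clip01 u : 0 <= clip u < 1.
Proof. by rewrite /clip; case: ifP => // _; rewrite lexx ltr01. Qed.

Definition rword k u := word k (clip u).

Lemma size_rword k u : size (rword k u) = k.
Proof. exact: size_word. Qed.

Lemma rwordS k u : exists e, rword k.+1 u = e :: rword k u.
Proof. by exists (next (word k (clip u)) (clip u)). Qed.

(** It holds for every u, so properties of words of positive weight hold surely. Coalescence and the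
    starting points are required surely. *)
Lemma rword_gt0 k u : 0 < M (rword k u).
Proof. by have /word_itvP := in_word k (clip01 u); rewrite -/(rword k u); lra. Qed.

Let word_itv_sub v u : u \in word_itv v -> 0 <= u < 1.
Proof.
elim: v => [|e v IHv]; last by move/word_itv_behead.
by move/word_itvP; rewrite /= M_nil; lra.
Qed.

Definition unif : probability (measurableTypeR R) R := uniform_prob (@ltr01 R).

Let unif_itv a b : 0 <= a -> a <= b -> b <= 1 -> unif [set` `[a, b[] = (b - a)%:E.
Proof.
move=> a0 ab b1; rewrite /unif /= /uniform_prob integral_uniform_pdf.
have -> : [set` `[a, b[] `&` `[(0 : R), 1] = [set` `[a, b[].
  by apply: setIidl => u /=; rewrite !in_itv /=; lra.
under eq_integral => u.
  rewrite inE /= in_itv /= => uab; rewrite /uniform_pdf ifT; last lra.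
  rewrite subr0 invr1; over.
rewrite integral_cst//= mul1e lebesgue_measure_itv /= lte_fin.
by case: ltgtP ab => // -> _; rewrite subrr.
Qed.

Let unif_out : unif (~` [set` `[0, 1[]) = 0%E.
Proof. by rewrite probability_setC// unif_itv// subr0 subee. Qed.

Let rword_event v : [set u | rword (size v) u = v] `&` [set` `[0, 1[] = [set` word_itv v].
Proof.
apply/seteqP; split=> u /=.
  rewrite in_itv /rword => -[+ u01]; rewrite (_ : clip u = u); last by rewrite /clip ifT.
  by move/(wordE u01 erefl).
move=> uv; have u01 := word_itv_sub uv; rewrite in_itv; split => //.
by rewrite /rword /clip ifT//; apply/wordE.
Qed.

Let rword_out k u : ~~ (0 <= u < 1) -> rword k u = rword k 1.
Proof. by rewrite /rword /clip => /negbTE ->; rewrite ltxx andbF. Qed.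

Lemma measurable_rword v : measurable [set u | rword (size v) u = v].
Proof.
rewrite -[X in measurable X](setUIDK _ [set` `[0, 1[]) rword_event.
apply: measurableU => //.
case: (pselect (rword (size v) 1 = v)) => h.
  rewrite (_ : _ `\` _ = ~` [set` `[0, 1[]); first exact: measurableC.
  apply/seteqP; split=> u /=; first by case.
  rewrite in_itv /= => /negP u01; split; last exact/negP.
  by rewrite rword_out.
rewrite (_ : _ `\` _ = set0)//; apply/seteqP; split=> u //= -[+ ].
rewrite in_itv /= => hu /negP u01; apply: h.
by rewrite -(rword_out _ u01).
Qed.

Lemma prob_rword v : unif [set u | rword (size v) u = v] = (M v)%:E.
Proof.
have mv := measurable_rword v.
rewrite -[X in unif X](setUIDK _ [set` `[0, 1[]) measureU; last first.
- by apply/seteqP; split=> u // -[[_ ?] []].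
- exact: measurableD.
- exact: measurableI.
have out0 : unif ([set u | rword (size v) u = v] `\` [set` `[0, 1[]) = 0%E.
  by apply/eqP; rewrite -measure_le0 -unif_out le_measure ?inE//; [exact: measurableD|exact: measurableC].
rewrite [X in (_ + X)%E]out0 adde0 rword_event.
have left0 w : 0 <= word_left w.
  by elim: w => //= e v' IH; rewrite addr_ge0// sumr_ge0.
rewrite [LHS]unif_itv ?lerDl//; first by rewrite addrC addKr.
elim: (v) => [|e v' IH] /=; first by rewrite M_nil add0r.
by have := partial_le v' e.+1; rewrite partialS; lra.
Qed.

End Words.

(** * Path weights split according to the coupling time *)

Fixpoint paths (S : finType) n : seq (seq S) :=
  if n is n'.+1 then [seq b :: p | b <- enum S, p <- paths S n'] else [:: [::]].

Section Paths.
Context (S : finType).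

Lemma mem_paths n p : (p \in paths S n) = (size p == n).
Proof.
elim: n p => [|n IHn] p; first by rewrite /= inE size_eq0.
apply/allpairsP/idP => [[[b p'] [_ /= + ->]]|]; first by rewrite IHn.
by case: p => // b p pn; exists (b, p); rewrite /= mem_enum IHn.
Qed.

Lemma uniq_paths n : uniq (paths S n).
Proof.
elim: n => //= n IHn; apply: allpairs_uniq => //; first exact: enum_uniq.
by move=> [b p] [b' p'] _ _ [-> ->].
Qed.

Lemma big_paths (R : realType) n (f : seq S -> R) :
  \sum_(p <- paths S n.+1) f p = \sum_b \sum_(p <- paths S n) f (b :: p).
Proof. by rewrite /= big_allpairs_dep big_enum. Qed.

End Paths.

(* Paths are reversed: the head of the list is the current position. *)
Section Laws.
Context (R : realType) (S : finType) (q : S -> S -> R).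
Hypothesis q_ge0 : forall a b, 0 <= q a b.
Hypothesis q_sum : forall a, \sum_b q a b = 1.

Fixpoint law (z : S) n b : R :=
  if n is n'.+1 then \sum_a law z n' a * q a b else (b == z)%:R.

Fixpoint path_prob (z : S) (p : seq S) : R :=
  if p is b :: p' then (if p' is a :: _ then path_prob z p' * q a b else (b == z)%:R) else 0.

Lemma law_ge0 z n b : 0 <= law z n b.
Proof. by elim: n b => [|n IHn] b /=; [rewrite ler0n|apply: sumr_ge0 => a _; rewrite mulr_ge0]. Qed.

Lemma law_sum z n : \sum_b law z n b = 1.
Proof.
elim: n => [|n IHn] /=; first by rewrite (bigD1 z)//= eqxx big1 ?addr0// => b /negbTE ->.
by rewrite exchange_big -[RHS]IHn; apply: eq_bigr => a _; rewrite -mulr_sumr q_sum mulr1.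
Qed.

Variables x y : S.

Definition common n b := Num.min (law x n b) (law y n b).
Definition excess z n b := law z n b - common n b.
(* The mass that becomes common to both laws at time n. *)
Definition fresh n b :=
  common n b - (if n is n'.+1 then \sum_a common n' a * q a b else 0).
(** The conditional probability of coupling on arrival at b at time n. By [incomingS] the
    denominator is, for n > 0, the mass arriving from uncoupled positions; where it vanishes the
    quotient is 0. *)
Definition rate z n b := fresh n b / (fresh n b + excess z n b).

Local Notation ends z := ((z == x) || (z == y)).

Lemma common_ge0 n b : 0 <= common n b.
Proof. by rewrite /common le_min !law_ge0. Qed.

Lemma excess_ge0 z n b : ends z -> 0 <= excess z n b.
Proof. by rewrite /excess subr_ge0 /common => /orP[]/eqP ->; rewrite ge_min lexx ?orbT. Qed.

Lemma excess_disjoint n b : 0 < excess x n b -> 0 < excess y n b -> False.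
Proof.
by rewrite /excess !subr_gt0 /common => h1 h2; move: h1 h2; rewrite minEle; case: ifP => _; rewrite ltxx.
Qed.

Lemma fresh_ge0 n b : 0 <= fresh n b.
Proof.
rewrite subr_ge0; case: n => [|n]; first exact: common_ge0.
rewrite {2}/common le_min; apply/andP; split; apply: ler_sum => a _;
  by rewrite ler_wpM2r// /common ge_min lexx ?orbT.
Qed.

Lemma incomingS z n b : fresh n.+1 b + excess z n.+1 b = \sum_a excess z n a * q a b.
Proof.
rewrite /fresh /excess /= addrC addrA subrK -sumrB.
by apply: eq_bigr => a _; rewrite mulrBl.
Qed.

Lemma rate01 z n b : ends z -> 0 <= rate z n b <= 1.
Proof.
move=> ze; have f0 := fresh_ge0 n b; have e0 := excess_ge0 n b ze.
have s0 := addr_ge0 f0 e0; apply/andP; split; first by rewrite /rate divr_ge0.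
move: s0; rewrite le_eqVlt => /orP[/eqP h|h]; first by rewrite /rate -h invr0 mulr0.
by rewrite /rate ler_pdivrMr// mul1r lerDl.
Qed.

Lemma rateE z n b : ends z -> (fresh n b + excess z n b) * rate z n b = fresh n b.
Proof.
move=> ze; have f0 := fresh_ge0 n b; have e0 := excess_ge0 n b ze.
rewrite /rate; case: (eqVneq (fresh n b + excess z n b) 0) => h; last by rewrite mulrC divfK.
by rewrite h mul0r; lra.
Qed.

(** The total variation distance of the two laws at time n. *)
Definition dist n := \sum_b excess x n b.

Lemma distE n : dist n = 1 - \sum_b common n b.
Proof. by rewrite /dist sumrB law_sum. Qed.

Lemma dist_right n : \sum_b excess y n b = dist n.
Proof. by rewrite distE sumrB law_sum. Qed.

Lemma dist_ge0 n : 0 <= dist n.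
Proof. by apply: sumr_ge0 => b _; apply: excess_ge0; rewrite eqxx. Qed.

Lemma fresh_sum n : \sum_b fresh n b = (if n is n'.+1 then dist n' else 1) - dist n.
Proof.
rewrite distE; case: n => [|n]; rewrite /fresh.
  by under eq_bigr do rewrite subr0; lra.
rewrite sumrB.
rewrite exchange_big /= distE; under [X in _ - X]eq_bigr do rewrite -mulr_sumr q_sum mulr1.
by lra.
Qed.

Lemma dist_noninc n p : (n <= p)%N -> dist p <= dist n.
Proof.
elim: p => [|p IHp]; first by rewrite leqn0 => /eqP ->.
rewrite leq_eqVlt => /orP[/eqP ->//|/IHp]; apply: le_trans.
by rewrite -subr_ge0 -(fresh_sum p.+1); apply: sumr_ge0 => b _; exact: fresh_ge0.
Qed.

(* The weights of the paths that have not coupled yet, and of those that couple at their end. *)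
Fixpoint alive z (p : seq S) : R :=
  if p is b :: p' then
    (if p' is a :: _ then alive z p' * q a b else (b == z)%:R) * (1 - rate z (size p') b)
  else 0.
Definition entering z (p : seq S) : R :=
  if p is b :: p' then (if p' is a :: _ then alive z p' * q a b else (b == z)%:R) else 0.
Definition killed z (p : seq S) : R := entering z p * rate z (size p).-1 (head x p).

Lemma alive_killed z p : alive z p + killed z p = entering z p.
Proof. by case: p => [|b p] /=; rewrite /killed /= ?mul0r ?addr0//; ring. Qed.

Lemma alive_ge0 z p : ends z -> 0 <= alive z p.
Proof.
move=> ze; elim: p => //= b p IHp; apply: mulr_ge0; last by have := rate01 (size p) b ze; lra.
by case: p IHp => [|a p] IHp; rewrite ?ler0n// mulr_ge0.
Qed.

Lemma entering_ge0 z p : ends z -> 0 <= entering z p.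
Proof. by move=> ze; case: p => [|b [|a p]] //=; rewrite ?ler0n// mulr_ge0// (alive_ge0 (a :: p)). Qed.

Lemma killed_ge0 z p : ends z -> 0 <= killed z p.
Proof.
by move=> ze; rewrite mulr_ge0 ?entering_ge0//; have /andP[] := rate01 (size p).-1 (head x p) ze.
Qed.

Lemma entering_sum z n b : ends z ->
  \sum_(p <- paths S n) entering z (b :: p) = fresh n b + excess z n b.
Proof.
move=> ze; elim: n b => [|n IHn] b.
  by rewrite /= big_seq1 /fresh /excess /=; ring.
rewrite big_paths incomingS; apply: eq_bigr => a _.
rewrite [LHS]/= -mulr_suml; congr (_ * _).
transitivity (\sum_(p <- paths S n) entering z (a :: p) * (1 - rate z n a)).
  rewrite big_seq [RHS]big_seq; apply: eq_bigr => p.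
  by rewrite mem_paths => /eqP <-.
rewrite -mulr_suml IHn mulrBr mulr1 rateE//; ring.
Qed.

Lemma killed_sum z n b : ends z -> \sum_(p <- paths S n) killed z (b :: p) = fresh n b.
Proof.
move=> ze; rewrite -[RHS](rateE _ _ ze) -entering_sum// mulr_suml.
by rewrite big_seq [RHS]big_seq; apply: eq_bigr => p; rewrite mem_paths => /eqP <-.
Qed.

Lemma alive_sum z n b : ends z -> \sum_(p <- paths S n) alive z (b :: p) = excess z n b.
Proof.
move=> ze; have := entering_sum n b ze; rewrite -(killed_sum n b ze).
by under eq_bigr do rewrite -alive_killed; rewrite big_split /=; lra.
Qed.

Lemma alive_excess z b p : ends z -> 0 < alive z (b :: p) -> 0 < excess z (size p) b.
Proof.
move=> ze; move/lt_le_trans; apply; rewrite -(alive_sum _ _ ze).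
rewrite (big_rem p) ?mem_paths//= lerDl; apply: sumr_ge0 => p' _; exact: (alive_ge0 (b :: p')).
Qed.

Lemma entering_gt0 z b p : ends z -> 0 < entering z (b :: p) ->
  (if p is [::] then b == z else true) && ((p == [::]) || (0 < alive z p)).
Proof.
move=> ze; case: p => [|a p]; first by rewrite /=; case: eqP => //; rewrite ltxx.
have -> : entering z [:: b, a & p] = alive z (a :: p) * q a b by [].
move=> h; rewrite orFb lt0r alive_ge0// andbT.
by apply: contraTneq h => ->; rewrite mul0r ltxx.
Qed.

Lemma alive_entering z p : ends z -> 0 < alive z p -> 0 < entering z p.
Proof. by move=> ze h; rewrite -alive_killed; have := killed_ge0 p ze; lra. Qed.

Lemma killed_entering z p : ends z -> 0 < killed z p -> 0 < entering z p.
Proof. by move=> ze h; rewrite -alive_killed; have := alive_ge0 p ze; lra. Qed.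

Lemma entering_alive_drop z p k : ends z -> 0 < entering z p -> (0 < k < size p)%N ->
  0 < alive z (drop k p).
Proof.
move=> ze; elim: p k => [|b p IHp] k // h; case: k => // k /andP[_]; rewrite ltnS => kp.
have /andP[_ /orP[/eqP p0|ap]] := entering_gt0 ze h; first by move: kp; rewrite p0.
case: k kp => [|k] kp; first by rewrite drop_cons drop0.
by rewrite drop_cons; apply: IHp; rewrite ?(alive_entering ze).
Qed.

Lemma entering_last z p : ends z -> 0 < entering z p -> last x p = z.
Proof.
move=> ze; elim: p => [|b p IHp]; first by rewrite /= ltxx.
move=> h; have := entering_gt0 ze h; case: p IHp h => [|a p] IHp h /=.
  by rewrite andbT => /eqP.
by move=> ap; apply: IHp; apply: alive_entering.
Qed.

Fixpoint reversed (s : nat -> S) n := if n is n'.+1 then s n :: reversed s n' else [:: s 0%N].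

Fixpoint step_prod (s : nat -> S) t k : R :=
  if k is k'.+1 then q (s t) (s t.+1) * step_prod s t.+1 k' else 1.

Lemma size_reversed s n : size (reversed s n) = n.+1.
Proof. by elim: n => //= n ->. Qed.

Lemma head_reversed s n a : head a (reversed s n) = s n.
Proof. by case: n. Qed.

Lemma nth_reversed s n i a : (i <= n)%N -> nth a (reversed s n) (n - i) = s i.
Proof.
elim: n => [|n IHn]; first by rewrite leqn0 => /eqP ->.
rewrite leq_eqVlt => /orP[/eqP ->|]; first by rewrite subnn.
by rewrite ltnS => lein; rewrite subSn//= IHn.
Qed.

(** The weight of coupling at time t while following s up to time n. For t > n only the beginning of
    the uncoupled path is prescribed; for t < n the common chain has to continue along s. *)
Definition coupled_part z s n t :=
  (\sum_(p <- paths S t.+1 | drop (t - n) p == reversed s (minn t n)) killed z p) * step_prod s t (n - t).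

Let step_prodS s t k : step_prod s t k.+1 = step_prod s t k * q (s (t + k)%N) (s (t + k).+1).
Proof. by elim: k t => [|k IHk] t; rewrite /= ?mul1r ?mulr1 ?addn0// -addSnnS -mulrA -IHk. Qed.

Let sum_pick n r (f : seq S -> R) : size r = n ->
  \sum_(p <- paths S n | p == r) f p = f r.
Proof.
move=> rn; rewrite big_mkcond (bigD1_seq r) ?uniq_paths ?mem_paths ?rn//= eqxx.
by rewrite big1 ?addr0// => p /negbTE ->.
Qed.

Let coupled_before z s n t : (t <= n)%N ->
  coupled_part z s n t = killed z (reversed s t) * step_prod s t (n - t).
Proof.
move=> tn; rewrite /coupled_part (eqP (tn : (t - n)%N == 0%N)) (minn_idPl tn).
under eq_bigl do rewrite drop0.
by rewrite sum_pick// size_reversed.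
Qed.

(** Increasing T by one moves mass from alive to killed paths without loss, since the rows of [q]
    sum to 1. For T = n it is an induction on the path, one step at a time. *)
Lemma path_prob_split z s n T : (n <= T)%N ->
  \sum_(t < T.+1) coupled_part z s n t +
  \sum_(p <- paths S T.+1 | drop (T - n) p == reversed s n) alive z p = path_prob z (reversed s n).
Proof.
move=> nT; rewrite -(subnK nT) addnC; elim: (T - n)%N => [|k IHk].
  rewrite addn0 subnn; under [X in _ + X]eq_bigl do rewrite drop0.
  rewrite sum_pick ?size_reversed//.
  elim: n {nT} => [|n IHn].
    by rewrite big_ord1 coupled_before// subnn mulr1 addrC alive_killed.
  have -> : path_prob z (reversed s n.+1) = path_prob z (reversed s n) * q (s n) (s n.+1).
    by case: (n).
  have e : entering z (reversed s n.+1) = alive z (reversed s n) * q (s n) (s n.+1).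
    by case: (n).
  have [r rE] : exists r, r = reversed s n.+1 by eexists.
  rewrite -rE in e *; rewrite big_ord_recr /= [X in _ + X + _]coupled_before// -rE subnn mulr1 -addrA.
  rewrite [X in _ + X]addrC alive_killed e.
  rewrite -IHn mulrDl mulr_suml; congr (_ + _); apply: eq_bigr => t _.
  have tn : (t <= n)%N by have := ltn_ord t; lia.
  rewrite !coupled_before//; last exact: leqW.
  by rewrite subSn// step_prodS subnKC// mulrA.
rewrite addnS big_ord_recr /= -addrA -IHk; congr (_ + _).
rewrite /coupled_part subSn ?leq_addr// addKn (minn_idPr _); last by rewrite -addnS leq_addr.
rewrite (_ : (n - (n + k).+1)%N = 0%N) ?mulr1; last by lia.
rewrite [X in X + _]big_mkcond [X in _ + X]big_mkcond -big_split big_paths exchange_big.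
rewrite [RHS]big_mkcond big_seq [RHS]big_seq; apply: eq_bigr => p; rewrite mem_paths.
case: p => [|a p] // _; case: ifP => h; last first.
  by rewrite big1// => b _; exact: addr0.
rewrite -[RHS]mulr1 -(q_sum a) mulr_sumr; apply: eq_bigr => b _.
by rewrite -[RHS]/(entering z [:: b, a & p]) -alive_killed [RHS]addrC.
Qed.

Lemma alive_le_dist z T (B : pred (seq S)) : ends z ->
  0 <= \sum_(p <- paths S T.+1 | B p) alive z p <= dist T.
Proof.
move=> ze; rewrite sumr_ge0/= => [|p _]; last exact: alive_ge0.
apply: (@le_trans _ _ (\sum_(p <- paths S T.+1) alive z p)).
  by rewrite [leRHS](bigID B)/= lerDl; apply: sumr_ge0 => p _; exact: alive_ge0.
rewrite big_paths; under eq_bigr do rewrite alive_sum//.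
by case/orP: ze => /eqP ->; rewrite ?dist_right.
Qed.

(* Given the coupling time, the two paths are drawn independently given their endpoint. *)
Definition pair_weight (pp : seq S * seq S) : R :=
  if pp is (z :: _, z' :: _) then
    (z == z')%:R * (killed x pp.1 * killed y pp.2 / fresh (size pp.1).-1 z) else 0.

Definition pairs t := [seq (p, p') | p <- paths S t.+1, p' <- paths S t.+1].

Lemma pair_weight_ge0 pp : 0 <= pair_weight pp.
Proof.
case: pp => -[|z p] [|z' p'] //=; rewrite mulr_ge0 ?ler0n// divr_ge0 ?fresh_ge0// mulr_ge0//.
  by apply: killed_ge0; rewrite eqxx.
by apply: killed_ge0; rewrite eqxx orbT.
Qed.

Let killed_fresh0 z b p : ends z -> fresh (size p) b = 0 -> killed z (b :: p) = 0.
Proof. by move=> ze f0; rewrite /killed /= /rate f0 mul0r mulr0. Qed.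

(** Summing over the partner path yields [fresh], which cancels the divisor; where [fresh] is 0 the
    killed weight is 0 as well. *)
Lemma pair_weight_left t (B : pred (seq S)) :
  \sum_(pp <- pairs t | B pp.1) pair_weight pp = \sum_(p <- paths S t.+1 | B p) killed x p.
Proof.
rewrite big_mkcond /pairs big_allpairs [RHS]big_mkcond big_seq [RHS]big_seq.
apply: eq_bigr => -[|z p]; rewrite mem_paths// => /eqP[pt] /=.
case: ifP => _; last by rewrite big1.
rewrite -/(paths S t.+1) big_paths (bigD1 z)//= [X in _ + X]big1 ?addr0 => [|b bz].
  rewrite eqxx; under eq_bigr do rewrite mul1r.
  rewrite -mulr_suml -mulr_sumr killed_sum ?eqxx ?orbT// pt.
  case: (eqVneq (fresh t z) 0) => f0; last by rewrite mulfK.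
  by rewrite killed_fresh0 ?eqxx ?pt// !mul0r.
by apply: big1 => p' _; rewrite eq_sym (negbTE bz) mul0r.
Qed.

Lemma pair_weight_right t (B : pred (seq S)) :
  \sum_(pp <- pairs t | B pp.2) pair_weight pp = \sum_(p <- paths S t.+1 | B p) killed y p.
Proof.
rewrite big_mkcond /pairs big_allpairs exchange_big [RHS]big_mkcond big_seq [RHS]big_seq.
apply: eq_bigr => -[|z p]; rewrite mem_paths// => /eqP[pt] /=.
case: ifP => _; last by rewrite big1.
rewrite -/(paths S t.+1) big_paths (bigD1 z)//= [X in _ + X]big1 ?addr0 => [|b bz].
  transitivity (\sum_(p' <- paths S t) killed x (z :: p') * killed y (z :: p) / fresh t z).
    rewrite big_seq [RHS]big_seq; apply: eq_bigr => p'; rewrite mem_paths => /eqP pt'.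
    by rewrite eqxx mul1r pt'.
  rewrite -mulr_suml -mulr_suml killed_sum ?eqxx//.
  case: (eqVneq (fresh t z) 0) => f0; last by rewrite mulrC mulrA mulVf ?mul1r.
  by rewrite killed_fresh0 ?eqxx ?orbT ?pt// mulr0 mul0r.
by apply: big1 => p' _; rewrite (negbTE bz) mul0r.
Qed.

Lemma pair_weight_sum t : \sum_(pp <- pairs t) pair_weight pp = \sum_b fresh t b.
Proof.
rewrite (pair_weight_left t xpredT) big_paths.
by apply: eq_bigr => b _; rewrite killed_sum// eqxx.
Qed.

Lemma pair_weight_gt0 pp : 0 < pair_weight pp ->
  [/\ 0 < killed x pp.1, 0 < killed y pp.2 & head x pp.1 = head x pp.2].
Proof.
case: pp => -[|z p] [|z' p'] /=; rewrite ?ltxx//; case: eqP => [<-|_]; last by rewrite mul0r ltxx.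
have kx : 0 <= killed x (z :: p) by apply: killed_ge0; rewrite eqxx.
have ky : 0 <= killed y (z :: p') by apply: killed_ge0; rewrite eqxx orbT.
rewrite mul1r => h; split=> //; rewrite lt0r ?kx ?ky andbT; apply/eqP => e; move: h.
  by rewrite e !mul0r ltxx.
by rewrite e mulr0 mul0r ltxx.
Qed.

(** Before the coupling time each path lies in the support of its own excess, and the two supports
    are disjoint. So the first meeting is exactly the drawn coupling time. *)
Lemma killed_disjoint t p p' k : size p = t.+1 -> size p' = t.+1 ->
  0 < killed x p -> 0 < killed y p' -> (k < t)%N -> nth x p (t - k) <> nth x p' (t - k).
Proof.
move=> pt pt' kp kp' kt.
have ax : 0 < alive x (drop (t - k) p).
  by apply: entering_alive_drop; rewrite ?killed_entering ?eqxx//; lia.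
have ay : 0 < alive y (drop (t - k) p').
  by apply: entering_alive_drop; rewrite ?killed_entering ?eqxx ?orbT//; lia.
rewrite (drop_nth x) in ax; last by lia.
rewrite (drop_nth x) in ay; last by lia.
move=> e; rewrite -e in ay.
have ex : 0 < excess x k (nth x p (t - k)).
  have := alive_excess _ ax; rewrite size_drop pt subnS.
  by rewrite (_ : (t.+1 - (t - k)).-1 = k); [apply; rewrite eqxx|lia].
apply: (excess_disjoint ex); have := alive_excess _ ay; rewrite size_drop pt' subnS.
by rewrite (_ : (t.+1 - (t - k)).-1 = k); [apply; rewrite eqxx orbT|lia].
Qed.

End Laws.

(** * Realisation of the maximal coupling on the unit interval *)

Section Coupling.
Context (R : realType) (S : finType) (q : S -> S -> R).
Hypothesis q_ge0 : forall a b, 0 <= q a b.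
Hypothesis q_sum : forall a, \sum_b q a b = 1.
Variables x y : S.
Local Notation fresh := (fresh q x y).
Local Notation dist := (dist q x y).
Local Notation pair_weight := (pair_weight q x y).
Local Notation killed := (killed q x y).
Hypothesis dist_vanishes : forall e, 0 < e -> exists t, dist t < e.

Let letter k := nth x (enum S) k.
(** An index out of range gives a pair of empty paths, whose weight is 0. *)
Let pair t c := nth ([::], [::]) (pairs S t) c.
Let step a k := if (k < #|S|)%N then q a (letter k) else 0.

Fixpoint chain_weight a (w : seq nat) : R :=
  if w is k :: w' then step a k * chain_weight (letter k) w' else 1.

(* The weight of a word encoding the coupling time t, the pair of paths up to
   that time, and the positions of the common chain after it. *)
Definition word_weight (w : seq nat) : R :=
  match w with
  | [::] => 1
  | [:: t] => \sum_b fresh t b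
  | t :: c :: w' => pair_weight (pair t c) * chain_weight (head x (pair t c).1) w'
  end.

Let weight v := word_weight (rev v).

Let chain_weight_ge0 a w : 0 <= chain_weight a w.
Proof. by elim: w a => //= k w IHw a; rewrite mulr_ge0// /step; case: ifP. Qed.

Let weight_ge0 v : 0 <= weight v.
Proof.
rewrite /weight; case: (rev v) => [|t [|c w]] //=.
  by apply: sumr_ge0 => b _; exact: fresh_ge0.
by rewrite mulr_ge0 ?pair_weight_ge0.
Qed.

Let sum_nth (T : Type) (d : T) (l : seq T) (F : T -> R) n : (size l <= n)%N ->
  \sum_(k < n) (if (nat_of_ord k < size l)%N then F (nth d l k) else 0) = \sum_(p <- l) F p.
Proof.
move=> ln; rewrite -big_mkcond (big_nth d) big_mkord.
by rewrite -(big_ord_widen_cond _ xpredT (fun i => F (nth d l i))).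
Qed.

Let cvg_stationary (u : nat -> R) l N : (forall n, (N <= n)%N -> u n = l) -> u @ \oo --> l.
Proof. by move=> ul; apply: cvg_near_cst; exists N => // n /= /ul. Qed.

Let pairE t c : pair_weight (pair t c) = if (c < size (pairs S t))%N then pair_weight (pair t c) else 0.
Proof. by case: ifP => // /negbT; rewrite -leqNgt /pair => ?; rewrite nth_default. Qed.

Let sum_step a n : (#|S| <= n)%N -> \sum_(k < n) step a k = 1.
Proof.
move=> Sn; rewrite -(q_sum a) -[RHS]big_enum -(@sum_nth _ x _ _ n) -?cardE//.
Qed.

Let chain_weight_rcons a w n : (#|S| <= n)%N ->
  \sum_(k < n) chain_weight a (rcons w (nat_of_ord k)) = chain_weight a w.
Proof.
move=> Sn; elim: w a => [|k w IHw] a /=; last by rewrite -mulr_sumr IHw.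
by under eq_bigr do rewrite mulr1; exact: sum_step.
Qed.

(** The sum telescopes to 1 - dist n. *)
Let fresh_cvg : (fun n => \sum_(t < n) \sum_b fresh t b) @ \oo --> (1 : R).
Proof.
rewrite -cvg_shiftS /=.
have E n : \sum_(t < n.+1) \sum_b fresh t b = 1 - dist n.
  elim: n => [|n IHn]; first by rewrite big_ord1 fresh_sum.
  by rewrite big_ord_recr /= IHn fresh_sum//; lra.
under eq_cvg do rewrite E.
apply/cvgrPdist_lt => e e0; have [t te] := dist_vanishes e0.
exists t => // n /= tn; rewrite subKr ger0_norm ?dist_ge0//.
by apply: le_lt_trans te; exact: dist_noninc.
Qed.

Let weight_sum v : (fun n => \sum_(e < n) weight (nat_of_ord e :: v)) @ \oo --> weight v.
Proof.
rewrite /weight; under eq_fun do under eq_bigr do rewrite rev_cons.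
case: (rev v) => [|t [|c w]] /=; first exact: fresh_cvg.
  apply: (@cvg_stationary _ _ (size (pairs S t))) => n tn.
  under eq_bigr do rewrite mulr1 pairE.
  by rewrite /pair (sum_nth _ pair_weight)// pair_weight_sum.
apply: (@cvg_stationary _ _ #|S|) => n Sn.
by rewrite -mulr_sumr chain_weight_rcons.
Qed.

Let weight_nil : weight [::] = 1. Proof. by []. Qed.

Local Notation P := (unif R).
Let rw := rword weight.
Let fw k u := rev (rw k u).

Let size_fw k u : size (fw k u) = k.
Proof. by rewrite size_rev size_rword. Qed.

Let fw_gt0 k u : 0 < word_weight (fw k u).
Proof. exact: (rword_gt0 weight_nil weight_sum). Qed.

Let take_fw k l u : (k <= l)%N -> fw k u = take k (fw l u).
Proof.
elim: l => [|l IHl]; first by rewrite leqn0 => /eqP ->; rewrite take0 /fw.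
rewrite leq_eqVlt => /orP[/eqP ->|kl]; first by rewrite take_oversize ?size_fw.
rewrite IHl//; have [e] := rwordS weight l u; rewrite /fw /rw => ->.
by rewrite rev_cons -cats1 take_cat size_rev size_rword; case: ltngtP (kl : (k <= l)%N) => // -> _;
  rewrite subnn take0 cats0 take_oversize// size_rev size_rword.
Qed.

Let measurable_fw k (B : set (seq nat)) : measurable ([set u | B (fw k u)] : set (measurableTypeR R)).
Proof.
rewrite (_ : [set u | _] = \bigcup_(v : seq nat)
    (if `[< B (rev v) /\ size v = k >] then [set u | rw (size v) u = v] else set0)).
  apply: countable_bigcupT_measurable => // v; case: ifP => // _.
  exact: (measurable_rword weight_ge0 weight_nil weight_sum).
apply/seteqP; split=> u /=.
  have sk : size (rw k u) = k by exact: size_rword.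
  by move=> Bu; exists (rw k u) => //; rewrite ifT /= ?sk//; apply/asboolP.
by move=> [v _]; case: ifP => // /asboolP[Bv <-] /= uv; rewrite /fw uv.
Qed.

Let prob_fw w : P [set u | fw (size w) u = w] = (word_weight w)%:E.
Proof.
rewrite -[in RHS](revK w) -/(weight (rev w)).
rewrite -(prob_rword weight_ge0 weight_nil weight_sum) size_rev.
congr (P _); apply/seteqP; split=> u /= h; first by rewrite -[in RHS]h revK.
by rewrite /fw /rw h revK.
Qed.

Definition coupled_at u := head 0%N (fw 1 u).

Let fw_cons n u : exists c w, [/\ fw n.+2 u = coupled_at u :: c :: w, size w = n,
  (c < size (pairs S (coupled_at u)))%N, 0 < pair_weight (pair (coupled_at u) c) &
  all (fun k => k < #|S|)%N w].
Proof.
have := fw_gt0 n.+2 u; have := size_fw n.+2 u.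
have : coupled_at u = head 0%N (fw n.+2 u).
  by rewrite /coupled_at (@take_fw 1 n.+2)//; case: (fw n.+2 u).
case: (fw n.+2 u) => [|t [|c w]] //= -> [wn] h; exists c, w.
have pw : 0 < pair_weight (pair t c).
  by rewrite lt0r pair_weight_ge0// andbT; apply: contraTneq h => ->; rewrite mul0r ltxx.
split=> //; first by move: pw; rewrite pairE; case: ifP; rewrite ?ltxx.
move: h; rewrite pmulr_rgt0//; elim: w (head x _) {wn} => //= k w IHw a.
rewrite {1}/step; case: ifP => [kS /=|_]; last by rewrite mul0r ltxx.
move=> h; apply: (IHw (letter k)); rewrite lt0r chain_weight_ge0 andbT.
by apply: contraTneq h => ->; rewrite mulr0 ltxx.
Qed.

Let measurable_coupled_at t : measurable ([set u | coupled_at u = t] : set (measurableTypeR R)).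
Proof. exact: (@measurable_fw 1 [set w | head 0%N w = t]). Qed.

Let prob_coupled_at t : P [set u | coupled_at u = t] = (\sum_b fresh t b)%:E.
Proof.
rewrite -[\sum_b _]/(word_weight [:: t]) -prob_fw; congr (P _).
apply/seteqP; split=> u /=; rewrite /coupled_at; last by move=> ->.
by have := size_fw 1 u; case: (fw 1 u) => [|t' []] //= _ ->.
Qed.

Let measurable_coupled_after t : measurable ([set u | (t < coupled_at u)%N] : set (measurableTypeR R)).
Proof. exact: (@measurable_fw 1 [set w | (t < head 0%N w)%N]). Qed.

Lemma prob_coupled_after t : P [set u | (t < coupled_at u)%N] = (dist t)%:E.
Proof.
rewrite (_ : [set u | _] = ~` \big[setU/set0]_(s < t.+1) [set u | coupled_at u = s]).
  rewrite probability_setC; last by apply: bigsetU_measurable => s _; exact: measurable_coupled_at.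
  rewrite measure_bigsetU_ord; last first.
  - by move=> i j _ _ [u [/= ui uj]]; apply: val_inj; rewrite /= -ui -uj.
  - by move=> s; exact: measurable_coupled_at.
  rewrite (eq_bigr (fun s => (\sum_b fresh (nat_of_ord s) b)%:E)) => [|s _]; last exact: prob_coupled_at.
  rewrite sumEFin -EFinB; congr (_%:E).
  elim: t => [|t IHt]; first by rewrite big_ord1 fresh_sum//=; lra.
  by rewrite big_ord_recr /= fresh_sum//; lra.
rewrite -bigcup_seq; apply/seteqP; split=> u /=.
  by move=> tu [s _ us]; move: tu; rewrite /= in us; rewrite us ltnNge -ltnS ltn_ord.
move=> h; rewrite ltnNge -ltnS; apply/negP => ut; apply: h.
by exists (Ordinal ut) => //=; rewrite mem_index_enum.
Qed.

(** Both marginals are treated at once: [sel] chooses the coordinate of the pair of paths and [z] is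
    its starting point. *)
Section Side.
Variables (sel : seq S * seq S -> seq S) (z : S).
Hypothesis z_end : (z == x) || (z == y).
Hypothesis sel_sum : forall t B, \sum_(pp <- pairs S t | B (sel pp)) pair_weight pp =
  \sum_(p <- paths S t.+1 | B p) killed z p.
Hypothesis sel_head : forall pp, 0 < pair_weight pp -> head x pp.1 = head x (sel pp).
Hypothesis sel_size : forall t pp, pp \in pairs S t -> size (sel pp) = t.+1.

(** Up to time t the position is read from the reversed path, whose head is time t; the letter with
    index j of the remaining word is the position at time t + 1 + j. *)
Let read n (w : seq nat) : S :=
  if w is t :: c :: w' then
    (if (n <= t)%N then nth x (sel (pair t c)) (t - n) else letter (nth 0%N w' (n - t.+1)))
  else x.

(** The coupling time, the pair and at most n further letters determine the position at time n. *)
Definition side n u := read n (fw n.+2 u).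

Let sideE n l u : (n.+2 <= l)%N -> side n u = read n (fw l u).
Proof.
move=> nl; rewrite /side (take_fw _ nl); have := size_fw l u.
case: (fw l u) => [|t [|c w]] //= wl; case: ifP => // nt.
by rewrite nth_take//; lia.
Qed.

Let cylinder s n := [set u | forall i, (i <= n)%N -> side i u = s i].

Let cylinderE s n : cylinder s n = [set u | forall i, (i <= n)%N -> read i (fw n.+2 u) = s i].
Proof.
by apply/seteqP; split=> u /= h i iln; rewrite -?(sideE (l := n.+2)) ?h// (@sideE i n.+2) ?h.
Qed.

Let measurable_cylinder s n : measurable (cylinder s n : set (measurableTypeR R)).
Proof. by rewrite cylinderE; exact: (@measurable_fw n.+2 [set w | forall i, (i <= n)%N -> read i w = s i]). Qed.

Let codes (s : nat -> S) n t := [seq index (s i) (enum S) | i <- iota t.+1 (n - t)].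

Let letter_index a : letter (index a (enum S)) = a.
Proof. by rewrite /letter nth_index// mem_enum. Qed.

Let index_letter k : (k < #|S|)%N -> index (letter k) (enum S) = k.
Proof. by move=> kS; rewrite /letter index_uniq ?enum_uniq// -cardE. Qed.

Let chain_weight_codes s n t : chain_weight (s t) (codes s n t) = step_prod q s t (n - t).
Proof.
rewrite /codes; move: (n - t)%N => k; elim: k t => //= k IHk t.
by rewrite letter_index IHk /step letter_index cardE index_mem mem_enum.
Qed.

Let cond s n t c := drop (t - n) (sel (pair t c)) == reversed s (minn t n).

Let part s n t c := if cond s n t c
  then [set u | fw (size (codes s n t)).+2 u = [:: t, c & codes s n t]] else set0.

Let size_codes s n t : size (codes s n t) = (n - t)%N.
Proof. by rewrite size_map size_iota. Qed.

Let readP s n t c w : size w = n -> (c < size (pairs S t))%N -> all (fun k => k < #|S|)%N w ->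
  (forall i, (i <= n)%N -> read i [:: t, c & w] = s i) <->
  cond s n t c /\ take (n - t) w = codes s n t.
Proof.
move=> wn ct wS; have pt : size (sel (pair t c)) = t.+1 by apply: sel_size; exact: mem_nth.
split=> [h|[/eqP cE wE] i iln /=].
  split.
    apply/eqP; apply: (@eq_from_nth _ x) => [|j].
      by rewrite size_drop size_reversed pt; lia.
    rewrite size_drop pt nth_drop => jt.
    have jm : (j <= minn t n)%N by lia.
    rewrite -{2}(subKn jm) nth_reversed ?leq_subr//.
    have im : (minn t n - j <= n)%N by lia.
    have := h _ im; rewrite /= ifT; last by lia.
    by move=> <-; congr nth; lia.
  apply: (@eq_from_nth _ 0%N) => [|j]; rewrite size_take_min; first by rewrite size_codes; lia.
  move=> jn; rewrite nth_take; last by lia.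
  rewrite (nth_map 0%N) ?size_iota ?nth_iota; [|lia..].
  have im : (t.+1 + j <= n)%N by lia.
  have := h _ im; rewrite /= ifF; last by lia.
  rewrite (_ : (t.+1 + j - t.+1)%N = j); last by lia.
  move=> <-; rewrite index_letter//; apply: (allP wS); apply: mem_nth; exact: leq_trans jn (geq_minr _ _).
case: leqP => ti.
  have := nth_reversed s x (_ : (i <= minn t n)%N) => <-; last by lia.
  rewrite -cE nth_drop; congr nth; lia.
have jn : (i - t.+1 < n - t)%N by lia.
rewrite -(nth_take _ jn) wE (nth_map 0%N) ?size_iota// nth_iota// letter_index.
by congr s; lia.
Qed.

Let cylinder_at s n t : cylinder s n `&` [set u | coupled_at u = t] =
  \big[setU/set0]_(c < size (pairs S t)) part s n t c.
Proof.
rewrite cylinderE -bigcup_seq; apply/seteqP; split=> u /=.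
  move=> [h ut]; have [c [w [fwE wn ct _ wS]]] := fw_cons n u.
  rewrite ut in ct fwE; rewrite fwE in h; exists (Ordinal ct); first by rewrite /= mem_index_enum.
  have [cd wE] := (readP s wn ct wS).1 h.
  rewrite /part /= cd /= (@take_fw _ n.+2) ?size_codes ?fwE /= ?wE//; lia.
move=> [c _]; rewrite /part; case: ifP => // cd /=.
have [c' [w [fwE wn ct _ wS]]] := fw_cons n u.
rewrite (@take_fw _ n.+2) ?size_codes ?fwE /= ?wE//; last by lia.
move=> [ut cE wE]; split=> //; rewrite ut cE in ct *.
by apply/readP.
Qed.

Let prob_part s n t c : P (part s n t c) =
  ((if cond s n t c then pair_weight (pair t c) else 0) * step_prod q s t (n - t))%:E.
Proof.
rewrite /part; case: ifP => cd; last by rewrite measure0 mul0r.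
rewrite -[(size _).+2]/(size [:: t, c & codes s n t]) prob_fw /=; congr (_%:E).
have := pair_weight_ge0 q_ge0 x y (pair t c); rewrite le_eqVlt => /orP[/eqP <-|pw]; first by rewrite !mul0r.
congr (_ * _); rewrite sel_head//.
case: (leqP n t) => nt; first by rewrite /codes (_ : (n - t)%N = 0%N)//; lia.
rewrite -chain_weight_codes; congr chain_weight.
move/eqP: cd; rewrite (_ : (t - n)%N = 0%N); last by lia.
by rewrite drop0 => ->; rewrite head_reversed; congr s; lia.
Qed.

Let measurable_part s n t c : measurable (part s n t c : set (measurableTypeR R)).
Proof.
rewrite /part; case: ifP => // _.
exact: (@measurable_fw _ [set w | w = [:: t, c & codes s n t]]).
Qed.

Let prob_cylinder_at s n t : P (cylinder s n `&` [set u | coupled_at u = t]) =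
  (coupled_part q x y z s n t)%:E.
Proof.
rewrite cylinder_at measure_bigsetU_ord; last first.
- move=> c c' _ _ [u []]; rewrite /part.
  by case: ifP => // _ /= e; case: ifP => // _ /=; rewrite e => -[] /val_inj.
- by move=> c; exact: measurable_part.
rewrite (eq_bigr (fun c => ((if cond s n t (nat_of_ord c) then pair_weight (pair t (nat_of_ord c)) else 0) *
  step_prod q s t (n - t))%:E)) => [|c _]; last exact: prob_part.
rewrite sumEFin -mulr_suml; congr (_ * _)%:E.
rewrite -(sel_sum t (fun p => drop (t - n) p == reversed s (minn t n))) [RHS]big_mkcond.
rewrite (big_nth ([::], [::])) big_mkord; exact: eq_bigr.
Qed.

(** Both sides are split by coupling times up to T, with equal terms; the two remainders lie in
    [0, dist T], which is arbitrarily small. *)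
Lemma prob_cylinder s n : P (cylinder s n) = (path_prob q z (reversed s n))%:E.
Proof.
have PE : P (cylinder s n) = (fine (P (cylinder s n)))%:E.
  by rewrite fineK// fin_num_measure//; exact: measurable_cylinder.
rewrite PE; congr (_%:E); apply/eqP; rewrite -subr_eq0 -normr_le0; apply/ler_addgt0Pl => e e0.
rewrite addr0; have [T0 Te] := dist_vanishes e0; pose T := maxn T0 n.
have {}Te : dist T <= e by apply: le_trans (ltW Te); apply: dist_noninc => //; exact: leq_maxl.
have nT : (n <= T)%N by exact: leq_maxr.
rewrite -(path_prob_split q_sum x y z s nT).
have /andP[r0 rT] := alive_le_dist q_ge0 q_sum T (fun p => drop (T - n) p == reversed s n) z_end.
move: r0 rT; set r := \sum_(p <- _ | _) _ => r0 rT.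
have mA := measurable_coupled_after T; have mC := measurable_cylinder s n.
set A := [set u | (T < coupled_at u)%N] in mA.
have [p pE] : exists p, P (cylinder s n `&` A) = p%:E.
  by exists (fine (P (cylinder s n `&` A))); rewrite fineK// fin_num_measure//; exact: measurableI.
have p0 : 0 <= p by rewrite -lee_fin -pE.
have pT : p <= dist T.
  rewrite -lee_fin -pE -prob_coupled_after; apply: le_measure; rewrite ?inE//.
  exact: measurableI.
have : (fine (P (cylinder s n)))%:E = ((\sum_(t < T.+1) coupled_part q x y z s n t) + p)%:E.
  rewrite -PE EFinD -pE (measureDI _ mC mA); congr (_ + _)%E.
  rewrite (_ : _ `\` _ = \big[setU/set0]_(t < T.+1) (cylinder s n `&` [set u | coupled_at u = t])).
    rewrite measure_bigsetU_ord; last first.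
    - by move=> i j _ _ [u [[/= _ ui] [_ uj]]]; apply: val_inj; rewrite /= -ui -uj.
    - by move=> t; apply: measurableI => //; exact: measurable_coupled_at.
    rewrite (eq_bigr (fun t => (coupled_part q x y z s n (nat_of_ord t))%:E)) => [|t _].
      by rewrite sumEFin.
    exact: prob_cylinder_at.
  rewrite -big_distrr/= -bigcup_seq setDE; congr (_ `&` _); apply/seteqP; split=> u /=.
    move=> /negP; rewrite -leqNgt -ltnS => ut.
    by exists (Ordinal ut) => //=; rewrite mem_index_enum.
  by move=> [t _ /= ut]; rewrite /A /= ut; apply/negP; rewrite -leqNgt -ltnS ltn_ord.
move=> [->]; rewrite ler_norml; lra.
Qed.

Lemma side_markov_chain : markov_chain q P side.
Proof.
split=> [n a|n s]; first exact: (@measurable_fw n.+2 [set w | read n w = a]).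
rewrite (prob_cylinder s n.+1) (prob_cylinder s n) -EFinM; congr (_%:E).
by case: n.
Qed.

End Side.

Let code u := nth 0%N (fw 2 u) 1.

Let pairing u := pair (coupled_at u) (code u).

Let pairing_gt0 u : 0 < pair_weight (pairing u) /\ pairing u \in pairs S (coupled_at u).
Proof.
have [c [w [e wn ct pw _]]] := fw_cons 0 u.
by rewrite /pairing /code e; split=> //; exact: mem_nth.
Qed.

Let side_cases sel n u : side sel n u =
  if (n <= coupled_at u)%N then nth x (sel (pairing u)) (coupled_at u - n)
  else letter (nth 0%N (fw n.+2 u) (n - coupled_at u).+1).
Proof.
have [c [w [e wn ct pw _]]] := fw_cons n u.
rewrite /side e /= /pairing /code (@take_fw 2 n.+2)// e /=.
by case: leqP => // tn; rewrite (_ : (n - coupled_at u)%N = (n - (coupled_at u).+1).+1)//; lia.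
Qed.

Let in_pairs t pp : pp \in pairs S t -> size pp.1 = t.+1 /\ size pp.2 = t.+1.
Proof.
by move=> /allpairsP[pq []]; rewrite !mem_paths => /eqP ? /eqP ? ->.
Qed.

Let x_end : (x == x) || (x == y). Proof. by rewrite eqxx. Qed.
Let y_end : (y == x) || (y == y). Proof. by rewrite eqxx orbT. Qed.

Let sides_meet u n : side fst n u = side snd n u <-> (coupled_at u <= n)%N.
Proof.
have [pw pin] := pairing_gt0 u; have [kx ky hd] := pair_weight_gt0 q_ge0 pw.
have [s1 s2] := in_pairs pin; rewrite !side_cases; case: (ltngtP n (coupled_at u)) => nt.
- by split=> // e; case: (killed_disjoint q_ge0 s1 s2 kx ky nt).
- by [].
- by rewrite nt subnn !nth0.
Qed.

Let side0 sel z u : (z == x) || (z == y) -> size (sel (pairing u)) = (coupled_at u).+1 ->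
  0 < killed z (sel (pairing u)) -> side sel 0 u = z.
Proof.
move=> ze sz kz; rewrite side_cases leq0n subn0.
by have := entering_last q_ge0 ze (killed_entering q_ge0 ze kz); rewrite -nth_last sz.
Qed.

Theorem maximal_coupling : exists (d : measure_display) (Om : measurableType d)
    (Pr : probability Om R) (X Y : nat -> Om -> S),
  [/\ coalescing_coupling q Pr X Y, forall u, X 0%N u = x /\ Y 0%N u = y &
      forall t, Pr [set u | (t%:R%:E < coupling_time R X Y u)%E] = (dist t)%:E].
Proof.
do 2 eexists; exists P, (side fst), (side snd); split.
- split.
  + apply: (side_markov_chain x_end) => [t B||t pp /in_pairs[]//].
    * exact: pair_weight_left.
    * by [].
  + apply: (side_markov_chain y_end) => [t B|pp pw|t pp /in_pairs[]//].
    * exact: pair_weight_right.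
    * by have [] := pair_weight_gt0 q_ge0 pw.
  + move=> u n /sides_meet un k nk; apply/sides_meet; exact: leq_trans nk.
- move=> u; have [pw pin] := pairing_gt0 u; have [kx ky _] := pair_weight_gt0 q_ge0 pw.
  by have [s1 s2] := in_pairs pin; split; exact: side0.
- move=> t; rewrite -prob_coupled_after; congr (P _); apply/seteqP; split=> u /=.
    move/first_time_gt => h; rewrite ltnNge; apply/negP => ut.
    by apply: (h _ ut); apply/sides_meet.
  move=> tu; apply/first_time_gt => n nt /sides_meet; lia.
Qed.

End Coupling.

(** * Duality between laws and the backward equation *)

Section Backward.
Context (R : realType) (S : finType) (q : S -> S -> R).

Fixpoint backward (f : S -> R) t (a : S) : R :=
  if t is t'.+1 then \sum_b q a b * backward f t' b else f a.

Lemma law_backward z f n t :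
  \sum_b law q z (n + t) b * f b = \sum_a law q z n a * backward f t a.
Proof.
elim: t n => [|t IHt] n /=; first by rewrite addn0.
rewrite -addSnnS IHt /=; under eq_bigr do rewrite mulr_suml.
rewrite exchange_big; apply: eq_bigr => a _ /=; rewrite mulr_sumr.
by apply: eq_bigr => b _; rewrite mulrA.
Qed.

Lemma law_expect z f t : \sum_b law q z t b * f b = backward f t z.
Proof.
rewrite -[t in LHS]add0n law_backward (bigD1 z)//= eqxx mul1r big1 ?addr0// => a /negbTE ->.
by rewrite mul0r.
Qed.

(** The distance is attained at the indicator of the points where the law from x exceeds the law
    from y. *)
Lemma dist_backward x y t : exists2 f : S -> R, (forall a, 0 <= f a <= 1) &
  dist q x y t = backward f t x - backward f t y.
Proof.
exists (fun b => (law q y t b < law q x t b)%R%:R).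
  by move=> a; rewrite ler0n/= lern1; case: (_ < _).
rewrite -!law_expect -sumrB; apply: eq_bigr => b _.
rewrite /excess /common; case: (ltP (law q y t b) (law q x t b)) => h.
  by rewrite /=; ring.
by rewrite /=; ring.
Qed.

End Backward.

(** * The chain as a walk on the circle *)

Section Chain.
Context (R : realType) (N : nat) (nu : 'I_N.+1 -> R).
Hypothesis N4 : (4 %| N)%N.
Hypothesis nu_pmf : inner_odd_pmf nu.
Let H := N./2.+1.
Local Notation q := (trans nu nu).

Let nu_ge0 z : 0 <= nu z. Proof. by case: nu_pmf. Qed.
Let nu_sum : \sum_z nu z = 1. Proof. by case: nu_pmf. Qed.

Let nu_eq0 (z : 'I_N.+1) : ~~ [&& odd z, (3 <= z)%N & (z + 3 <= N)%N] -> nu z = 0.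
Proof.
case: nu_pmf => _ _ ns zN; apply/eqP; move: zN; apply: contraNT => nz.
by apply: ns; rewrite lt0r nz nu_ge0.
Qed.

Let nu_nonempty : exists z, 0 < nu z.
Proof.
case: (pselect (exists z, 0 < nu z)) => // C; exfalso.
have := nu_sum; rewrite big1 => [/eqP|z _]; first by rewrite eq_sym oner_eq0.
by apply/eqP; rewrite eq_le nu_ge0 andbT leNgt; apply/negP => h; apply: C; exists z.
Qed.

Lemma inner_odd_ge8 : (8 <= N)%N.
Proof.
have [z nz] := nu_nonempty; have [_ _ /(_ z nz) /and3P[_ z3 zN]] := nu_pmf.
by case/dvdnP: N4 => k Nk; lia.
Qed.

Let HE : H.*2 = N.+2. Proof. by case/dvdnP: N4 => k Nk; rewrite /H; lia. Qed.
Let H_odd : odd H. Proof. by case/dvdnP: N4 => k Nk; rewrite /H Nk; lia. Qed.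
Let H_ge5 : (5 <= H)%N. Proof. by have := inner_odd_ge8; rewrite /H; lia. Qed.

(** The case distinction becomes a sum because nu has no mass on the end sites or on their
    neighbours. *)
Let transE (a b : 'I_N.+1) : q a b = (b == a :> nat)%:R * (1 / 2) + (b.+1 == a :> nat)%:R * (1 / 4) +
  (b == a.+1 :> nat)%:R * (1 / 4) + ((a == 0 :> nat) || (a == N :> nat))%:R * (1 / 4 * nu b).
Proof.
have N8 := inner_odd_ge8; have bN := ltn_ord b.
rewrite /trans -(inj_eq val_inj) /=.
have nu0 : [|| a == b :> nat, a.+1 == b | b.+1 == a] ->
    ((a == 0 :> nat) || (a == N :> nat))%:R * (1 / 4 * nu b) = 0.
  move=> near; case: (boolP ((a == 0 :> nat) || (a == N :> nat))) => ends; last by rewrite mul0r.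
  by rewrite nu_eq0 ?mulr0//; lia.
case: (eqVneq (nat_of_ord a) b) nu0 => ab.
  have -> : (b.+1 == a :> nat) = false by lia.
  have -> : (b == a.+1 :> nat) = false by lia.
  by move=> ->//=; ring.
case: (eqVneq a.+1 b) => ab1.
  have -> : (b.+1 == a :> nat) = false by lia.
  by move=> ->//=; ring.
case: (eqVneq b.+1 a) => ba1; first by move=> ->//=; ring.
by move=> _; case: eqP => _ /=; [|case: eqP => _ /=]; ring.
Qed.

Let pick (a : 'I_N.+1) (k : R) g : \sum_(b < N.+1) (b == a :> nat)%:R * k * g b = k * g a.
Proof.
rewrite (bigD1 a)//= eqxx mul1r big1 ?addr0// => b ba.
by rewrite (negbTE (ba : nat_of_ord b != a)) !mul0r.
Qed.

(** A step of the chain is a lazy walk step in which the missing neighbour of an end site carries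
    the mean under nu; on the circle that neighbour is the marked point. *)
Let sum_trans g (a : 'I_N.+1) : \sum_b q a b * g b = g a / 2 +
  (if a == 0 :> nat then \sum_b nu b * g b else g (inord a.-1)) / 4 +
  (if a == N :> nat then \sum_b nu b * g b else g (inord a.+1)) / 4.
Proof.
have N8 := inner_odd_ge8; have aN := ltn_ord a.
under eq_bigr do rewrite transE !mulrDl.
rewrite !big_split /= pick.
have -> : \sum_(b < N.+1) (b.+1 == a :> nat)%:R * (1 / 4) * g b =
    (if a == 0 :> nat then 0 else g (inord a.-1)) / 4.
  case: eqP => a0; first by rewrite mul0r big1// => b _; rewrite a0 !mul0r.
  transitivity (1 / 4 * g (inord a.-1)); last by field.
  rewrite -pick; apply: eq_bigr => b _; congr (_%:R * _ * _); congr nat_of_bool.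
  by rewrite inordK; lia.
have -> : \sum_(b < N.+1) (b == a.+1 :> nat)%:R * (1 / 4) * g b =
    (if a == N :> nat then 0 else g (inord a.+1)) / 4.
  case: eqP => a0.
    rewrite mul0r big1// => b _; rewrite (_ : (b == a.+1 :> nat) = false) ?mul0r//.
    by have := ltn_ord b; lia.
  transitivity (1 / 4 * g (inord a.+1)); last by field.
  rewrite -pick; apply: eq_bigr => b _; congr (_%:R * _ * _); congr nat_of_bool.
  by rewrite inordK//; lia.
have -> : \sum_(b < N.+1) ((a == 0 :> nat) || (a == N :> nat))%:R * (1 / 4 * nu b) * g b =
    ((a == 0 :> nat) || (a == N :> nat))%:R / 4 * \sum_b nu b * g b.
  by rewrite mulr_sumr; apply: eq_bigr => b _; field.
case: (eqVneq (nat_of_ord a) 0%N) => a0 /=.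
  have -> : (a == N :> nat) = false by lia.
  by field.
by case: ifP => _ /=; field.
Qed.

Lemma trans_ge0 a b : 0 <= q a b.
Proof. by rewrite transE !addr_ge0// mulr_ge0 ?ler0n ?mulr_ge0//; lra. Qed.

Lemma trans_sum a : \sum_b q a b = 1.
Proof.
have := sum_trans (fun=> 1) a; under eq_bigr do rewrite mulr1; move=> ->.
under eq_bigr do rewrite mulr1.
by rewrite nu_sum; do 2 case: ifP => _; field.
Qed.

(* The site a of the chain becomes the point a + 1 of the circle of length 2H. *)
Let weight z := if (0 < z < H.*2)%N then nu (inord z.-1) else 0.
Let lift (g : 'I_N.+1 -> R) z :=
  if (0 < z < H.*2)%N then g (inord z.-1) else \sum_a nu a * g a.

Let weight_lift g : \sum_(z < H.*2) weight z * lift g z = \sum_a nu a * g a.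
Proof.
rewrite HE big_ord_recl {1}/weight /= mul0r add0r; apply: eq_bigr => a _.
have aH : (a.+1 < H.*2)%N by rewrite HE; have := ltn_ord a; lia.
by rewrite /weight /lift /bump /= add1n aH /= inord_val.
Qed.

Let weight_gt0 h z : (forall a, 0 < nu a -> (h <= minn a (N - a))%N) -> 0 < weight z ->
  [/\ ~~ odd z, (4 <= z)%N, (z + 4 <= H.*2)%N & (h < z)%N && (z + h < H.*2)%N].
Proof.
rewrite /weight => hh; case: ifP => [zH wz|_]; last by rewrite ltxx.
have zN : (z.-1 < N.+1)%N by lia.
have := hh _ wz; have [_ _ /(_ _ wz)] := nu_pmf; rewrite !inordK// HE.
by case: z zH {wz} zN => // z /=; rewrite negbK => _ zN /and3P[-> ? ?]; split=> //; lia.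
Qed.

Let weight_ge0 z : 0 <= weight z.
Proof. by rewrite /weight; case: ifP. Qed.

Let weight_sum : \sum_(z < H.*2) weight z = 1.
Proof.
rewrite -nu_sum; have := weight_lift (fun=> 1); under [RHS]eq_bigr do rewrite mulr1.
move=> <-; apply: eq_bigr => z _; rewrite /weight /lift; case: ifP => _; first by rewrite mulr1.
by rewrite mul0r.
Qed.

Let lift_evolution h f : (0 < h)%N -> (forall a, 0 < nu a -> (h <= minn a (N - a))%N) ->
  (forall a, 0 <= f a <= 1) -> jump_evolution H h weight (fun t => lift (backward q f t)).
Proof.
move=> h0 hh f01; split.
- split=> [z|z wz| |z wz]; [exact: weight_ge0| | |].
  + by have [-> -> -> _] := weight_gt0 hh wz.
  + exact: weight_sum.
  + by have [_ _ _] := weight_gt0 hh wz.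
- move=> t z zH; rewrite /lift zH /heat zH.
  have zN : (z.-1 < N.+1)%N by lia.
  rewrite /= sum_trans inordK//.
  have -> : (0 < z.-1 < H.*2)%N = (z.-1 != 0)%N by lia.
  have -> : (z.+1 < H.*2)%N = (z.-1 != N)%N by lia.
  rewrite prednK; last by case/andP: zH.
  by case: eqP => _; case: eqP => _.
- by move=> t; rewrite /mean weight_lift.
- by move=> t; rewrite /lift ltnn andbF.
- move=> z _; rewrite /lift /=; case: ifP => // _.
  rewrite sumr_ge0 => [/=|a _]; last by rewrite mulr_ge0//; case/andP: (f01 a).
  by rewrite -nu_sum ler_sum// => a _; rewrite ler_piMr//; case/andP: (f01 a).
Qed.

Lemma dist_le_tail (x y : 'I_N.+1) t : (x < y)%N -> ~~ odd (y - x) ->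
  (forall a, 0 < nu a -> (y - x <= minn a (N - a))%N) -> dist q x y t <= tail R H 5 t.
Proof.
move=> xy eyx hyx; have h0 : (0 < y - x)%N by rewrite subn_gt0.
have [f f01 ->] := dist_backward q x y t.
apply: le_trans (ler_norm _) _; have yN := ltn_ord y.
have := sync_bound H_odd H_ge5 h0 eyx t (x := x.+1) (lift_evolution h0 hyx f01).
rewrite addSn subnKC; last exact: ltnW.
rewrite /lift !HE /= !ifT; [|lia..].
by rewrite /= !inord_val; apply; lia.
Qed.

End Chain.

Lemma rho_le (R : realType) (N : nat) (nu0 nuN : 'I_N.+1 -> R) a :
  0 < nu0 a + nuN a -> (rho nu0 nuN <= minn a (N - a))%N.
Proof.
move=> h; apply: (@leq_trans (\big[minn/N]_(z : 'I_N.+1 | (0 < nu0 z + nuN z)%R) minn z (N - z))).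
  by rewrite /rho; lia.
elim: (index_enum _) (mem_index_enum a) => // z l IHl.
rewrite inE big_cons => /orP[/eqP <-|/IHl al]; first by rewrite h geq_minl.
by case: ifP => // _; apply: leq_trans al; exact: geq_minr.
Qed.

Theorem theorem6 (R : realType) (N : nat) (hN : (0 < N)%N) (hN4 : (4 %| N)%N)
    (nu0 nuN : 'I_N.+1 -> R)
    (hnu0 : inner_odd_pmf nu0) (hnuN : inner_odd_pmf nuN)
    (hnu : nu0 = nuN)
    (x y : 'I_N.+1) (hxy : (x < y)%N)
    (heven : ~~ odd (y - x)) (hge2 : (2 <= y - x)%N)
    (hrho : (y - x <= rho nu0 nuN)%N) :
  exists (d : measure_display) (Om : measurableType d)
         (P : probability Om R) (X Y : nat -> Om -> 'I_N.+1),
    [/\ coalescing_coupling (trans nu0 nuN) P X Y,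
        forall w, X 0%N w = x /\ Y 0%N w = y &
        exists m : nat, (m <= 5)%N /\
          forall (d' : measure_display) (Om' : measurableType d')
                 (P' : probability Om' R) (T : 'I_m -> {RV P' >-> \bar R}),
            mutually_independent P' (fun i => T i : Om' -> \bar R) ->
            (forall i, distributed_as_T (N./2) P' (T i)) ->
            forall t : nat,
              (P [set w | t%:R%:E < coupling_time R X Y w]
               <= P' [set w | t%:R%:E < \sum_(i < m) T i w])%E].
Proof.
subst nuN; have N8 := inner_odd_ge8 hN4 hnu0.
have nu_rho a : 0 < nu0 a -> (y - x <= minn a (N - a))%N.
  by move=> a0; apply: leq_trans hrho _; apply: rho_le; rewrite addr_gt0.
have dist_le t := dist_le_tail hN4 hnu0 t hxy heven nu_rho.
have dist_vanishes e : 0 < e -> exists t, dist (trans nu0 nu0) x y t < e.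
  have HN : odd N./2.+1 /\ (5 <= N./2.+1)%N by case/dvdnP: hN4 => k Nk; lia.
  move=> e0; have [t te] := tail_vanishes HN.1 HN.2 5 e0.
  by exists t; apply: le_lt_trans te.
have [d [Om [P [X [Y [XY XY0 Pd]]]]]] :=
  maximal_coupling (trans_ge0 hN4 hnu0) (trans_sum hN4 hnu0) dist_vanishes.
exists d, Om, P, X, Y; split=> //; exists 5; split=> // d' Om' P' T Tind Tdist t.
(* T(N/2) is the exit time from (0, N/2 + 1), so the half-length of the circle matches H = L + 1
   with L = N/2. *)
rewrite Pd; apply: (@le_trans _ _ (tail R N./2.+1 5 t)%:E); first by rewrite lee_fin.
by apply: tail_le_prob_sum => //; lia.
Qed.
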